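(* Let $V$ be an open cone in $\mathbb{R}^d$ with vertex at the origin, and let $\{F_n\}_{n=0}^\infty$ be a sequence of distributions in $\mathcal{S}'(\mathbb{R}^d)$. Suppose there exists a smooth function $\psi\in\mathcal{D}(V\cap\mathbb{S})$ such that the generalized functions of one variable $f_n(r)=\langle F_n(r\omega),\psi(\omega)\rangle_\omega$ have extensions in $\mathcal{S}'_+$ that satisfy (P1) and (P2). Then for any arbitrary sequence of vectors $\{\mathbf{a}_n\}_{n=0}^\infty$ in a Fréchet space $\mathcal{X}$ the moment problem $$\langle F_n(\mathbf{x}),\phi(\mathbf{x})\rangle=\mathbf{a}_n,\quad n\in\mathbb{N},$$ has solutions $\phi\in\mathcal{S}(V,\mathcal{X})$.
   Context: $\mathbb{N}=\{0,1,2,\dots\}$. An open cone $V$ with vertex at the origin is an open set with $\lambda\mathbf{x}\in V$ whenever $\lambda>0$ and $\mathbf{x}\in V$. $\mathbb{S}$ is the unit sphere of $\mathbb{R}^d$; for $U\subseteq\mathbb{S}$ open, $\mathcal{D}(U)$ is the set of smooth functions on $\mathbb{S}$ whose support is contained in $U$. For a Fréchet space $\mathcal{X}$ (over $\mathbb{C}$), $\mathcal{S}(\mathbb{R}^d,\mathcal{X})\cong\mathcal{S}(\mathbb{R}^d)\widehat\otimes\mathcal{X}$ is the space of smooth $\boldsymbol\psi:\mathbb{R}^d\to\mathcal{X}$ such that $\{\mathbf{x}^{\mathbf{k}}\mathbf{D}^{\mathbf{m}}\boldsymbol\psi(\mathbf{x}):\mathbf{x}\in\mathbb{R}^d\}$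 is bounded in $\mathcal{X}$ for all multi-indices $\mathbf{k},\mathbf{m}$, and $\mathcal{S}(V,\mathcal{X})$ is the subspace of those with support contained in $\overline V$. For a scalar distribution $F\in\mathcal{S}'(\mathbb{R}^d)$, $\langle F,\phi\rangle\in\mathcal{X}$ is the element with $x'(\langle F,\phi\rangle)=\langle F,x'\circ\phi\rangle$ for all $x'\in\mathcal{X}'$. $\mathcal{S}(0,\infty)=\{\rho\in\mathcal{S}(\mathbb{R}):\operatorname{supp}\rho\subseteq[0,\infty)\}$ and $\mathcal{S}'(0,\infty)$ is its dual. For $F\in\mathcal{S}'(\mathbb{R}^d)$ and $\psi$ smooth on $\mathbb{S}$, $f(r)=\langle F(r\omega),\psi(\omega)\rangle_\omega\in\mathcal{S}'(0,\infty)$ is defined by $$\langle f(r),\rho(r)\rangle_r=\langle F(\mathbf{x}),|\mathbf{x}|^{1-d}\rho(|\mathbf{x}|)\psi(\mathbf{x}/|\mathbf{x}|)\rangle,\quad\rho\in\mathcal{S}(0,\infty).$$ $\mathcal{S}'_+$ is the space of tempered distributions on $\mathbb{R}$ with support in $[0,\infty)$; an extension of $f\in\mathcal{S}'(0,\infty)$ to $\mathcal{S}'_+$ is an element of $\mathcal{S}'_+$ agreeing with $f$ on $\mathcal{S}(0,\infty)$. $\mathcal{N}_0\subset\mathcal{S}'_+$ is the annihilator of $\mathcal{S}(0,\infty)$, i.e. the set of all finite linear combinations of the Dirac delta $\delta$ at the origin and its derivatives (including $0$). For $f\in\mathcal{S}'_+$ and $m\in\mathbb{N}$, $f^{(-m)}$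 denotes the $m$-primitive of $f$ lying in $\mathcal{S}'_+$ (the unique element of $\mathcal{S}'_+$ whose $m$-th derivative is $f$). Cesàro order symbols: for $f\in\mathcal{S}'_+$, $m\in\mathbb{N}$ and $\alpha>0$, $\alpha\notin\mathbb{Z}$: - $f(x)=O(x^\alpha)$ $(\mathrm{C},m)$, $x\to\infty$, means that $f^{(-m)}$ is a regular distribution (locally Lebesgue integrable function) for large arguments and there is a polynomial $P$ of degree at most $m-1$ such that $f^{(-m)}(x)=P(x)+O(x^{\alpha+m})$ as $x\to\infty$; - $f(x)=O(x^{-\alpha})$ $(\mathrm{C},m)$, $x\to0^+$, means that $f^{(-m)}$ is a locally Lebesgue integrable function on some interval $(0,\delta)$ and there is a polynomial $P$ of degree at most $m-1$ such that $f^{(-m)}(x)=P(x)+O(x^{-\alpha+m})$ as $x\to0^+$. For a sequence $\{f_n\}_{n=0}^\infty\subset\mathcal{S}'_+$: (P1): no element of $\mathcal{N}_0$ is a nontrivial linear combination of the $f_n$; that is, if $\sum_{n=0}^N b_nf_n\in\mathcal{N}_0$ with $b_n\in\mathbb{C}$, then $b_0=\dots=b_N=0$. (P2) (Cesàro admissibility): there is an increasing sequence $\{m_j\}_{j=0}^\infty$ of (non-negative) integers such that for every $j\in\mathbb{N}$ and every $\alpha>0$, $\alpha\notin\mathbb{Z}$, there exists $\nu=\nu_{j,\alpha}\in\mathbb{N}$ such that whenever $N\ge\nu$ and $b_0,\dots,b_N\in\mathbb{C}$ satisfy the three conditions: $\sum_{n=0}^N b_nf_n(x)=O(x^\alpha)$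 $(\mathrm{C},m_j)$, $x\to\infty$; the restriction of $\sum_{n=0}^N b_nf_n^{(-m_j)}$ to $(0,\infty)$ is a continuous function; and $\sum_{n=0}^N b_nf_n(x)=O(x^{-\alpha})$ $(\mathrm{C},m_j)$, $x\to0^+$; then $b_\nu=b_{\nu+1}=\dots=b_N=0$. *)

(* Defs.v *)
From HB Require Import structures.
From mathcomp Require Import all_boot all_order all_algebra.
From mathcomp Require Import all_classical all_reals all_analysis.
From mathcomp Require Import complex.
Set Implicit Arguments.
Unset Strict Implicit.
Unset Printing Implicit Defensive.
Import Order.TTheory GRing.Theory Num.Theory.
Import numFieldNormedType.Exports.
Local Open Scope classical_set_scope.
Local Open Scope complex_scope.
Local Open Scope ring_scope.

(* Complex scalars are written R[i]^o, the alias of R[i] that carries the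
   normed module and tvs structures. *)

Section Frechet.
Context (R : realType) (X : tvsType R[i]).

Definition seminorm (q : X -> R) : Prop :=
  [/\ forall x, 0 <= q x,
      forall x y, q (x + y) <= q x + q y &
      forall (a : R[i]) x, (q (a *: x))%:C = `|a| * (q x)%:C].

(* A tvsType comes with a uniformity that is only required to induce the
   topology, so completeness is expressed with the canonical uniformity of the
   topological group, i.e. with the neighborhoods of 0. Sequences suffice
   because the topology is first countable. *)
Definition tvs_cauchy (u : nat -> X) : Prop :=
  forall U : set X, nbhs 0 U ->
    exists N, forall m n, (N <= m)%N -> (N <= n)%N -> U (u m - u n).

Definition frechet : Prop :=
  [/\ hausdorff_space X,
      exists q : nat -> X -> R, (forall n, seminorm (q n)) /\
        forall U : set X, nbhs 0 U <->
          exists (N : nat) (eps : R), 0 < eps /\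
            [set x | forall n, (n <= N)%N -> q n x < eps] `<=` U &
      forall u : nat -> X, tvs_cauchy u -> exists l : X, u @ \oo --> l].

Definition tvs_bounded (B : set X) : Prop :=
  forall U : set X, nbhs 0 U ->
    \forall t \near (+oo_R : set_system R), B `<=` [set t%:C *: u | u in U].

End Frechet.

Section Derivative.
Context (R : realType) (E : lmodType R) (X : tvsType R[i]).
Implicit Types (v x : E) (f : E -> X).

(* Difference quotients in the real direction v; the library's derive requires
   domain and codomain to be modules over the same field. *)
Definition diff_quot v f x (h : R) : X := h^-1%:C *: (f (x + h *: v) - f x).

Definition rderivable v f x : Prop :=
  exists l : X, diff_quot v f x h @[h --> 0^'] --> l.

Definition rderive v f x : X :=
  xget 0 [set l : X | diff_quot v f x h @[h --> 0^'] --> l].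

End Derivative.

Definition supp (T : topologicalType) (V : nmodType) (f : T -> V) : set T :=
  closure [set x | f x != 0].

Section SchwartzRd.
Context (R : realType) (d : nat).
Local Notation Rd := 'rV[R]_d.

Section Vector.
Context (X : tvsType R[i]).
Implicit Type f : Rd -> X.

(* A multi-index is encoded as a word in the coordinates: the word s stands for
   the multi-index whose i-th component is the number of occurrences of i
   in s. *)
Definition monom (k : seq 'I_d) (x : Rd) : R := \prod_(i <- k) x 0 i.

Definition partial (m : seq 'I_d) f : Rd -> X :=
  foldr (fun i g => rderive (delta_mx 0 i : Rd) g) f m.

Definition smooth f : Prop := forall m : seq 'I_d,
  continuous (partial m f) /\
  forall (i : 'I_d) (x : Rd), rderivable (delta_mx 0 i : Rd) (partial m f) x.

Definition schwartz f : Prop := smooth f /\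
  forall k m : seq 'I_d,
    tvs_bounded (range (fun x : Rd => (monom k x)%:C *: partial m f x)).

Definition schwartz_in (V : set Rd) f : Prop :=
  schwartz f /\ supp f `<=` closure V.

End Vector.

(* The topology of S(R^d) is given by the seminorms
   sup_x |x^k D^m phi(x)|; this is the basic neighborhood of phi0. *)
Definition schwartz_nbhd (N : nat) (eps : R) (phi0 : Rd -> R[i]^o) :
    set (Rd -> R[i]^o) :=
  [set phi | schwartz phi /\ forall k m : seq 'I_d,
    (size k <= N)%N -> (size m <= N)%N -> forall x : Rd,
    `|(monom k x)%:C * partial m (phi - phi0) x| <= eps%:C].

(* Elements of S'(R^d) are functionals on all functions; only their values on
   Schwartz functions are meaningful. *)
Definition tempered (F : (Rd -> R[i]^o) -> R[i]^o) : Prop :=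
  (forall (a : R[i]) (phi1 phi2 : Rd -> R[i]^o),
     schwartz phi1 -> schwartz phi2 ->
     F (a *: phi1 + phi2) = a * F phi1 + F phi2) /\
  (forall phi0 : Rd -> R[i]^o, schwartz phi0 ->
     forall eps : R, 0 < eps -> exists (N : nat) (delta : R), 0 < delta /\
       forall phi, schwartz_nbhd N delta phi0 phi ->
         `|F phi - F phi0| < eps%:C).

Definition pairing_eq (X : tvsType R[i]) (F : (Rd -> R[i]^o) -> R[i]^o)
    (phi : Rd -> X) (a : X) : Prop :=
  forall x' : {linear X -> R[i]^o}, continuous x' -> x' a = F (x' \o phi).

Definition open_cone (V : set Rd) : Prop :=
  open V /\ forall (l : R) (x : Rd), 0 < l -> V x -> V (l *: x).

(* The library norm of 'rV[R]_d is the sup norm. *)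
Definition enorm (x : Rd) : R := Num.sqrt (\sum_i x 0 i ^+ 2).

Definition sphere : set Rd := [set x | enorm x = 1].

(* Functions on the sphere are functions on R^d considered on the sphere only;
   they are smooth when they are the restriction of a smooth function. *)
Definition smooth_on_sphere (psi : Rd -> R[i]^o) : Prop :=
  exists2 Psi : Rd -> R[i]^o, smooth Psi &
    forall w, sphere w -> psi w = Psi w.

Definition sphere_test (U : set Rd) (psi : Rd -> R[i]^o) : Prop :=
  smooth_on_sphere psi /\ closure [set w | sphere w /\ psi w != 0] `<=` U.

(* <F(r w), psi(w)>_w. The value at x = 0 of the function that F is applied to
   is 0 for rho in S(0, oo), since then rho 0 = 0. *)
Definition radial (F : (Rd -> R[i]^o) -> R[i]^o) (psi : Rd -> R[i]^o)
    (rho : R -> R[i]^o) : R[i]^o :=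
  F (fun x => (enorm x ^ (1 - d%:Z))%:C
              * rho (enorm x) * psi ((enorm x)^-1 *: x)).

End SchwartzRd.

Section OneVariable.
Context (R : realType).
Local Notation C := (R[i]^o).
Local Notation mu := (@lebesgue_measure R).
Implicit Types (rho h : R -> C) (f g : (R -> C) -> C).

Definition nderiv (n : nat) rho : R -> C :=
  iter n (fun g : R -> C => rderive (1 : R^o) g) rho.

Definition smooth1 rho : Prop := forall n,
  continuous (nderiv n rho) /\
  forall x : R, rderivable (1 : R^o) (nderiv n rho) x.

Definition schwartz1 rho : Prop := smooth1 rho /\
  forall k n, tvs_bounded (range (fun x : R => (x ^+ k)%:C *: nderiv n rho x)).

Definition schwartz1_pos rho : Prop :=
  schwartz1 rho /\ supp rho `<=` `[0, +oo[%classic.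

Definition test1 (U : set R) rho : Prop :=
  [/\ smooth1 rho, compact (supp rho) & supp rho `<=` U].

Definition schwartz1_nbhd (N : nat) (eps : R) (rho0 : R -> C) : set (R -> C) :=
  [set rho | schwartz1 rho /\ forall k n, (k <= N)%N -> (n <= N)%N ->
    forall x : R, `|(x ^+ k)%:C * nderiv n (rho - rho0) x| <= eps%:C].

Definition tempered1 f : Prop :=
  (forall (a : R[i]) rho1 rho2, schwartz1 rho1 -> schwartz1 rho2 ->
     f (a *: rho1 + rho2) = a * f rho1 + f rho2) /\
  (forall rho0, schwartz1 rho0 ->
     forall eps : R, 0 < eps -> exists (N : nat) (delta : R), 0 < delta /\
       forall rho, schwartz1_nbhd N delta rho0 rho ->
         `|f rho - f rho0| < eps%:C).

Definition Splus f : Prop :=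
  tempered1 f /\ forall rho, test1 `]-oo, 0[%classic rho -> f rho = 0.

Definition extends_radial g f : Prop :=
  forall rho, schwartz1_pos rho -> g rho = f rho.

Definition N0 f : Prop :=
  Splus f /\ forall rho, schwartz1_pos rho -> f rho = 0.

Definition dist_deriv (m : nat) g : (R -> C) -> C :=
  fun rho => (-1) ^+ m * g (nderiv m rho).

(* f^(-m); for f in S'_+ it is unique up to its values on functions that are
   not Schwartz. *)
Definition primitive (m : nat) f : (R -> C) -> C :=
  xget 0 [set g | Splus g /\
                  forall rho, schwartz1 rho -> dist_deriv m g rho = f rho].

Definition cintegral (D : set R) h : C :=
  (\int[mu]_(x in D) complex.Re (h x)) +i* (\int[mu]_(x in D) complex.Im (h x)).

(* On the open set D, f is the regular distribution given by h. *)
Definition regular_on (D : set R) f h : Prop :=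
  [/\ locally_integrable D (fun x => complex.Re (h x)),
      locally_integrable D (fun x => complex.Im (h x)) &
      forall rho, test1 D rho -> f rho = cintegral D (fun x => h x * rho x)].

Definition bigO_pow (F : set_system R) h (beta : R) : Prop :=
  exists k : R, \forall x \near F, `|h x| <= (k * x `^ beta)%:C.

(* f(x) = O(x^alpha) (C, m) as x -> oo *)
Definition cesaro_infty (m : nat) (alpha : R) f : Prop :=
  exists (A : R) (h : R -> C) (P : {poly R[i]}),
    [/\ regular_on `]A, +oo[%classic (primitive m f) h,
        (size P <= m)%N &
        bigO_pow +oo_R (fun x => h x - P.[x%:C]) (alpha + m%:R)].

(* f(x) = O(x^(- alpha)) (C, m) as x -> 0+ *)
Definition cesaro_zero (m : nat) (alpha : R) f : Prop :=
  exists (delta : R) (h : R -> C) (P : {poly R[i]}),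
    [/\ 0 < delta,
        regular_on `]0, delta[%classic (primitive m f) h,
        (size P <= m)%N &
        bigO_pow 0^'+ (fun x => h x - P.[x%:C]) (- alpha + m%:R)].

Definition continuous_on_pos f : Prop :=
  exists2 h : R -> C,
    forall x : R, 0 < x -> {for x, continuous h} &
    regular_on `]0, +oo[%classic f h.

Definition P1 (f : nat -> (R -> C) -> C) : Prop :=
  forall (N : nat) (b : nat -> R[i]),
    N0 (\sum_(n < N.+1) b n *: f n) -> forall n, (n <= N)%N -> b n = 0.

Definition P2 (f : nat -> (R -> C) -> C) : Prop :=
  exists m : nat -> nat, {homo m : i j / (i < j)%N} /\
  forall (j : nat) (alpha : R), 0 < alpha -> alpha \isn't a Num.int ->
  exists nu : nat, forall (N : nat) (b : nat -> R[i]), (nu <= N)%N ->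
    cesaro_infty (m j) alpha (\sum_(n < N.+1) b n *: f n) ->
    continuous_on_pos (\sum_(n < N.+1) b n *: primitive (m j) (f n)) ->
    cesaro_zero (m j) alpha (\sum_(n < N.+1) b n *: f n) ->
    forall n, (nu <= n <= N)%N -> b n = 0.

End OneVariable.

(* Main.v *)
(* The radial lift rho |-> |x|^(1-d) rho(|x|) psi(x/|x|) maps S(0,oo) continuously into
   S(V) and turns <F_n, .> into f_n, which reduces the problem to one variable.

   Fix j. If a combination g of the f_n is bounded on S(0,oo) by the seminorm of order j,
   then for m large its m-primitive is a continuous function of polynomial growth on
   (0,oo): g is a bounded functional of the derivative of order m-2, the Hahn-Banach
   theorem extends it to the kernels (x - t)_+, and the values there give the function.
   So (P2) applies to g and annihilates its coefficients of index >= nu_j. Hence for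
   n >= nu_j no f_n + sum_(k < n) b_k f_k is bounded for this seminorm, which yields rho_n
   with arbitrarily small seminorm, f_n(rho_n) = 1 and f_k(rho_n) = 0 for k < n; for the
   remaining n, (P1) yields such a rho_n without smallness.

   With c_n = a_n - sum_(k < n) f_n(rho_k) c_k, and rho_n small enough compared with c_n,
   the sum of the radial lifts of rho_n times c_n converges in S(V,X) and solves the
   problem. *)

(* (P2) speaks only of primitives of the prescribed orders m_j, whereas boundedness is measured by
   Schwartz seminorms. Since m is strictly increasing, m_(J+2) = M + 2 with M >= J. For test
   functions supported in (0,oo) the seminorm of order J is dominated by a weighted supremum of the
   single derivative of order M: lower derivatives are recovered by integrating from the right end
   of the support, at the cost of one power of 1 + x each time. The two remaining orders are those
   spent on the kernels.

   The density obtained from the kernels is correct only on derivatives of order M + 2. The defect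
   annihilates these derivatives, hence is a polynomial on (0,oo), and adding it keeps continuity
   and polynomial growth. A large non-integer alpha then gives both Cesaro conditions with zero
   polynomial.

   Smallness of rho_n in the seminorm of order j is available only for n >= max(j, nu_j). This omits
   finitely many n for each j, which does not affect convergence.

   Pairings with densities are written as increments of antiderivatives until [regular_on] has to be
   established. *)
Require Import Defs.
From HB Require Import structures.
From mathcomp Require Import all_boot all_order all_algebra.
From mathcomp Require Import all_classical all_reals all_analysis.
From mathcomp Require Import measurable_realfun complex ring lra.
Set Implicit Arguments.
Unset Strict Implicit.
Unset Printing Implicit Defensive.
Import Order.TTheory GRing.Theory Num.Theory.
Import numFieldNormedType.Exports.
Local Open Scope classical_set_scope.
Local Open Scope complex_scope.
Local Open Scope ring_scope.

(** * Complex limits and directional derivatives *)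

(* The library norm of [R[i]] takes values in [R[i]]; this one is real. *)
Notation nrm z := (Normc.normc z).

Section ComplexLimits.
Context {R : realType}.
Local Notation C := (R[i]^o).
Implicit Types z w : R[i].

Lemma normcNc z : `|z| = (nrm z)%:C. Proof. by case: z => a b; rewrite normc_def. Qed.

Lemma nrm_ge0 z : 0 <= nrm z.
Proof. by have := normr_ge0 z; rewrite normcNc ler0c. Qed.

Lemma nrmD z w : nrm (z + w) <= nrm z + nrm w.
Proof. by rewrite -lecR rmorphD /= -!normcNc ler_normD. Qed.

Lemma nrmM z w : nrm (z * w) = nrm z * nrm w.
Proof. exact: Normc.normcM. Qed.

Lemma nrmN z : nrm (- z) = nrm z.
Proof. by apply: (@complexI R); rewrite -!normcNc normrN. Qed.

Lemma nrmB z w : nrm (z - w) <= nrm z + nrm w.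
Proof. by rewrite -(nrmN w) nrmD. Qed.

Lemma nrmBC z w : nrm (z - w) = nrm (w - z).
Proof. by rewrite -nrmN opprB. Qed.

Lemma nrm_real (x : R) : nrm x%:C = `|x|.
Proof. by rewrite /Normc.normc /= expr0n addr0 sqrtr_sqr. Qed.

Lemma nrm0 : nrm (0 : R[i]) = 0. Proof. exact: Normc.normc0. Qed.

Lemma nrm1 : nrm (1 : R[i]) = 1. Proof. exact: Normc.normc1. Qed.

Lemma nrm_eq0 z : nrm z = 0 -> z = 0.
Proof. exact: Normc.eq0_normc. Qed.

Lemma nrm_Re z : `|complex.Re z| <= nrm z.
Proof. by rewrite -lecR -normcNc normc_ge_Re. Qed.

Lemma nrm_Im z : `|complex.Im z| <= nrm z.
Proof.
have := nrm_Re (z * 'i%C); rewrite ReiNIm normrN => /le_trans; apply.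
by rewrite nrmM (_ : nrm 'i%C = 1) ?mulr1// /Normc.normc /= expr0n add0r expr1n sqrtr1.
Qed.

Lemma nrm_ReIm z : nrm z <= `|complex.Re z| + `|complex.Im z|.
Proof.
rewrite {1}(complexE z); apply: (le_trans (nrmD _ _)).
rewrite nrmM !nrm_real (_ : nrm 'i%C = 1) ?mul1r//.
by rewrite /Normc.normc /= expr0n add0r expr1n sqrtr1.
Qed.

Lemma cvgCP (T : Type) (F : set_system T) {FF : Filter F} (f : T -> C) (l : C) :
  f @ F --> l <-> forall e : R, 0 < e -> \forall t \near F, nrm (f t - l) < e.
Proof.
rewrite cvgrPdist_lt; split=> h e e0.
  have := h e%:C; rewrite ltcR => /(_ e0); apply: filterS => t.
  by rewrite normcNc ltcR nrmBC.
(* A positive radius in [R[i]] has zero imaginary part, so real radii suffice. *)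
move: e0; case: e => a b; rewrite ltcE /= => /andP[/eqP -> a0].
have := h a a0; apply: filterS => t ht.
by rewrite complexr0 normcNc ltcR nrmBC.
Qed.

Lemma cvgC_ReIm (T : Type) (F : set_system T) {FF : Filter F} (f : T -> C)
    (l : C) :
  f @ F --> l <-> (complex.Re (f t) @[t --> F] --> complex.Re l /\
                   complex.Im (f t) @[t --> F] --> complex.Im l).
Proof.
rewrite cvgCP; split=> [h|[h1 h2] e e0].
  split; apply/cvgrPdist_lt => e /h; apply: filterS => t ht; rewrite distrC;
    apply: le_lt_trans ht.
    by rewrite -raddfB; exact: nrm_Re.
  by rewrite -raddfB; exact: nrm_Im.
have e2 : 0 < e / 2 by rewrite divr_gt0.
move/cvgrPdist_lt : h1 => /(_ _ e2) h1; move/cvgrPdist_lt : h2 => /(_ _ e2) h2.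
near=> t; apply: (le_lt_trans (nrm_ReIm _)); rewrite (splitr e) ltrD// raddfB/= distrC.
  by near: t.
by near: t.
Unshelve. all: by end_near. Qed.

Lemma continuousCP (T : topologicalType) (f : T -> C) (x : T) :
  {for x, continuous f} <->
  ({for x, continuous (fun t => complex.Re (f t))} /\
   {for x, continuous (fun t => complex.Im (f t))}).
Proof. exact: cvgC_ReIm. Qed.


Lemma cvgCD (T : Type) (F : set_system T) {FF : Filter F} (f g : T -> C) (a b : C) :
  f @ F --> a -> g @ F --> b -> (f t + g t) @[t --> F] --> a + b.
Proof. exact: (@cvgD R[i] C T F FF f g a b). Qed.

Lemma cvgCM (T : Type) (F : set_system T) {FF : Filter F} (f g : T -> C) (a b : C) :
  f @ F --> a -> g @ F --> b -> (f t * g t) @[t --> F] --> a * b.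
Proof. exact: (@cvgM R[i] T F FF f g a b). Qed.

Lemma cvgCN (T : Type) (F : set_system T) {FF : Filter F} (f : T -> C) (a : C) :
  f @ F --> a -> (- f t) @[t --> F] --> - a.
Proof. exact: (@cvgN R[i] C T F FF f a). Qed.

Lemma cvgC_near_eq (T : Type) (F : set_system T) {FF : Filter F} (f g : T -> C) (a : C) :
  (\forall t \near F, f t = g t) -> f @ F --> a -> g @ F --> a.
Proof. by move=> fg; apply: cvg_trans; exact: near_eq_cvg. Qed.

End ComplexLimits.

Section DirectionalDerivative.
Context {R : realType}.
Local Notation C := (R[i]^o).

(** The relational form of the derivative: the rules below never mention the choice made by
    [rderive], which is recovered at the end by uniqueness of limits. *)
Definition isd (E : lmodType R) (X : tvsType R[i]) (v : E) (f : E -> X) (x : E) (l : X) : Prop :=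
  diff_quot v f x h @[h --> 0^'] --> l.

Lemma rderiveE (E : lmodType R) (X : tvsType R[i]) (v : E) (f : E -> X) x l :
  hausdorff_space X -> isd v f x l -> rderive v f x = l.
Proof.
move=> hX h; rewrite /rderive; apply: xget_unique => // l' h'.
exact: cvg_unique h' h.
Qed.

Lemma rderiveEC (E : lmodType R) (v : E) (f : E -> C) x l :
  isd v f x l -> rderive v f x = l.
Proof. by apply: rderiveE; exact: norm_hausdorff. Qed.

Lemma rderivableE (E : lmodType R) (v : E) (f : E -> C) x :
  rderivable v f x -> isd v f x (rderive v f x).
Proof. by move=> [l hl]; rewrite (rderiveEC hl). Qed.

(** The bridge to real one-variable calculus: the mean value theorem and the fundamental theorem are
    applied to the two components. *)
Lemma isd1_ReIm (f : R -> C) (x : R) (l : C) :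
  isd (1 : R^o) f x l <->
  (is_derive x 1 (fun t => complex.Re (f t)) (complex.Re l) /\
   is_derive x 1 (fun t => complex.Im (f t)) (complex.Im l)).
Proof.
have E1 (h : R) : complex.Re (diff_quot (1 : R^o) f x h) =
    h^-1 *: (((fun t => complex.Re (f t)) \o shift x) (h *: 1) - complex.Re (f x)).
  rewrite /diff_quot /= -raddfB.
  rewrite /shift /= addrC /GRing.scale/=.
  by rewrite mulr1 [x + h]addrC (addrC (- f x)); case: (f _ - _) => a b /=; rewrite mul0r subr0.
have E2 (h : R) : complex.Im (diff_quot (1 : R^o) f x h) =
    h^-1 *: (((fun t => complex.Im (f t)) \o shift x) (h *: 1) - complex.Im (f x)).
  rewrite /diff_quot /= -raddfB.
  rewrite /shift /= addrC /GRing.scale/=.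
  by rewrite mulr1 [x + h]addrC (addrC (- f x)); case: (f _ - _) => a b /=; rewrite mul0r addr0.
rewrite /isd cvgC_ReIm; split=> -[].
  under eq_fun do rewrite E1.
  move=> h1; under eq_fun do rewrite E2.
  move=> h2; split; split.
  - by apply/cvg_ex; exists (complex.Re l).
  - by apply: cvg_lim => //; exact: norm_hausdorff.
  - by apply/cvg_ex; exists (complex.Im l).
  - by apply: cvg_lim => //; exact: norm_hausdorff.
move=> h1 h2; under eq_fun do rewrite E1; under [X in _ /\ (X @ _ --> _)]eq_fun do rewrite E2.
split.
  by have [d1 <-] := h1.
by have [d2 <-] := h2.
Qed.


Section Rules.
Context (E : lmodType R) (v : E).
Implicit Types (f g : E -> C) (x : E).

Lemma isd_cst (c : C) x : isd v (fun _ => c) x 0.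
Proof.
rewrite /isd /diff_quot; under eq_fun do rewrite subrr scaler0.
exact: cvg_cst.
Qed.

Lemma isdD f g x (l l' : C) :
  isd v f x l -> isd v g x l' -> isd v (fun y => f y + g y) x (l + l').
Proof.
move=> hf hg; rewrite /isd.
rewrite (_ : diff_quot _ _ _ = (fun h => diff_quot v f x h + diff_quot v g x h)).
  exact: cvgCD hf hg.
by apply: funext => h; rewrite /diff_quot -scalerDr opprD addrACA.
Qed.

Lemma isdN f x (l : C) : isd v f x l -> isd v (fun y => - f y) x (- l).
Proof.
move=> hf; rewrite /isd.
rewrite (_ : diff_quot _ _ _ = (fun h => - diff_quot v f x h)).
  exact: cvgCN hf.
by apply: funext => h; rewrite /diff_quot -scalerN opprD.
Qed.

Lemma isd_shift f x (l : C) : isd v f x l -> f (x + h *: v) @[h --> 0^'] --> f x.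
Proof.
move=> hf; rewrite -[X in _ --> X]addr0 -[X in _ + X](mul0r l).
have h0 : (h%:C : C) @[h --> (0:R)^'] --> (0 : C).
  apply/cvgCP => e e0; near=> h; rewrite subr0 nrm_real.
  by near: h; exact: dnbhs0_lt.
apply: (cvgC_near_eq _ (cvgCD (cvg_cst (f x)) (cvgCM h0 hf))); near=> h.
have hn0 : h != 0 by near: h; exact: nbhs_dnbhs_neq.
rewrite /= /diff_quot /= /GRing.scale /= mulrA -rmorphM divff//= mul1r.
by rewrite addrC subrK.
Unshelve. all: by end_near. Qed.

Lemma isdM f g x (l l' : C) :
  isd v f x l -> isd v g x l' ->
  isd v (fun y => f y * g y) x (l * g x + f x * l').
Proof.
move=> hf hg; rewrite /isd.
rewrite (_ : diff_quot _ _ _ = (fun h => diff_quot v f x h * g (x + h *: v) +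
  f x * diff_quot v g x h)).
  exact: cvgCD (cvgCM hf (isd_shift hg)) (cvgCM (cvg_cst _) hg).
by apply: funext => h; rewrite /diff_quot /GRing.scale /=; ring.
Qed.

Lemma isdZ (c : C) f x (l : C) : isd v f x l -> isd v (fun y => c * f y) x (c * l).
Proof.
move=> hf; have := isdM (isd_cst c x) hf; rewrite mul0r add0r; exact.
Qed.

Lemma isd_sum (I : Type) (s : seq I) (P : pred I) (f : I -> E -> C) (l : I -> C) x :
  (forall i, isd v (f i) x (l i)) ->
  isd v (fun y => \sum_(i <- s | P i) f i y) x (\sum_(i <- s | P i) l i).
Proof.
move=> h; elim: s => [|i s IH].
  under eq_fun do rewrite big_nil; rewrite big_nil; exact: isd_cst.
rewrite big_cons (_ : (fun y => _) = (fun y =>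
  if P i then f i y + \sum_(j <- s | P j) f j y else \sum_(j <- s | P j) f j y)).
  case: (P i); last exact: IH.
  exact: (isdD (h i) IH).
by apply: funext => y; rewrite big_cons.
Qed.

Lemma isd_comp (G : R -> C) (r : E -> R) x (dr : R) (l : C) :
  isd v (fun y => (r y)%:C : C) x (dr%:C) -> isd (1 : R^o) G (r x) l ->
  isd v (fun y => G (r y)) x (dr%:C * l).
Proof.
move=> hr hG.
(* Caratheodory's device: [q] extends the difference quotient continuously to the increment 0, so an
   increment of [r] that vanishes for some [h] causes no division by zero. *)
pose q s : C := if s == 0 then l else diff_quot (1 : R^o) G (r x) s.
have qc : q s @[s --> (0 : R)] --> l.
  apply/cvgCP => e e0; move/cvgCP : hG => /(_ e e0).
  rewrite !near_simpl => -[d /= d0 hd]; exists d => //= s sd.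
  rewrite /q; case: eqP => [_|/eqP s0]; first by rewrite subrr nrm0.
  exact: hd.
have hrs : r (x + h *: v) - r x @[h --> 0^'] --> (0 : R).
  have := isd_shift hr; rewrite cvgC_ReIm /= => -[h1 _].
  by rewrite -[X in _ --> X](subrr (r x)); exact: (cvgB h1 (cvg_cst (r x))).
have qr := cvg_comp _ _ hrs qc.
rewrite /isd (_ : diff_quot _ _ _ = (fun h => diff_quot v (fun y => (r y)%:C : C) x h *
  q (r (x + h *: v) - r x))); first exact: cvgCM hr qr.
apply: funext => h; rewrite /diff_quot /q.
have [e|ne] := eqVneq (r (x + h *: v) - r x) 0.
  have -> : r (x + h *: v) = r x by apply/eqP; rewrite -subr_eq0 e.
  by rewrite !subrr !scaler0 mul0r.
move: ne; set a := r (_ + _) - r x => ne.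
rewrite /diff_quot (_ : r x + a *: (1 : R^o) = r (x + h *: v)); last by rewrite /a /GRing.scale/= mulr1 addrC subrK.
rewrite -rmorphB/= -/a /GRing.scale/= -mulrA; congr (_ * _).
by rewrite mulrA -rmorphM divff//= mul1r.
Qed.

Lemma isd_near f g x (l : C) :
  (\forall h \near (0:R)^', f (x + h *: v) = g (x + h *: v)) -> f x = g x ->
  isd v f x l -> isd v g x l.
Proof.
move=> fg fgx; apply: cvg_trans; apply: near_eq_cvg; near=> h.
by rewrite /diff_quot fgx (near fg h).
Unshelve. all: by end_near. Qed.

End Rules.
Arguments isdZ {E v} c {f x l} _.
Arguments isd_cst {E} v c x.

End DirectionalDerivative.
Arguments isdZ {R E v} c {f x l} _.
Arguments isd_cst {R E} v c x.

(** * Smooth functions of one variable and mean value inequalities *)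

Section Smooth1.
Context {R : realType}.
Local Notation C := (R[i]^o).
Local Notation D1 := (1 : R^o).
Implicit Types (f g rho : R -> C) (x : R).

Lemma isd_continuous f x (l : C) : isd D1 f x l -> {for x, continuous f}.
Proof.
move/isd1_ReIm => [[d1 _] [d2 _]]; apply/continuousCP.
by split; apply: differentiable_continuous; rewrite -derivable1_diffP.
Qed.

Lemma nderivS n rho : nderiv n.+1 rho = rderive D1 (nderiv n rho).
Proof. by []. Qed.

Lemma nderivD n m rho : nderiv n (nderiv m rho) = nderiv (n + m) rho.
Proof. by rewrite /nderiv iterD. Qed.

Lemma smooth1_isd rho n x : smooth1 rho ->
  isd D1 (nderiv n rho) x (nderiv n.+1 rho x).
Proof. by move=> /(_ n)[_ h]; apply: rderivableE; exact: h. Qed.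

Arguments smooth1_isd {rho} n x _.

(** Smoothness is always proved by exhibiting a jet, a sequence in which each function is the
    derivative of the preceding one. The jet then also computes all the [nderiv]. *)
Lemma jet_nderiv (D : nat -> R -> C) n :
  (forall n x, isd D1 (D n) x (D n.+1 x)) -> nderiv n (D 0%N) = D n.
Proof.
move=> h; elim: n => // n IH.
by rewrite nderivS IH; apply: funext => x; exact: rderiveEC.
Qed.

Lemma jet_smooth1 (D : nat -> R -> C) :
  (forall n x, isd D1 (D n) x (D n.+1 x)) -> smooth1 (D 0%N).
Proof.
move=> h n; rewrite jet_nderiv//; split=> x; first exact: isd_continuous (h n x).
by exists (D n.+1 x); exact: h.
Qed.

Lemma smooth1_nderiv rho m : smooth1 rho -> smooth1 (nderiv m rho).
Proof. by move=> h n; rewrite nderivD; exact: h. Qed.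

Lemma linfunE (T : Type) (a : R[i]) (u v : T -> C) :
  a *: u + v = (fun t => (a : C) * u t + v t).
Proof. by []. Qed.

Lemma scalefunE (T : Type) (a : R[i]) (u : T -> C) : a *: u = (fun t => (a : C) * u t).
Proof. by []. Qed.

Lemma smooth1_lin_jet (a : C) f g : smooth1 f -> smooth1 g -> forall n x,
  isd D1 (fun y => a * nderiv n f y + nderiv n g y) x
    (a * nderiv n.+1 f x + nderiv n.+1 g x).
Proof.
move=> hf hg n x.
exact: (isdD (isdZ a (smooth1_isd n x hf)) (smooth1_isd n x hg)).
Qed.

Lemma smooth1_lin (a : R[i]) f g : smooth1 f -> smooth1 g -> smooth1 (a *: f + g).
Proof.
move=> hf hg; rewrite linfunE.
apply: (@jet_smooth1 (fun n y => (a : C) * nderiv n f y + nderiv n g y)) => n x.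
exact: smooth1_lin_jet.
Qed.

Lemma nderiv_lin (a : R[i]) f g n : smooth1 f -> smooth1 g ->
  nderiv n (a *: f + g) = a *: nderiv n f + nderiv n g.
Proof.
move=> hf hg; rewrite !linfunE.
apply: (@jet_nderiv (fun n y => (a : C) * nderiv n f y + nderiv n g y)) => k x.
exact: smooth1_lin_jet.
Qed.

Lemma nderiv_0 n : nderiv n (0 : R -> C) = 0.
Proof. by apply: (@jet_nderiv (fun n => 0)) => k x; exact: isd_cst. Qed.

Lemma smooth1_0 : smooth1 (0 : R -> C).
Proof. by apply: (@jet_smooth1 (fun n => 0)) => k x; exact: isd_cst. Qed.

Lemma smooth1Z (a : R[i]) f : smooth1 f -> smooth1 (a *: f).
Proof.
move=> hf; rewrite (_ : a *: f = a *: f + 0).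
  exact: smooth1_lin hf smooth1_0.
by rewrite linfunE scalefunE; apply: funext => x; rewrite addr0.
Qed.

Lemma nderivZ (a : R[i]) f n : smooth1 f -> nderiv n (a *: f) = a *: nderiv n f.
Proof.
move=> hf; rewrite (_ : a *: f = a *: f + 0); last first.
  by rewrite linfunE scalefunE; apply: funext => x; rewrite addr0.
rewrite (nderiv_lin a n hf smooth1_0) nderiv_0.
by rewrite linfunE scalefunE; apply: funext => x; rewrite addr0.
Qed.

Lemma nderiv_open_eq0 (U : set R) rho n : open U -> smooth1 rho ->
  (forall x, U x -> rho x = 0) -> forall x, U x -> nderiv n rho x = 0.
Proof.
move=> oU srho U0; elim: n => [|n IH] x Ux; first exact: U0.
rewrite nderivS; apply: rderiveEC; apply: isd_near (isd_cst D1 0 x) => /=.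
  move: (open_nbhs_nbhs (conj oU Ux)) => /nbhs_ballP[d /= d0 hd]; near=> h.
  rewrite IH//; apply: hd; rewrite /ball/= opprD addNKr normrN /GRing.scale/= mulr1.
  by near: h; exact: dnbhs0_lt.
by rewrite IH.
Unshelve. all: by end_near. Qed.

Lemma real_comparison (F f H h : R -> R) (a b : R) : a <= b ->
  (forall x, a <= x <= b -> is_derive x 1 F (f x)) ->
  (forall x, a <= x <= b -> is_derive x 1 H (h x)) ->
  (forall x, a <= x <= b -> f x <= h x) -> F b - F a <= H b - H a.
Proof.
move=> ab dF dH fh; suff : 0 <= (H b - F b) - (H a - F a) by lra.
have dG x : a <= x <= b -> is_derive x 1 (H - F) (h x - f x).
  by move=> axb; apply: is_deriveB; [exact: dH|exact: dF].
have [||c] := @MVT_segment R (H - F) (h - f) a b ab.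
- by move=> x; rewrite in_itv/= => /andP[ax xb]; apply: dG; rewrite !ltW.
- apply: derivable_within_continuous => x; rewrite in_itv/= => xab.
  by have [] := dG x xab.
rewrite in_itv/= => cab e; rewrite [leRHS](_ : _ = (H - F) b - (H - F) a) ?e//.
by rewrite mulr_ge0 ?subr_ge0//; exact: fh.
Qed.

Lemma nrm_phase (z : R[i]) : exists w : R[i], nrm w = 1 /\ w * z = (nrm z)%:C.
Proof.
have [->|z0] := eqVneq z 0; first by exists 1; rewrite nrm1 mulr0 nrm0.
have nz : nrm z != 0 by apply: contra_neq z0; exact: nrm_eq0.
exists ((nrm z)%:C / z); split; last by rewrite divfK.
by rewrite nrmM nrm_real Normc.normcV ger0_norm ?nrm_ge0// divff.
Qed.

(** The mean value theorem fails for complex values. A phase [w] rotates the increment of [F] onto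
    the positive real axis, after which real parts can be compared. *)
Lemma complex_comparison (F f : R -> C) (H h : R -> R) (a b : R) : a <= b ->
  (forall x, a <= x <= b -> isd D1 F x (f x)) ->
  (forall x, a <= x <= b -> is_derive x 1 H (h x)) ->
  (forall x, a <= x <= b -> nrm (f x) <= h x) -> nrm (F b - F a) <= H b - H a.
Proof.
move=> ab dF dH fh; have [w [w1 wz]] := nrm_phase (F b - F a).
have -> : nrm (F b - F a) = complex.Re (w * F b) - complex.Re (w * F a).
  by rewrite -raddfB -mulrBr wz.
apply: (@real_comparison (fun t => complex.Re (w * F t)) (fun t => complex.Re (w * f t))
  H h a b) => // x xab.
  by have /isd1_ReIm [] := isdZ w (dF x xab).
apply: (le_trans _ (fh x xab)); apply: (le_trans (ler_norm _)).
by apply: (le_trans (nrm_Re _)); rewrite nrmM w1 mul1r.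
Qed.

Lemma complex_lipschitz (F f : R -> C) (A a b : R) : a <= b ->
  (forall x, a <= x <= b -> isd D1 F x (f x)) ->
  (forall x, a <= x <= b -> nrm (f x) <= A) -> nrm (F b - F a) <= A * (b - a).
Proof.
move=> ab dF fA; rewrite mulrBr.
apply: (@complex_comparison F f (fun t => A * t) (fun=> A) a b) => // x _.
by have := @is_deriveZ R _ _ (@id R) A x 1 1 (is_derive_id _ _);
  rewrite /GRing.scale/= mulr1.
Qed.

Lemma tvs_boundedC (T : Type) (u : T -> C) :
  tvs_bounded (range u) <-> exists M : R, forall x : T, nrm (u x) <= M.
Proof.
split=> [h|[M hM] U U0].
  have /h : nbhs (0 : C) [set z | nrm z < 1].
    have : (fun z : C => z) @ (0 : C) --> (0 : C) by exact: cvg_id.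
    move/cvgCP => /(_ 1 ltr01); apply: filterS => z /=; by rewrite subr0.
  move=> -[t [_ ht]].
  have [t1 tt1] : exists t1, t < t1 /\ 0 < t1.
    by exists (`|t| + 1); rewrite ltr_pwDr ?ler_norm// ?ltr_wpDl.
  exists t1 => x; have [z /= z1 <-] := ht t1 tt1.1 (u x) (imageT u x).
  by rewrite /GRing.scale /= nrmM nrm_real gtr0_norm ?tt1.2// ger_pMr ?tt1.2// ltW.
have [e /= e0 he] : exists2 e : R, 0 < e & forall z : C, nrm z < e -> U z.
  move: U0 => /nbhs_ballP[e /= e0 he]; move: e0 he; case: e => a b.
  rewrite ltcE/= => /andP[/eqP -> a0] he; exists a => // z za; apply: he.
  by rewrite -ball_normE /= sub0r normrN complexr0 normcNc ltcR.
exists ((`|M| + 1) / e); split; first exact: num_real.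
move=> t tM y [x _ <-].
have t0 : 0 < t by apply: le_lt_trans tM; rewrite divr_ge0 ?addr_ge0 ?normr_ge0// ltW.
exists (t^-1%:C * u x).
  apply: he; rewrite nrmM nrm_real gtr0_norm ?invr_gt0// ltr_pdivrMl//.
  apply: (@le_lt_trans _ _ (`|M|)); first exact: le_trans (hM x) (ler_norm _).
  move: tM; rewrite ltr_pdivrMr// => tM.
  by apply: lt_trans tM; rewrite ltrDl.
by rewrite /GRing.scale /= mulrA -rmorphM divff ?gt_eqF// mul1r.
Qed.

Lemma schwartz1P rho : schwartz1 rho <-> smooth1 rho /\
  forall k n, exists M : R, forall x, `|x| ^+ k * nrm (nderiv n rho x) <= M.
Proof.
split=> -[h1 h2]; split=> // k n.
  have /tvs_boundedC[M hM] := h2 k n; exists M => x; have := hM x.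
  by rewrite nrmM nrm_real normrX.
apply/tvs_boundedC; have [M hM] := h2 k n; exists M => x.
by have := hM x; rewrite nrmM nrm_real normrX.
Qed.

End Smooth1.
Arguments smooth1_isd {R rho} n x _.

(** * Antiderivatives and a smooth step *)

Section RealAntiderivative.
Context {R : realType}.
Local Notation mu := (@lebesgue_measure R).
Local Notation C := (R[i]^o).
Local Notation D1 := (1 : R^o).

Lemma is_derive_eq_cst (F G f : R -> R) (a b : R) :
  (forall x : R, a < x < b -> is_derive x 1 F (f x)) ->
  (forall x : R, a < x < b -> is_derive x 1 G (f x)) ->
  forall x y, a < x < b -> a < y < b -> F x - F y = G x - G y.
Proof.
move=> dF dG.
suff H x y : a < x < b -> a < y < b -> x <= y -> F x - F y = G x - G y.
  move=> x y xab yab; have [/H->//|/ltW yx] := leP x y.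
  by apply: oppr_inj; rewrite !opprB; exact: H.
move=> /andP[ax xb] /andP[ay yb] xy.
have ab z : x <= z <= y -> a < z < b.
  by move=> /andP[xz zy]; rewrite (lt_le_trans ax xz) (le_lt_trans zy yb).
have h1 := @real_comparison R F f G f x y xy (fun z h => dF z (ab z h))
  (fun z h => dG z (ab z h)) (fun z h => lexx _).
have h2 := @real_comparison R G f F f x y xy (fun z h => dG z (ab z h))
  (fun z h => dF z (ab z h)) (fun z h => lexx _).
lra.
Qed.

Lemma antiderivative_bounded (f : R -> R) (b : R) : continuous f ->
  exists F : R -> R, forall x : R, - b < x < b -> is_derive x 1 F (f x).
Proof.
move=> cf; pose F x := \int[mu]_(t in `[- b, x]) f t.
exists F => x /andP[bx xb].
have intf : mu.-integrable `[- b, b] (EFin \o f).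
  apply: continuous_compact_integrable; first exact: segment_compact.
  by apply: continuous_subspaceT.
have [d1 d2] : derivable F x 1 /\ derive1 F x = f x.
  exact: (continuous_FTC1_closed xb intf bx (cf x)).
by move: F d1 d2 => F d1 d2; apply: (DeriveDef d1); rewrite -derive1E.
Qed.

Lemma antiderivative (f : R -> R) : continuous f ->
  exists F : R -> R, forall x : R, is_derive x 1 F (f x).
Proof.
move=> cf; have [G hG] := choice (fun n : nat => antiderivative_bounded n%:R cf).
(* The antiderivatives on the intervals ]-n, n[ agree once they are normalized to vanish at 0, so
   they glue. The index is an integer exceeding |x|. *)
pose F x := G (Num.trunc `|x|).+1 x - G (Num.trunc `|x|).+1 0.
have FE (n : nat) x : - n%:R < x < n%:R -> F x = G n x - G n 0.
  move=> xn; rewrite /F; set k := (Num.trunc _).+1.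
  have xk : - k%:R < x < k%:R by rewrite -ltr_norml; exact: truncnS_gt.
  have m0 (i : nat) : - i%:R < x < i%:R -> - i%:R < (0 : R) < i%:R.
    by move=> h; rewrite oppr_lt0 andbb; lra.
  have [kn|nk] := leqP k n.
    apply: (@is_derive_eq_cst _ _ f (- k%:R) k%:R) => //; last exact: m0.
    move=> y yk; apply: hG; have : (k%:R : R) <= n%:R by rewrite ler_nat.
    lra.
  apply: (@is_derive_eq_cst _ _ f (- n%:R) n%:R) => //; last exact: m0.
    move=> y yk; apply: hG; have : (n%:R : R) <= k%:R by rewrite ler_nat ltnW.
    lra.
exists F => x; pose n := (Num.trunc `|x|).+1.
have xn : - n%:R < x < n%:R by rewrite -ltr_norml; exact: truncnS_gt.
apply: (@near_eq_is_derive _ _ _ (fun y => G n y - G n 0)).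
- near=> y; apply/esym/FE.
  have : y \in `](- n%:R), n%:R[ by near: y; apply: near_in_itvoo; rewrite in_itv.
  by rewrite in_itv.
- rewrite -[f x]subr0; apply: is_deriveB; exact: hG.
Unshelve. all: by end_near. Qed.

Lemma complex_antiderivative (f : R -> C) : continuous f ->
  exists F : R -> C, forall x, isd D1 F x (f x).
Proof.
move=> cf.
have [F1 h1] := @antiderivative (fun t => complex.Re (f t)) (fun x => proj1 ((continuousCP f x).1 (cf x))).
have [F2 h2] := @antiderivative (fun t => complex.Im (f t)) (fun x => proj2 ((continuousCP f x).1 (cf x))).
exists (fun x => F1 x +i* F2 x) => x; apply/isd1_ReIm; split; [exact: h1|exact: h2].
Qed.

End RealAntiderivative.

Section SmoothStep.
Context {R : realType}.
Local Notation C := (R[i]^o).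
Local Notation D1 := (1 : R^o).
Implicit Types (f g : R -> R) (P : {poly R}).

(** With the derivatives left existential, products are handled by induction on [n] without a
    Leibniz formula. *)
Fixpoint rdiff (n : nat) f : Prop :=
  if n is m.+1 then exists g, (forall x : R, is_derive x 1 f (g x)) /\ rdiff m g else True.

Lemma rdiffW n f : rdiff n.+1 f -> rdiff n f.
Proof.
elim: n f => // n IH f [g [dg hg]]; exists g; split=> //; exact: IH.
Qed.

Lemma rdiffD n f g : rdiff n f -> rdiff n g -> rdiff n (fun x => f x + g x).
Proof.
elim: n f g => // n IH f g [f' [df hf]] [g' [dg hg]].
exists (fun x => f' x + g' x); split; last exact: IH.
by move=> x; apply: is_deriveD.
Qed.

Lemma rdiffM n f g : rdiff n f -> rdiff n g -> rdiff n (fun x => f x * g x).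
Proof.
elim: n f g => // n IH f g hhf hhg; have [f' [df hf]] := hhf; have [g' [dg hg]] := hhg.
exists (fun x => f x * g' x + g x * f' x); split.
  by move=> x; apply: is_deriveM.
apply: rdiffD; first by apply: IH => //; exact: rdiffW.
by apply: IH => //; exact: rdiffW.
Qed.

Lemma rdiff_reflect n f : rdiff n f -> rdiff n (fun x => f (1 - x)).
Proof.
elim: n f => // n IH f [f' [df hf]].
exists (fun x => (-1) * f' (1 - x)); split.
  move=> x; rewrite mulrC.
  apply: (@is_derive1_comp R f (fun x => 1 - x) x (f' (1 - x)) (-1) (df _)).
  rewrite -[X in is_derive _ _ _ X]sub0r.
  exact: (is_deriveB (is_derive_cst _ _ _) (is_derive_id _ _)).
apply: rdiffM; last exact: IH.
clear; elim: n (-1 : R) => // n IH c; exists (cst 0); split; last exact: IH.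
by move=> x; exact: is_derive_cst.
Qed.

Lemma rdiff_jet f : (forall n, rdiff n f) ->
  exists D : nat -> R -> R, D 0%N = f /\ forall n (x : R), is_derive x 1 (D n) (D n.+1 x).
Proof.
move=> hf; exists (fun n => derive1n n f); split=> // n x.
suff [g hg] : exists g, forall x : R, is_derive x 1 (derive1n n f) (g x).
  have [dx ex] := hg x; apply: (DeriveDef dx).
  by rewrite derive1nS derive1E.
have := hf n.+1; elim: n f {hf} => [|n IH] f [g [dg hg]]; first by exists g.
have [k hk] := IH _ hg; exists k => y.
rewrite derive1Sn (_ : derive1 f = g); first exact: hk.
by apply: funext => z; rewrite derive1E; have [_ ->] := dg z.
Qed.

(** The family P(1/x) exp(-1/x), extended by 0, is closed under differentiation: P becomes X^2 (P -
    P'). Smoothness of exp(-1/x) is thus an induction over all P at once. *)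
Definition flat_exp P x : R :=
  if 0 < x then P.[x^-1] * expR (- x^-1) else 0.

Lemma poly_le_expR P : exists K, 0 <= K /\ forall y, 0 <= y -> `|P.[y]| <= K * expR y.
Proof.
exists (\sum_(i < size P) `|P`_i| * (1 + i`!%:R)); split.
  by apply: sumr_ge0 => i _; rewrite mulr_ge0// addr_ge0.
move=> y y0; rewrite horner_coef; apply: (le_trans (ler_norm_sum _ _ _)).
rewrite mulr_suml; apply: ler_sum => i _; rewrite normrM -mulrA ler_wpM2l//.
rewrite normrX ger0_norm//; case: (nat_of_ord i) => [|n].
  rewrite expr0 mulr_ege1 ?lerDl//.
  by rewrite -expR0 ler_expR.
have := expR_ge1Dxn n y0; rewrite -lerBrDl ler_pdivrMr ?ltr0n ?fact_gt0//.
move=> /le_trans; apply; rewrite mulrC ler_pM ?expR_ge0// ?lerBlDr ?lerDl ?ler01//.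
rewrite subr_ge0 -expR0 ler_expR//.
by rewrite lerDr.
Qed.

(** The exponential beats [P * 'X^2], which leaves two spare factors x. This quadratic bound makes
    the derivative at 0 vanish. *)
Lemma flat_exp_le P : exists K, 0 <= K /\ forall x, `|flat_exp P x| <= K * x ^+ 2.
Proof.
have [K [K0 hK]] := poly_le_expR (P * 'X^2); exists K; split=> // x.
rewrite /flat_exp; case: ifPn => [x0|_]; last by rewrite normr0 mulr_ge0// sqr_ge0.
have y0 : 0 < x^-1 by rewrite invr_gt0.
have := hK _ (ltW y0); rewrite hornerM hornerXn normrM normrX (gtr0_norm y0).
rewrite normrM (gtr0_norm (expR_gt0 _)) expRN ler_pdivrMr ?expR_gt0//.
rewrite mulrAC exprVn ler_pdivrMr ?exprn_gt0//; exact.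
Qed.

Lemma flat_exp_derive P (x : R) :
  is_derive x 1 (flat_exp P) (flat_exp ('X^2 * (P - P^`())) x).
Proof.
have [x0|x0|->] := ltgtP x 0.
- rewrite [X in is_derive _ _ _ X]/flat_exp ltNge (ltW x0)/=.
  have h : is_derive x 1 (cst (0 : R)) (0 : R) := is_derive_cst _ _ _.
  apply: near_eq_is_derive h.
  near=> y; rewrite /flat_exp ltNge (_ : y <= 0)//.
  by apply: ltW; near: y; exact: lt_nbhsl.
- rewrite [X in is_derive _ _ _ X]/flat_exp x0.
  have dV : is_derive x 1 (fun y : R => y^-1) (- x ^- 2 *: 1).
    by apply: is_deriveV; rewrite gt_eqF.
  have dP : is_derive x 1 (fun y => P.[y^-1]) (P^`().[x^-1] * (- x ^- 2 *: 1)).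
    exact: (@is_derive1_comp R (fun z => P.[z]) (fun y => y^-1) x _ _ (is_derive_poly P x^-1) dV).
  have dE : is_derive x 1 (fun y => expR (- y^-1)) (expR (- x^-1) * - (- x ^- 2 *: 1)).
    exact: (@is_derive1_comp R expR (fun y => - y^-1) x _ _ (is_derive_expR _) (is_deriveN dV)).
  have := is_deriveM dP dE.
  set l := (X in is_derive _ _ _ X); rewrite (_ : l = ('X^2 * (P - P^`())).[x^-1] * expR (- x^-1)).
    apply: near_eq_is_derive.
    near=> y; rewrite /flat_exp (_ : 0 < y)//; near: y; exact: lt_nbhsr.
  rewrite /l /GRing.scale/= !mulr1 hornerM hornerXn hornerD hornerN exprVn; ring.
- rewrite [X in is_derive _ _ _ X]/flat_exp ltxx.
  have [K [K0 hK]] := flat_exp_le P.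
  suff h : h^-1 *: ((flat_exp P \o shift 0) (h *: 1) - flat_exp P 0) @[h --> 0^'] --> (0 : R).
    by split; [apply/cvg_ex; exists 0; exact: h|exact: cvg_lim h].
  apply/cvgrPdist_lt => e e0; near=> h.
  have hn0 : h != 0 by near: h; exact: nbhs_dnbhs_neq.
  rewrite sub0r normrN {2}/flat_exp ltxx subr0 /= addr0 /GRing.scale/= mulr1.
  rewrite normrM normfV mulrC ltr_pdivrMr ?normr_gt0//.
  apply: (le_lt_trans (hK h)); rewrite -real_normK ?num_real// expr2 mulrA ltr_pM2r ?normr_gt0//.
  apply: (@le_lt_trans _ _ ((K + 1) * `|h|)); first by rewrite ler_wpM2r// lerDl.
  rewrite mulrC -ltr_pdivlMr ?ltr_wpDl//.
  by near: h; apply: dnbhs0_lt; rewrite divr_gt0 ?ltr_wpDl.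
Unshelve. all: by end_near. Qed.

Lemma flat_exp_rdiff n P : rdiff n (flat_exp P).
Proof.
elim: n P => // n IH P; exists (flat_exp ('X^2 * (P - P^`()))); split=> //.
exact: flat_exp_derive.
Qed.

(** The step is the antiderivative of a bump that is positive exactly on (0,1), divided by its total
    increment. *)
Lemma smooth_step : exists s : R -> C, [/\ smooth1 s,
  forall x, x <= 0 -> s x = 0 & forall x, 1 <= x -> s x = 1].
Proof.
pose b x := flat_exp 1 x * flat_exp 1 (1 - x).
have bE x : 0 < x < 1 -> 0 < b x.
  move=> /andP[x0 x1]; rewrite /b /flat_exp x0 subr_gt0 x1 !hornerC !mul1r.
  by rewrite mulr_gt0 ?expR_gt0.
have b0 x : x <= 0 -> b x = 0.
  by move=> x0; rewrite /b /flat_exp ltNge x0/= mul0r.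
have b1 x : 1 <= x -> b x = 0.
  by move=> x0; rewrite /b /flat_exp subr_gt0 (ltNge x 1) x0/= mulr0.
have [D [D0 dD]] : exists D : nat -> R -> R, D 0%N = b /\
    forall n (x : R), is_derive x 1 (D n) (D n.+1 x).
  apply: rdiff_jet => n; apply: rdiffM; first exact: flat_exp_rdiff.
  exact/rdiff_reflect/flat_exp_rdiff.
have bc : continuous b.
  move=> x; rewrite -D0; apply: differentiable_continuous.
  by rewrite -derivable1_diffP; have [] := dD 0%N x.
have [B dB] := antiderivative bc.
have cBc : 0 < B 1 - B 0.
  have [|c] := @MVT R B b 0 1 ltr01 (fun x _ => dB x).
  - by apply: derivable_within_continuous => x _; have [] := dB x.
  by rewrite in_itv/= subr0 mulr1 => /bE c01 ->.
set c := B 1 - B 0 in cBc.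
(* The jet of the step: index 0 is the normalized antiderivative, index n + 1 the n-th derivative of
   the bump. *)
pose E n x : C := if n is m.+1 then (c^-1 * D m x)%:C else (c^-1 * (B x - B 0))%:C.
have dE n x : isd D1 (E n) x (E n.+1 x).
  apply/isd1_ReIm; split; last by case: n => [|n] /=; exact: is_derive_cst.
  case: n => [|n] /=.
    apply: (@is_deriveZ _ _ _ (fun x => B x - B 0) c^-1).
    by rewrite D0 -[b x]subr0; apply: is_deriveB.
  exact: (@is_deriveZ _ _ _ (D n) c^-1).
exists (E 0%N); split; first exact: jet_smooth1.
  move=> x x0 /=; have h : B 0 - B x <= 0 - 0.
    apply: (@real_comparison R B b (cst 0) (cst 0)) => // y /andP[_ y0].
      by rewrite b0.
  have h' : 0 - 0 <= B 0 - B x.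
    apply: (@real_comparison R (cst 0) (cst 0) B b) => // y /andP[_ y0].
    by rewrite b0.
  by rewrite (_ : B x - B 0 = 0) ?mulr0//; lra.
move=> x x1 /=; have h : B x - B 1 <= 0 - 0.
  apply: (@real_comparison R B b (cst 0) (cst 0)) => // y /andP[y0 _].
    by rewrite b1.
have h' : 0 - 0 <= B x - B 1.
  apply: (@real_comparison R (cst 0) (cst 0) B b) => // y /andP[y0 _].
  by rewrite b1.
by rewrite (_ : B x - B 0 = c) ?mulVf ?gt_eqF// /c; lra.
Qed.

End SmoothStep.

(** * Extension of dominated functionals *)

Section HahnBanach.
Context {R : realType} (Y : lmodType R) (B : Y -> R -> Prop).
Hypothesis B0 : B 0 0.
Hypothesis BD : forall f g a b, B f a -> B g b -> B (f + g) (a + b).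
Hypothesis BZ : forall f a (s : R), B f a -> B (s *: f) (`|s| * a).
Implicit Types (G : set (Y * R)).

(** [B f a] reads: f has size at most a. Using a relation allows vectors without any bound. Partial
    functionals are graphs, ordered by inclusion for Zorn's lemma. Single-valuedness follows from
    domination, because the difference of two values at one point lies over 0, where [B 0 0]
    applies. *)
Definition dominated_graph G : Prop :=
  [/\ G (0, 0),
      forall (s : R) f r g t, G (f, r) -> G (g, t) -> G (s *: f + g, s * r + t) &
      forall f r a, G (f, r) -> B f a -> r <= a].

(** After division by |s|, domination on f + s e says that the value at e is at least every r - a
    with f - e of size a, and at most every a' - r' with f' + e of size a'. Every lower bound is
    below every upper one, since (f - e) + (f' + e) = f + f'. The supremum of the lower bounds is
    chosen. *)
Lemma dominated_graph_extend G e a0 : dominated_graph G -> B e a0 ->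
  exists c : R, dominated_graph
    [set p | exists f r s, G (f, r) /\ p = (f + s *: e, r + s * c)].
Proof.
move=> [G0 Glin Gdom] Be.
have Bn f a : B f a -> B (- f) a.
  by move=> /(@BZ _ _ (-1)); rewrite scaleN1r normrN1 mul1r.
have GZ (s : R) f r : G (f, r) -> G (s *: f, s * r).
  by move=> Gf; have := Glin s _ _ _ _ Gf G0; rewrite !addr0.
pose S := [set x : R | exists f r a, [/\ G (f, r), B (f - e) a & x = r - a]].
have key f r a f' r' a' : G (f, r) -> B (f - e) a -> G (f', r') -> B (f' + e) a' ->
    r - a <= a' - r'.
  move=> Gf Bf Gf' Bf'; have := Glin 1 _ _ _ _ Gf Gf'; rewrite scale1r mul1r.
  move=> /Gdom/(_ _); have := BD Bf Bf'; rewrite addrACA addNr addr0 => /[swap] /[apply].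
  lra.
have hS : has_sup S.
  split; first by exists (0 - a0), 0, 0, a0; split=> //; rewrite sub0r; exact: Bn.
  by exists (a0 - 0) => _ [f [r [a [Gf Bf ->]]]]; apply: key Gf Bf G0 _; rewrite add0r.
have c1 f r a : G (f, r) -> B (f - e) a -> r - a <= sup S.
  by move=> Gf Bf; apply: (ub_le_sup hS.2); exists f, r, a.
have c2 f r a : G (f, r) -> B (f + e) a -> sup S <= a - r.
  move=> Gf Bf; apply: (ge_sup hS.1) => _ [f' [r' [a' [Gf' Bf' ->]]]].
  exact: key Gf' Bf' Gf Bf.
exists (sup S); split.
- by exists 0, 0, 0; split=> //; rewrite scale0r mul0r !addr0.
- move=> s _ _ _ _ [f [r [u [Gf [-> ->]]]]] [f' [r' [u' [Gf' [-> ->]]]]].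
  exists (s *: f + f'), (s * r + r'), (s * u + u'); split; first exact: Glin.
  congr (_, _); last by ring.
  by rewrite scalerDr scalerDl scalerA addrACA.
- move=> _ _ a [f [r [s [Gf [-> ->]]]]] Ba.
  have [s0|s0|s0] := ltgtP s 0.
  + have sn0 : 0 < (- s)^-1 by rewrite invr_gt0 oppr_gt0.
    have := BZ (- s)^-1 Ba; rewrite scalerDr scalerA (gtr0_norm sn0) => h.
    have := c1 _ _ _ (GZ (- s)^-1 _ _ Gf); rewrite -scaleN1r => /(_ ((- s)^-1 * a)).
    rewrite (_ : -1 = (- s)^-1 * s); last by rewrite invrN mulNr mulVf// lt_eqF.
    move=> /(_ h); rewrite -mulrBr mulrC ler_pdivrMr ?oppr_gt0// mulrN mulrC; lra.
  + have si0 : 0 < s^-1 by rewrite invr_gt0.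
    have := BZ s^-1 Ba; rewrite scalerDr scalerA mulVf ?gt_eqF// scale1r.
    rewrite (gtr0_norm si0) => h.
    have := c2 _ _ _ (GZ s^-1 _ _ Gf) h; rewrite -mulrBr mulrC ler_pdivlMr//.
    rewrite mulrC; lra.
  + by move: Ba; rewrite s0 scale0r mul0r !addr0; exact: Gdom.
Qed.

Lemma hahn_banach G0 : dominated_graph G0 ->
  exists w : Y -> R, [/\ forall f r, G0 (f, r) -> w f = r,
    forall (s : R) f g a b, B f a -> B g b -> w (s *: f + g) = s * w f + w g &
    forall f a, B f a -> `|w f| <= a].
Proof.
move=> hG0.
pose P : set (set (Y * R)) := [set G | G = set0 \/ (G0 `<=` G /\ dominated_graph G)].
have [F FP Ftot|G [PG Gmax]] := @Zorn_bigcup _ P.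
  have [[G [FG Gn0]]|h] := pselect (exists G, F G /\ G <> set0); last first.
    left; rewrite -subset0 => p [G FG Gp].
    by apply: h; exists G; split=> // G0'; rewrite G0' in Gp.
  have FP' H p : F H -> H p -> G0 `<=` H /\ dominated_graph H.
    by move=> FH Hp; case: (FP _ FH) => // H0; rewrite H0 in Hp.
  have [p Gp] : exists p, G p by apply/set0P/eqP.
  have [G0G [z _ _]] := FP' _ _ FG Gp.
  right; split; first by move=> q /G0G Gq; exists G.
  split; first by exists G.
  - move=> s f r g t [H FH Hf] [H' FH' Hg].
    have [HH'|H'H] := Ftot _ _ FH FH'.
      by exists H' => //; have [_ [_ l _]] := FP' _ _ FH' Hg; apply: l => //; exact: HH'.
    by exists H => //; have [_ [_ l _]] := FP' _ _ FH Hf; apply: l => //; exact: H'H.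
  - by move=> f r a [H FH Hf]; have [_ [_ _]] := FP' _ _ FH Hf; apply.
have {PG} [G0G GD] : G0 `<=` G /\ dominated_graph G.
  case: PG => // Ge; exfalso; apply: (Gmax G0); last by right; split.
  rewrite Ge; split=> // h; have [z _ _] := hG0; exact: h z.
have [Gz Glin Gdom] := GD.
have Gfun f r r' a : B f a -> G (f, r) -> G (f, r') -> r = r'.
  move=> _; suff H s s' : G (f, s) -> G (f, s') -> s <= s'.
    by move=> h h'; apply/eqP; rewrite eq_le !H.
  move=> h h'; have := Glin (-1) _ _ _ _ h' h; rewrite scaleN1r addNr.
  by move=> /Gdom /(_ B0); rewrite mulN1r; lra.
have Gtot f a : B f a -> exists r, G (f, r).
  move=> Bf; have [c hc] := dominated_graph_extend GD Bf.
  set G' := [set p | _] in hc.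
  have GG' : G `<=` G'.
    by move=> [g r] Gg; exists g, r, 0; rewrite scale0r mul0r !addr0.
  have G'f : G' (f, c) by exists 0, 0, 1; rewrite scale1r mul1r !add0r.
  apply: contrapT => nG; apply: (Gmax G'); last by right; split=> //; exact: subset_trans GG'.
  by split=> // h; apply: nG; exists c; exact: h.
pose w f := xget 0 [set r | G (f, r)].
have wG f a : B f a -> G (f, w f).
  by move=> /Gtot[r hr]; rewrite /w; case: xgetP => [x _|/(_ r)].
exists w; split.
- move=> f r /G0G Gf; rewrite /w; case: xgetP => [x _ /= Gx|/(_ r)]//.
  have := Glin (-1) _ _ _ _ Gf Gx; rewrite scaleN1r addNr => h.
  have h' := Glin (-1) _ _ _ _ h Gz; move: h' (Gdom _ _ _ h B0).
  by rewrite scaler0 addr0 => /Gdom /(_ B0); lra.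
- move=> s f g a b Bf Bg; have Bfg := BD (BZ s Bf) Bg.
  by apply: (Gfun _ _ _ _ Bfg); [exact: wG Bfg|apply: Glin; [exact: wG Bf|exact: wG Bg]].
- move=> f a Bf; rewrite ler_norml; apply/andP; split; last exact: Gdom (wG _ _ Bf) Bf.
  have := Glin (-1) _ _ _ _ (wG _ _ Bf) Gz; rewrite !addr0 => /Gdom.
  move/(_ (`|-1| * a) (BZ _ Bf)); rewrite normrN1 mul1r; lra.
Qed.

End HahnBanach.

Section EffectiveLimit.
Context {R : realType} (T : Type) (t0 : T).

(** A Cauchy criterion over an arbitrary index type, with [d k] as the claimed error at k: the
    supremum of the lower ends [u k - d k] lies in all the intervals of radius [d k] around
    [u k]. *)
Lemma real_effective_limit (u d : T -> R) :
  (forall k l, u k - u l <= d k + d l) -> exists L, forall k, `|u k - L| <= d k.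
Proof.
move=> h; pose S := [set u k - d k | k in [set: T]].
have S0 : S !=set0 by exists (u t0 - d t0), t0.
have ubS l : ubound S (u l + d l) by move=> _ [k _ <-]; have := h k l; lra.
exists (sup S) => k; rewrite ler_norml; apply/andP; split.
  by have := ge_sup S0 (ubS k); lra.
have : u k - d k <= sup S by apply: ub_le_sup; [exists (u k + d k)|exists k].
lra.
Qed.

Lemma complex_effective_limit (u : T -> R[i]) (d : T -> R) :
  (forall k l, nrm (u k - u l) <= d k + d l) ->
  exists L, forall k, nrm (u k - L) <= 2 * d k.
Proof.
move=> h.
have [|L1 h1] := @real_effective_limit (fun k => complex.Re (u k)) d.
  by move=> k l; apply: le_trans (h k l); rewrite -raddfB (le_trans (ler_norm _))// nrm_Re.
have [|L2 h2] := @real_effective_limit (fun k => complex.Im (u k)) d.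
  by move=> k l; apply: le_trans (h k l); rewrite -raddfB (le_trans (ler_norm _))// nrm_Im.
exists (L1 +i* L2) => k; apply: (le_trans (nrm_ReIm _)).
by rewrite mulr_natl mulr2n lerD// raddfB/=.
Qed.

End EffectiveLimit.

(** * Functionals bounded on a subspace of finite codimension *)

Section FiniteCodimension.
Context {R : realType} (E : lmodType R[i]) (B : E -> R -> Prop).
Hypothesis B_ge0 : forall x a, B x a -> 0 <= a.
Hypothesis BD : forall x y a b, B x a -> B y b -> B (x + y) (a + b).
Hypothesis BZ : forall x a (s : R[i]), B x a -> B (s *: x) (nrm s * a).
Implicit Types (S : set E) (f g : E -> R[i]).

Definition subspace_set S : Prop :=
  S 0 /\ forall (s : R[i]) x y, S x -> S y -> S (s *: x + y).

Definition linear_on S f : Prop :=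
  forall (s : R[i]) x y, S x -> S y -> f (s *: x + y) = s * f x + f y.

Definition bounded_on S f : Prop :=
  exists2 c : R, 0 <= c & forall x a, S x -> B x a -> nrm (f x) <= c * a.

Lemma linear_on0 S f : subspace_set S -> linear_on S f -> f 0 = 0.
Proof.
move=> [S0 _] /(_ (-1) _ _ S0 S0); rewrite scaler0 addr0.
by move=> /eqP; rewrite mulN1r addNr => /eqP.
Qed.

Hypothesis BW : forall x a b, B x a -> a <= b -> B x b.

Definition total_on_set S := forall x, S x -> exists a, B x a.

(** If f is bounded on S, its kernel is split off by a vector e with f e = 1, and g is corrected so
    as to vanish at e. If f is unbounded, vectors e_k of size tending to 0 with f e_k = 1 exist; g
    e_k is Cauchy because e_k - e_l lies in the kernel, and the correction is minus its limit. *)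
Lemma bounded_on_extend S f g : subspace_set S -> total_on_set S ->
  linear_on S f -> linear_on S g -> bounded_on (S `&` [set x | f x = 0]) g ->
  exists c : R[i], bounded_on S (fun x => g x + c * f x).
Proof.
move=> sS Btot lf lg [C C0 hC].
have SZ s x : S x -> S (s *: x).
  by move=> Sx; rewrite -[_ *: _]addr0; apply: sS.2 => //; exact: sS.1.
have fZ h s x : linear_on S h -> S x -> h (s *: x) = s * h x.
  move=> lh Sx; rewrite -[_ *: _]addr0 lh ?(linear_on0 sS lh) ?addr0//; exact: sS.1.
have lB h s x y : linear_on S h -> S x -> S y -> h (x - s *: y) = h x - s * h y.
  by move=> lh Sx Sy; rewrite addrC -scaleNr lh// mulNr addrC.
have SB s x y : S x -> S y -> S (x - s *: y).
  by move=> Sx Sy; rewrite addrC -scaleNr; apply: sS.2.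
have BB s x y a b : B x a -> B y b -> B (x - s *: y) (a + nrm s * b).
  by move=> Bx By; rewrite -scaleNr -(nrmN s); apply: BD => //; exact: BZ.
(* Boundedness of f, restated: vectors with f x = 1 cannot be arbitrarily small. *)
have [[c c0 hc]|hn] := pselect (exists2 c : R, 0 < c & forall x a, S x -> B x a -> f x = 1 -> c <= a).
  have [[e [Se fe]]|fe] := pselect (exists e, S e /\ f e = 1); last first.
    have f0 x : S x -> f x = 0.
      move=> Sx; apply/eqP/negP => /negP fx0; apply: fe; exists ((f x)^-1 *: x).
      by split; [exact: SZ|rewrite fZ// mulVf].
    by exists 0, C => // x a Sx Bx; rewrite mul0r addr0; apply: hC => //; split=> //; exact: f0.
  have [b Be] := Btot _ Se; have b0 := B_ge0 Be.
  exists (- g e), (C * (1 + c^-1 * b)).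
    by rewrite mulr_ge0// addr_ge0// mulr_ge0// invr_ge0 ltW.
  move=> x a Sx Bx; have a0 := B_ge0 Bx.
  have -> : g x + - g e * f x = g (x - f x *: e) by rewrite lB// mulNr mulrC.
  have fxa : nrm (f x) <= c^-1 * a.
    have [fx0|fx0] := eqVneq (f x) 0.
      by rewrite fx0 nrm0 mulr_ge0// invr_ge0 ltW.
    have nf : 0 < nrm (f x).
      by rewrite lt_def nrm_ge0 andbT; apply: contra_neq fx0; exact: nrm_eq0.
    have := hc _ _ (SZ (f x)^-1 _ Sx) (BZ (f x)^-1 Bx).
    rewrite fZ// mulVf// => /(_ erefl); rewrite Normc.normcV.
    by rewrite ler_pdivlMl// mulrC -ler_pdivlMl.
  apply: (@le_trans _ _ (C * (a + nrm (f x) * b))).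
    apply: hC; last exact: BB.
    by split; [exact: SB|rewrite /= lB// fe mulr1 subrr].
  by rewrite -mulrA ler_wpM2l// mulrDl mul1r lerD2l mulrAC ler_wpM2r.
have /choice[e he] : forall k : nat, exists x, [/\ S x, B x (k.+1%:R^-1) & f x = 1].
  move=> k; apply: contrapT => h; apply: hn; exists (k.+1%:R^-1); first by rewrite invr_gt0.
  move=> x a Sx Bx fx; rewrite leNgt; apply/negP => ak; apply: h.
  by exists x; split=> //; apply: BW Bx (ltW ak).
have [|L hL] := @complex_effective_limit R nat 0%N (fun k => g (e k)) (fun k => C * k.+1%:R^-1).
  move=> k l; have [Sk Bk fk] := he k; have [Sl Bl fl] := he l.
  rewrite -[g (e l)]mul1r -lB// -mulrDr; apply: hC.
    by split; [exact: SB|rewrite /= lB// fk fl mul1r subrr].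
  by have := BB 1 _ _ _ _ Bk Bl; rewrite nrm1 mul1r.
exists (- L), C => // x a Sx Bx.
rewrite leNgt; apply/negP => lt.
pose d := nrm (g x + - L * f x) - C * a; have d0 : 0 < d by rewrite subr_gt0.
(* The vector x - f(x) e_k lies in the kernel of f. Its bound contributes C |f x| / (k + 1), and the
   error of the limit twice that amount. The fixed excess [d] is thus below every such quantity,
   against the Archimedean property. *)
have hk k : d <= (3 * C * nrm (f x)) * k.+1%:R^-1.
  have [Sk Bk fk] := he k.
  have -> : d = nrm ((g x - f x * g (e k)) + f x * (g (e k) - L)) - C * a.
    by rewrite /d; congr (nrm _ - _); ring.
  rewrite lerBlDr; apply: (le_trans (nrmD _ _)); rewrite nrmM -lB//.
  have h1 : nrm (g (x - f x *: e k)) <= C * (a + nrm (f x) * k.+1%:R^-1).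
    apply: hC; last exact: BB.
    by split; [exact: SB|rewrite /= lB// fk mulr1 subrr].
  have h2 := ler_wpM2l (nrm_ge0 (f x)) (hL k).
  apply: (le_trans (lerD h1 h2)).
  by move: (k.+1%:R^-1) => t; rewrite le_eqVlt; apply/orP; left; apply/eqP; ring.
pose M := 3 * C * nrm (f x); have M0 : 0 <= M by rewrite !mulr_ge0// nrm_ge0.
have := hk (Num.trunc (M / d)); rewrite -/M ler_pdivlMr//.
have := truncnS_gt (M / d); rewrite ltr_pdivrMr// mulrC => h1 h2.
by have := lt_le_trans h1 h2; rewrite ltxx.
Qed.

Lemma bounded_on_extend_finite n (f : nat -> E -> R[i]) S g : subspace_set S ->
  total_on_set S -> (forall k, linear_on S (f k)) -> linear_on S g ->
  bounded_on (S `&` [set x | forall k, (k < n)%N -> f k x = 0]) g ->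
  exists b : nat -> R[i], bounded_on S (fun x => g x + \sum_(k < n) b k * f k x).
Proof.
elim: n g => [|n IH] g sS tS lf lg [C C0 hC].
  exists (fun=> 0), C => // x a Sx Bx; rewrite big_ord0 addr0; exact: hC.
pose S' := S `&` [set x | forall k, (k < n)%N -> f k x = 0].
have sS' : subspace_set S'.
  split; first by split; [exact: sS.1|move=> k _; exact: linear_on0 (lf k)].
  move=> s x y [Sx fx] [Sy fy]; split; first exact: sS.2.
  by move=> k kn; rewrite lf// fx// fy// mulr0 addr0.
have lS' h : linear_on S h -> linear_on S' h by move=> lh s x y [? _] [? _]; exact: lh.
have [||||c hc] := @bounded_on_extend S' (f n) g sS'.
- by move=> x [Sx _]; exact: tS.
- exact: lS'.
- exact: lS'.
- exists C => // x a [[Sx fx] fnx] Bx; apply: hC => //; split=> // k.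
  by rewrite ltnS leq_eqVlt => /predU1P[->//|/fx].
have [|||||b hb] := IH (fun x => g x + c * f n x) => //.
  by move=> s x y Sx Sy /=; rewrite lg// lf//; ring.
exists (fun k => if (k < n)%N then b k else c).
have [D D0 hD] := hb; exists D => // x a Sx Bx.
rewrite big_ord_recr /= ltnn.
rewrite (eq_bigr (fun k : 'I_n => b k * f k x)); last by move=> k _; rewrite ltn_ord.
by rewrite addrCA addrA [X in nrm X](_ : _ = g x + c * f n x + \sum_(k < n) b k * f k x); [exact: hD|ring].
Qed.

(** If vectors of size e normalized by f_n x = 1 are missing from the common kernel of the f_k,
    rescaling shows that f_n is bounded there by 1/e. Reinstating the f_k one at a time then costs
    only a multiple of each. *)
Lemma bounded_combination_or_dual n (f : nat -> E -> R[i]) S : subspace_set S ->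
  total_on_set S -> (forall k, linear_on S (f k)) ->
  (exists b : nat -> R[i], bounded_on S (fun x => f n x + \sum_(k < n) b k * f k x)) \/
  (forall e : R, 0 < e -> exists x, [/\ S x, B x e, f n x = 1 &
     forall k, (k < n)%N -> f k x = 0]).
Proof.
move=> sS tS lf; have [h|h] := pselect (forall e : R, 0 < e -> exists x,
  [/\ S x, B x e, f n x = 1 & forall k, (k < n)%N -> f k x = 0]); first by right.
left; apply: bounded_on_extend_finite => //.
move/existsNP : h => [e /not_implyP[e0 he]].
exists e^-1; first by rewrite invr_ge0 ltW.
move=> x a [Sx fx] Bx; have a0 := B_ge0 Bx.
have [->|fx0] := eqVneq (f n x) 0; first by rewrite nrm0 mulr_ge0// invr_ge0 ltW.
have nf : 0 < nrm (f n x).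
  by rewrite lt_def nrm_ge0 andbT; apply: contra_neq fx0; exact: nrm_eq0.
have fZ k s : f k (s *: x) = s * f k x.
  by rewrite -[_ *: _]addr0 lf ?(linear_on0 sS (lf k)) ?addr0//; exact: sS.1.
rewrite mulrC ler_pdivlMr// leNgt; apply/negP => lt; apply: he.
exists ((f n x)^-1 *: x); split.
- by rewrite -[_ *: _]addr0; apply: sS.2 => //; exact: sS.1.
- apply: BW (BZ _ Bx) _; rewrite Normc.normcV mulrC ler_pdivrMr// mulrC; exact: ltW.
- by rewrite fZ mulVf.
- by move=> k kn; rewrite fZ (fx k kn) mulr0.
Qed.

End FiniteCodimension.

(** * Test functions on the half line *)

Section TestFunctions.
Context {R : realType}.
Local Notation C := (R[i]^o).
Local Notation D1 := (1 : R^o).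
Implicit Types (h sigma rho tau : R -> C).

Definition vanish_off (a b : R) sigma := forall x, x <= a \/ b <= x -> sigma x = 0.

(** The vanishing of every derivative, endpoints included, is carried along so that boundary terms
    disappear without further argument. *)
Definition ctest_in (a b : R) rho := smooth1 rho /\ forall n, vanish_off a b (nderiv n rho).

Definition ctest rho := exists a b : R, [/\ 0 < a, a < b & ctest_in a b rho].

Lemma vanish_offW a b a' b' sigma :
  a' <= a -> b <= b' -> vanish_off a b sigma -> vanish_off a' b' sigma.
Proof.
by move=> aa bb h x [xa|xb]; apply: h; [left; exact: le_trans aa|right; exact: le_trans xb].
Qed.

Lemma ctest_common rho tau : ctest rho -> ctest tau ->
  exists a b : R, [/\ 0 < a, a < b, ctest_in a b rho & ctest_in a b tau].
Proof.
move=> [a [b [a0 ab [sr vr]]]] [a' [b' [a0' ab' [st vt]]]].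
exists (Num.min a a'), (Num.max b b'); split.
- by rewrite lt_min a0.
- by rewrite gt_min lt_max ab.
- by split=> // n; apply: vanish_offW (vr n); rewrite ?ge_min ?le_max lexx.
- by split=> // n; apply: vanish_offW (vt n); rewrite ?ge_min ?le_max lexx orbT.
Qed.

Lemma ctest_nderiv rho m : ctest rho -> ctest (nderiv m rho).
Proof.
move=> [a [b [a0 ab [sr vr]]]]; exists a, b; split; [exact: a0|exact: ab|split; first exact: smooth1_nderiv].
by move=> n; rewrite nderivD; exact: vr.
Qed.

Lemma ctest_in_lin (a b : R) (c : R[i]) rho tau :
  ctest_in a b rho -> ctest_in a b tau -> ctest_in a b (c *: rho + tau).
Proof.
move=> [sr vr] [st vt]; split; first exact: smooth1_lin.
move=> n x hx; rewrite nderiv_lin// linfunE (vr n x hx) (vt n x hx).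
by rewrite mulr0 addr0.
Qed.

Lemma ctest_lin (c : R[i]) rho tau : ctest rho -> ctest tau -> ctest (c *: rho + tau).
Proof.
move=> cr ct; have [a [b [a0 ab hr ht]]] := ctest_common cr ct.
by exists a, b; split=> //; exact: ctest_in_lin.
Qed.

Lemma ctest0 : ctest 0.
Proof.
exists 1, 2; split=> //; first by rewrite ltr1n.
split; first exact: smooth1_0.
by move=> n x _; rewrite nderiv_0.
Qed.

Lemma ctestZ (c : R[i]) rho : ctest rho -> ctest (c *: rho).
Proof.
move=> h; rewrite (_ : c *: rho = c *: rho + 0); first exact: ctest_lin h ctest0.
by rewrite linfunE scalefunE; apply: funext => x; rewrite addr0.
Qed.

Lemma isd0_cst (F : R -> C) (a b : R) :
  (forall x, a <= x <= b -> isd D1 F x 0) -> a <= b -> F b = F a.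
Proof.
move=> dF ab; apply/eqP; rewrite -subr_eq0; apply/eqP/nrm_eq0/le_anti.
rewrite nrm_ge0 andbT -(mul0r (b - a)).
by apply: (@complex_lipschitz R F (fun=> 0)) => // x _; rewrite nrm0.
Qed.

Lemma isd_eq_cst (F G f : R -> C) (a b : R) :
  (forall x, isd D1 F x (f x)) -> (forall x, isd D1 G x (f x)) -> a <= b ->
  F b - F a = G b - G a.
Proof.
move=> dF dG ab; suff : F b - G b = F a - G a.
  have -> : F b - F a = (F b - G b) - (F a - G a) + (G b - G a) by ring.
  by move=> ->; rewrite subrr add0r.
apply: (@isd0_cst (fun x => F x - G x)) => // x _.
by rewrite -(subrr (f x)); apply: isdD => //; exact: isdN.
Qed.

(* [z] is the integral of [h * sigma], given as the increment of an antiderivative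
   across an interval supporting [sigma]. *)
Definition is_pairing h sigma (z : C) := exists (a b : R) (F : R -> C),
  [/\ 0 < a, a < b, vanish_off a b sigma,
      forall x, isd D1 F x (h x * sigma x) & z = F b - F a].

Lemma antiderivative_vanish_off (F : R -> C) h sigma (a b a' b' : R) : a' <= a -> b <= b' ->
  vanish_off a b sigma -> (forall x, isd D1 F x (h x * sigma x)) ->
  F b' = F b /\ F a = F a'.
Proof.
move=> aa bb v dF; split; apply: isd0_cst => // x /andP[h1 h2].
  by have := dF x; rewrite v ?mulr0//; right.
by have := dF x; rewrite v ?mulr0//; left.
Qed.

Lemma is_pairing_in h sigma z (a b : R) (F : R -> C) : is_pairing h sigma z ->
  a <= b -> vanish_off a b sigma -> (forall x, isd D1 F x (h x * sigma x)) ->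
  z = F b - F a.
Proof.
move=> [a' [b' [G [a0' ab' v' dG ->]]]] ab v dF.
rewrite -(isd_eq_cst dF dG (ltW ab')).
pose a1 := Num.min a a'; pose b1 := Num.max b b'.
have aa : a1 <= a by rewrite ge_min lexx.
have bb : b <= b1 by rewrite le_max lexx.
have aa' : a1 <= a' by rewrite ge_min lexx orbT.
have bb' : b' <= b1 by rewrite le_max lexx orbT.
have [e1 e2] := antiderivative_vanish_off aa bb v dF.
have [e1' e2'] := antiderivative_vanish_off aa' bb' v' dF.
by rewrite -e1' e2' -e1 e2.
Qed.

Lemma is_pairing_unique h sigma z z' : is_pairing h sigma z -> is_pairing h sigma z' -> z = z'.
Proof.
move=> hz [a' [b' [G [a0' ab' v' dG ->]]]].
exact: is_pairing_in hz (ltW ab') v' dG.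
Qed.

Lemma is_pairing_lin h sigma tau (c : C) z t : is_pairing h sigma z ->
  is_pairing h tau t -> is_pairing h (c *: sigma + tau) (c * z + t).
Proof.
move=> [a [b [F [a0 ab v dF ->]]]] [a' [b' [G [a0' ab' v' dG ->]]]].
pose a1 := Num.min a a'; pose b1 := Num.max b b'.
have aa : a1 <= a by rewrite ge_min lexx.
have bb : b <= b1 by rewrite le_max lexx.
have aa' : a1 <= a' by rewrite ge_min lexx orbT.
have bb' : b' <= b1 by rewrite le_max lexx orbT.
have [e1 e2] := antiderivative_vanish_off aa bb v dF.
have [e1' e2'] := antiderivative_vanish_off aa' bb' v' dG.
exists a1, b1, (fun x => c * F x + G x); split.
- by rewrite lt_min a0.
- by rewrite gt_min lt_max ab.
- move=> x hx; rewrite linfunE.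
  rewrite (vanish_offW aa bb v hx) (vanish_offW aa' bb' v' hx).
  by rewrite mulr0 addr0.
- move=> x; have := isdD (isdZ c (dF x)) (dG x); rewrite linfunE.
  by rewrite mulrDr mulrCA.
- by rewrite -e1 e2 -e1' e2'; ring.
Qed.

Lemma is_pairingD h h' sigma z t : is_pairing h sigma z ->
  is_pairing h' sigma t -> is_pairing (fun x => h x + h' x) sigma (z + t).
Proof.
move=> [a [b [F [a0 ab v dF ->]]]] ht.
have [_ [_ [G [_ _ _ dG _]]]] := ht.
have -> := is_pairing_in ht (ltW ab) v dG.
exists a, b, (fun x => F x + G x); split; [exact: a0|exact: ab|exact: v| |].
  by move=> x; rewrite mulrDl; exact: (isdD (dF x) (dG x)).
by ring.
Qed.

(** The density is continuous only on (0,oo). At points x <= 0 < a the product is 0 in a whole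
    neighbourhood, whatever h does there. *)
Lemma mul_vanish_continuous h sigma (a b : R) : 0 < a -> vanish_off a b sigma ->
  (forall x : R, 0 < x -> {for x, continuous h}) -> continuous sigma ->
  continuous (fun x => h x * sigma x).
Proof.
move=> a0 v ch cs x; have [x0|x0] := ltP 0 x.
  by apply: cvgCM; [exact: ch|exact: cs].
have : (cst 0 : R -> C) @ x --> h x * sigma x.
  rewrite v ?mulr0; last by left; exact: le_trans x0 (ltW a0).
  exact: cvg_cst.
apply: cvgC_near_eq; near=> y; rewrite v ?mulr0//; left; apply: ltW.
by near: y; apply: lt_nbhsl; exact: le_lt_trans a0.
Unshelve. all: by end_near. Qed.

Lemma is_pairing_exists h rho : (forall x : R, 0 < x -> {for x, continuous h}) ->
  ctest rho -> exists z, is_pairing h rho z.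
Proof.
move=> ch [a [b [a0 ab [sr vr]]]].
have [F dF] := complex_antiderivative (mul_vanish_continuous a0 (vr 0%N) ch (sr 0%N).1).
exists (F b - F a), a, b, F; split; [exact: a0|exact: ab|exact: (vr 0%N)|exact: dF|by []].
Qed.

Definition represents h (u : (R -> C) -> C) := forall rho, ctest rho -> is_pairing h rho (u rho).

Definition test_linear (u : (R -> C) -> C) := forall (c : R[i]) rho tau,
  ctest rho -> ctest tau -> u (c *: rho + tau) = c * u rho + u tau.

(** The step rises between 1 and 2, so its derivative is a test function on the half line with
    integral one. It serves to subtract mean values. *)
Lemma bump_exists : exists s : R -> C, [/\ smooth1 s,
  forall x, x <= 1 -> s x = 0, forall x, 2 <= x -> s x = 1 & ctest_in (1/2) 3 (nderiv 1 s)].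
Proof.
have [s0 [ss0 z0 o0]] := @smooth_step R.
pose s x := s0 (x - 1).
have js n x : isd D1 (fun y => nderiv n s0 (y - 1)) x (nderiv n.+1 s0 (x - 1)).
  have h : isd D1 (fun y : R => (y - 1)%:C : C) x (1 : R)%:C.
    apply/isd1_ReIm => /=; split; last exact: is_derive_cst.
    rewrite -[X in is_derive _ _ _ X]subr0.
    exact: (is_deriveB (is_derive_id _ _) (is_derive_cst _ _ _)).
  by have := isd_comp h (smooth1_isd n (x - 1) ss0); rewrite mul1r.
have ss : smooth1 s by exact: (@jet_smooth1 R (fun n y => nderiv n s0 (y - 1))).
have z x : x <= 1 -> s x = 0 by move=> x1; apply: z0; rewrite subr_le0.
have o x : 2 <= x -> s x = 1 by move=> x1; apply: o0; lra.
exists s; split; [exact: ss|exact: z|exact: o|split; first exact: smooth1_nderiv].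
move=> n x hx; rewrite nderivD addn1; case: hx => hx.
  have H := @nderiv_open_eq0 R [set t | t < 1] s n.+1 (@open_lt _ _) ss.
  apply: H => /=; last lra.
  by move=> t t1; apply: z; exact: ltW.
(* To the right of 2 it is s - 1 that vanishes; it has the same derivatives of positive order as
   s. *)
pose s1 := (-1) *: (cst 1 : R -> C) + s.
pose c1 n : R -> C := if n is 0%N then cst 1 else cst 0.
have jc k y : isd D1 (c1 k) y (c1 k.+1 y) by case: k => [|k]; exact: isd_cst.
have sc : smooth1 (cst 1 : R -> C) by exact: (@jet_smooth1 R c1).
have ec : nderiv n.+1 (cst 1 : R -> C) = cst 0 by exact: (@jet_nderiv R c1).
have -> : nderiv n.+1 s x = nderiv n.+1 s1 x.
  by rewrite /s1 (nderiv_lin (-1) n.+1 sc ss) linfunE ec mulr0 add0r.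
have H := @nderiv_open_eq0 R [set t | 2 < t] s1 n.+1 (@open_gt _ _).
apply: H => /=; last lra.
  exact: smooth1_lin.
by move=> t t2; rewrite /s1 linfunE o ?ltW// mulN1r addNr.
Qed.

End TestFunctions.

(** * Continuous densities of bounded functionals *)

Section RealTaylor.
Context {R : realType}.
Implicit Types (f : R -> R).

Lemma real_lipschitz_between f f1 (M y z : R) : (forall x : R, is_derive x 1 f (f1 x)) ->
  (forall x, Num.min y z <= x <= Num.max y z -> `|f1 x| <= M) ->
  `|f z - f y| <= M * `|z - y|.
Proof.
move=> df.
suff H (a b : R) : a <= b -> (forall x, a <= x <= b -> `|f1 x| <= M) ->
    `|f b - f a| <= M * (b - a).
  have [yz|/ltW zy] := leP y z => hM.
    by rewrite [in leRHS]ger0_norm ?subr_ge0//; exact: H.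
  by rewrite distrC [in leRHS]distrC [in leRHS]ger0_norm ?subr_ge0//; exact: H.
move=> ab hM.
have dM (x : R) : is_derive x 1 (fun t : R => M * t) M.
  by have := @is_deriveZ R _ _ (@id R) M x 1 1 (is_derive_id _ _); rewrite /GRing.scale/= mulr1.
have dMn (x : R) : is_derive x 1 (fun t : R => - M * t) (- M).
  by have := @is_deriveZ R _ _ (@id R) (- M) x 1 1 (is_derive_id _ _); rewrite /GRing.scale/= mulr1.
have h1 := @real_comparison R f f1 _ _ a b ab (fun x _ => df x) (fun x _ => dM x)
  (fun x h => le_trans (ler_norm _) (hM x h)).
have h2 := @real_comparison R _ _ f f1 a b ab (fun x _ => dMn x) (fun x _ => df x) _.
rewrite ler_norml; apply/andP; split; last by move: h1; lra.
have : - M * b - - M * a <= f b - f a; last lra.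
by apply: h2 => x h; rewrite lerNl (le_trans (ler_norm _))// normrN; exact: hM.
Qed.

Lemma real_taylor2 f f1 f2 (M y z : R) : (forall x : R, is_derive x 1 f (f1 x)) ->
  (forall x : R, is_derive x 1 f1 (f2 x)) -> (forall x, `|f2 x| <= M) ->
  `|f z - f y - f1 y * (z - y)| <= M * (z - y) ^+ 2.
Proof.
move=> d1 d2 hM; have M0 : 0 <= M by apply: le_trans (hM 0).
pose g s := f s - f1 y * s; pose g1 s := f1 s - f1 y.
have dg (x : R) : is_derive x 1 g (g1 x).
  apply: is_deriveB.
  by have := @is_deriveZ R _ _ (@id R) (f1 y) x 1 1 (is_derive_id _ _); rewrite /GRing.scale/= mulr1.
rewrite (_ : _ - _ - _ = g z - g y); last by rewrite /g; ring.
rewrite -real_normK ?num_real// expr2 mulrA.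
apply: (real_lipschitz_between dg) => x hx.
apply: (@le_trans _ _ (M * `|x - y|)); first exact: (real_lipschitz_between d2).
rewrite ler_wpM2l// -(opprB y) normrN.
move: hx; have [yz|zy] := leP y z => /andP[h1 h2].
  by rewrite distrC !ger0_norm ?subr_ge0// lerD2r.
rewrite [leRHS]distrC !ger0_norm ?subr_ge0//; lra.
Qed.

Lemma is_derive_quadratic (A : R -> R) (y l K d : R) : 0 < d ->
  (forall z, `|z - y| < d -> `|A z - A y - (z - y) * l| <= K * (z - y) ^+ 2) ->
  is_derive y 1 A l.
Proof.
move=> d0 hA.
suff h : h^-1 *: ((A \o shift y) (h *: (1 : R)) - A y) @[h --> 0^'] --> l.
  by split; [apply/cvg_ex; exists l; exact: h|exact: cvg_lim h].
apply/cvgrPdist_lt => e e0; near=> h.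
have hn0 : h != 0 by near: h; exact: nbhs_dnbhs_neq.
have hd : `|h| < d by near: h; exact: dnbhs0_lt.
have := hA (h + y); rewrite addrK => /(_ hd) hq.
rewrite /= /GRing.scale/= mulr1 -(@ltr_pM2l _ `|h|) ?normr_gt0// -normrM.
rewrite mulrBr mulrA divff// mul1r distrC.
apply: (le_lt_trans hq); rewrite -real_normK ?num_real// expr2 mulrA.
rewrite mulrC ltr_pM2l ?normr_gt0//.
apply: (@le_lt_trans _ _ ((`|K| + 1) * `|h|)).
  by rewrite ler_wpM2r// (le_trans (ler_norm _))// lerDl.
rewrite mulrC -ltr_pdivlMr ?ltr_wpDl//.
by near: h; apply: dnbhs0_lt; rewrite divr_gt0 ?ltr_wpDl.
Unshelve. all: by end_near. Qed.

(* As a function of [t] this is \int_0^y (s - t)_+ f''(s) ds. *)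
Definition truncated_taylor f f1 (y t : R) : R :=
  if t <= y then f t - f y - f1 y * (t - y) else 0.

(** The y-derivative of [truncated_taylor f f1 y t] is f''(y) (y - t)_+. The error is quadratic
    uniformly in t, so the expansion can be passed through a functional that is bounded in a
    supremum norm. The factor y in the constant comes from |y - t| <= y. *)
Lemma truncated_taylor_increment f f1 f2 f3 (M y z t : R) :
  (forall x : R, is_derive x 1 f (f1 x)) -> (forall x : R, is_derive x 1 f1 (f2 x)) ->
  (forall x : R, is_derive x 1 f2 (f3 x)) ->
  (forall x, `|f2 x| <= M) -> (forall x, `|f3 x| <= M) -> 0 < y -> 0 <= t ->
  t <= Num.max y z ->
  `|- ((z - y) * f2 y) * Num.max (y - t) 0 +
    (truncated_taylor f f1 z t - truncated_taylor f f1 y t)| <=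
    (2 * M + M * y) * (z - y) ^+ 2.
Proof.
move=> d1 d2 d3 hf2 hf3 y0 t0 tyz; have M0 : 0 <= M by apply: le_trans (hf2 0).
set e := z - y; have ez : z = y + e by rewrite /e; ring.
have t1 := real_taylor2 y z d1 d2 hf2; have t2 := real_taylor2 z y d1 d2 hf2.
have t3 := real_taylor2 y z d2 d3 hf3.
have e2 : (y - z) ^+ 2 = e ^+ 2 by rewrite /e; ring.
rewrite e2 in t2; rewrite -/e in t1 t3.
have My0 : 0 <= M * y * e ^+ 2 by rewrite (mulr_ge0 (mulr_ge0 M0 (ltW y0)) (sqr_ge0 e)).
have Me0 : 0 <= M * e ^+ 2 by rewrite (mulr_ge0 M0 (sqr_ge0 e)).
have both : t <= y -> t <= z -> `|- (e * f2 y) * Num.max (y - t) 0 + (truncated_taylor f f1 z t - truncated_taylor f f1 y t)| <= (2 * M + M * y) * e ^+ 2.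
  move=> ty tz; rewrite /truncated_taylor ty tz max_l; last lra.
  rewrite [X in `|X|](_ : _ = (f y - f z - f1 z * (y - z)) + (f1 z - f1 y - f2 y * e) * (y - t)); last first.
    by rewrite /e; ring.
  apply: (le_trans (ler_normD _ _)); rewrite normrM.
  have h1 : `|f1 z - f1 y - f2 y * e| * `|y - t| <= M * e ^+ 2 * y.
    by apply: ler_pM => //; rewrite ger0_norm; lra.
  by move: t2 h1 My0 Me0; lra.
(* When t lies between y and z, only one of the two remainders is present, and every distance
   involved is at most |z - y|, so each term is already quadratic. *)
have [ty|yt] := leP t y; have [tz|zt] := leP t z; first exact: both.
+ have h1 := real_taylor2 y t d1 d2 hf2.
  have se : (t - y) ^+ 2 <= e ^+ 2.
    by rewrite -(sqrrN e) -sqrrN /e !opprB; apply: lerXn2r; rewrite ?nnegrE; lra.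
  have h2 : `|e * f2 y * (y - t)| <= M * e ^+ 2.
    rewrite mulrAC normrM mulrC ler_pM// normrM -real_normK ?num_real// expr2 ler_wpM2l//.
    by rewrite ger0_norm ?subr_ge0// ltr0_norm /e; lra.
  have h3 := ler_wpM2l M0 se.
  rewrite /truncated_taylor ty (leNgt t z) zt /= max_l; last lra.
  rewrite [X in `|X|](_ : _ = - (e * f2 y * (y - t)) - (f t - f y - f1 y * (t - y))); last by ring.
  apply: (le_trans (ler_normB _ _)); rewrite normrN.
  by move: h1 h2 h3 My0; lra.
+ have h1 := real_taylor2 z t d1 d2 hf2.
  have se : (t - z) ^+ 2 <= e ^+ 2.
    by rewrite -sqrrN /e !opprB; apply: lerXn2r; rewrite ?nnegrE; lra.
  have h3 := ler_wpM2l M0 se.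
  rewrite /truncated_taylor tz (leNgt t y) yt /= max_r; last lra.
  by rewrite mulr0 add0r subr0; move: h1 h3 My0 Me0; lra.
+ by move: tyz; rewrite le_max !leNgt yt zt.
Qed.

End RealTaylor.

Section TestBounds.
Context {R : realType}.
Local Notation C := (R[i]^o).

Lemma continuous_bounded (g : R -> R) (a b : R) : a <= b -> continuous g ->
  exists M, forall x, a <= x <= b -> g x <= M.
Proof.
move=> ab cg; have [c _ hc] := EVT_max ab (continuous_subspaceT cg).
by exists (g c) => x xab; apply: hc; rewrite in_itv.
Qed.

Lemma ctest_bounded (a b : R) (rho : R -> C) n : a < b -> ctest_in a b rho ->
  exists M, forall x, nrm (nderiv n rho x) <= M.
Proof.
move=> ab [sr vr].
have cn (p : R -> R) : continuous p -> continuous (fun x => `|p x|).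
  by move=> cp x; apply: cvg_norm; exact: cp.
have [M1 h1] := @continuous_bounded (fun x => `|complex.Re (nderiv n rho x)|) a b (ltW ab)
  (cn _ (fun x => proj1 ((continuousCP (nderiv n rho) x).1 ((sr n).1 x)))).
have [M2 h2] := @continuous_bounded (fun x => `|complex.Im (nderiv n rho x)|) a b (ltW ab)
  (cn _ (fun x => proj2 ((continuousCP (nderiv n rho) x).1 ((sr n).1 x)))).
exists (`|M1| + `|M2|) => x.
have [xa|ax] := leP x a; first by rewrite vr ?nrm0 ?addr_ge0//; left.
have [bx|xb] := leP b x; first by rewrite vr ?nrm0 ?addr_ge0//; right.
have axb : a <= x <= b by rewrite !ltW.
apply: (le_trans (nrm_ReIm _)); rewrite lerD//.
  by apply: le_trans (h1 x axb) (ler_norm _).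
by apply: le_trans (h2 x axb) (ler_norm _).
Qed.

End TestBounds.

(** * Densities of real functionals through the kernels (x - t)_+ *)

Section RealRepresentation.
Context {R : realType} (L : nat) (K : R) (K0 : 0 < K).
Local Notation C := (R[i]^o).
Local Notation D1 := (1 : R^o).
Local Notation Y := (R -> R^o).
Implicit Types (f g : R -> R).

(** The constant [K] of the functional is built into the gauge, so that domination holds with
    constant 1. Only t >= 0 is tested, which identifies functions that agree on the half line. *)
Definition weight_ball (f : Y) (A : R) : Prop :=
  forall t, 0 <= t -> K * (1 + t) ^+ L * `|f t| <= A.

Lemma weight_ge0 t : 0 <= t -> 0 <= K * (1 + t) ^+ L.
Proof. by move=> t0; rewrite mulr_ge0 ?exprn_ge0 ?addr_ge0// ltW. Qed.

Lemma weight_le (t x : R) : 0 <= t -> t <= x -> (1 + t) ^+ L <= (1 + x) ^+ L.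
Proof. by move=> t0 tx; apply: lerXn2r; rewrite ?nnegrE; lra. Qed.

Lemma weight_ball0 : weight_ball 0 0.
Proof. by move=> t t0; rewrite normr0 mulr0. Qed.

Lemma weight_ballD f g a b : weight_ball f a -> weight_ball g b -> weight_ball (f + g) (a + b).
Proof.
move=> hf hg t t0; apply: le_trans (lerD (hf t t0) (hg t t0)).
by rewrite -mulrDr ler_wpM2l ?weight_ge0// ler_normD.
Qed.

Lemma weight_ballZ f a (s : R) : weight_ball f a -> weight_ball (s *: (f : Y)) (`|s| * a).
Proof.
move=> hf t t0; rewrite normrM mulrCA ler_wpM2l//; exact: hf.
Qed.

Context (m : nat) (v : (R -> C) -> R).
Hypothesis vD : forall (c : R) rho tau, ctest rho -> ctest tau ->
  v (c%:C *: rho + tau) = c * v rho + v tau.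
Hypothesis vK : forall rho A, ctest rho ->
  (forall x, 0 <= x -> (1 + x) ^+ L * nrm (nderiv m rho x) <= A) ->
  v (nderiv m.+2 rho) <= K * A.

(** The functional f |-> v(f''), defined on the real functions f that are m-th derivatives of test
    functions. *)
Definition test_graph : set (Y * R) := [set p | exists rho : R -> C,
  [/\ ctest rho, forall x, nderiv m rho x = (p.1 x)%:C & p.2 = v (nderiv m.+2 rho)]].

Lemma test_graph_dominated : dominated_graph weight_ball test_graph.
Proof.
split.
- exists 0; split; first exact: ctest0.
    by move=> x; rewrite nderiv_0.
  have := vD 1 ctest0 ctest0; rewrite nderiv_0 /= (_ : 1%:C *: _ + _ = 0).
    by move=> h; lra.
  by rewrite linfunE; apply: funext => x; rewrite mulr0 addr0.
- move=> s f r g t [rho [cr hr /= ->]] [tau [ct ht /= ->]].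
  have [[a [b [_ _ [sr _]]]] [a' [b' [_ _ [st _]]]]] := (cr, ct).
  exists (s%:C *: rho + tau); split; first exact: ctest_lin.
    by move=> x; rewrite nderiv_lin// linfunE hr ht /= rmorphD rmorphM.
  transitivity (v (s%:C *: nderiv m.+2 rho + nderiv m.+2 tau)).
    by rewrite vD//; exact: ctest_nderiv.
  by rewrite (nderiv_lin _ m.+2 sr st).
- move=> f r a [rho [cr hr /= ->]] hf.
  have -> : a = K * (K^-1 * a) by rewrite mulrA divff ?gt_eqF// mul1r.
  apply: vK => // x x0; rewrite hr nrm_real ler_pdivlMl// mulrA; exact: hf.
Qed.

(* The density is the Hahn-Banach extension evaluated at the kernel (x - t)_+, because
   f(t) = \int (x - t)_+ f''(x) dx for a test function f. *)
Lemma real_representation : exists h : R -> R,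
  [/\ forall x, 0 < x -> {for x, continuous h},
      forall x, 0 <= x -> `|h x| <= K * (1 + x) ^+ L.+1 &
      forall rho f (a b : R) (F : R -> R), 0 < a -> a < b -> ctest_in a b rho ->
        (forall x, nderiv m rho x = (f x)%:C) ->
        (forall x : R, is_derive x 1 F (h x * complex.Re (nderiv m.+2 rho x))) ->
        v (nderiv m.+2 rho) = F b - F a].
Proof.
have [w [wG wl wB]] := hahn_banach weight_ball0 weight_ballD weight_ballZ test_graph_dominated.
pose hat x : Y := fun t => Num.max (x - t) 0.
have w0 : w 0 = 0.
  by have := wB _ _ weight_ball0; rewrite normr_le0 => /eqP.
have Bsub f g a b : weight_ball f a -> weight_ball g b -> w (f - g : Y) = w f - w g.
  move=> hf hg; have := wl (-1) _ _ _ _ hg hf; rewrite scaleN1r addrC => ->.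
  by rewrite mulN1r addrC.
have Bhat x : 0 <= x -> weight_ball (hat x) (K * (1 + x) ^+ L.+1).
  move=> x0 t t0; rewrite /hat; have [xt|tx] := leP (x - t) 0.
    by rewrite normr0 mulr0 mulr_ge0 ?exprn_ge0 ?addr_ge0// ltW.
  rewrite -mulrA ler_pM2l// exprSr gtr0_norm//; apply: ler_pM; last by lra.
  - by rewrite exprn_ge0// addr_ge0.
  - exact: ltW.
  - by apply: weight_le => //; lra.
pose h x := w (hat x).
(* Two kernels differ by at most y - x, and both vanish beyond t = y. Hence h is locally
   Lipschitz. *)
have hlip x y : 0 <= x -> x <= y -> `|h y - h x| <= K * (1 + y) ^+ L * (y - x).
  move=> x0 xy; have y0 := le_trans x0 xy.
  rewrite /h -(Bsub _ _ _ _ (Bhat _ y0) (Bhat _ x0)); apply: wB => t t0.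
  have [ty|yt] := leP t y; last first.
    rewrite (_ : `|_| = 0); first by rewrite mulr0 mulr_ge0 ?subr_ge0 ?weight_ge0.
    by rewrite !fctE /hat !max_r ?subrr ?normr0//; lra.
  apply: ler_pM; [exact: weight_ge0|exact: normr_ge0|by rewrite ler_pM2l// weight_le|].
  rewrite !fctE /hat (max_l (_ : 0 <= y - t)) ?subr_ge0//.
  have [xt|tx] := leP (x - t) 0; first by rewrite subr0 ger0_norm ?subr_ge0//; lra.
  by rewrite ger0_norm; lra.
exists h; split.
- move=> x x0; apply/cvgrPdist_lt => e e0.
  pose M := K * (1 + (x + 1)) ^+ L; have M0 : 0 < M by rewrite mulr_gt0// exprn_gt0//; lra.
  have lip y z : 0 <= y -> y <= z -> z <= x + 1 -> `|h z - h y| <= M * (z - y).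
    move=> y0 yz zx; apply: (le_trans (hlip _ _ y0 yz)).
    by rewrite ler_wpM2r ?subr_ge0// ler_pM2l// weight_le//; lra.
  near=> y.
  have y0 : 0 < y by near: y; exact: lt_nbhsr.
  have y1 : y < x + 1 by near: y; apply: lt_nbhsl; rewrite ltrDl.
  have ye : `|x - y| < e / M.
    by near: y; apply: cvgr_dist_lt; [exact: cvg_id|rewrite divr_gt0].
  rewrite ltr_pdivlMr// in ye; apply: le_lt_trans ye; rewrite mulrC.
  have [xy|/ltW yx] := leP x y.
    rewrite distrC [in leRHS]distrC [in leRHS]ger0_norm ?subr_ge0//; apply: lip => //; exact: ltW.
  by rewrite [in leRHS]ger0_norm ?subr_ge0//; apply: lip => //; [exact: ltW|lra].
- by move=> x x0; exact: wB (Bhat _ x0).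
- move=> rho f a b F a0 ab [sr vr] rf dF.
  pose f1 x := complex.Re (nderiv m.+1 rho x); pose f2 x := complex.Re (nderiv m.+2 rho x).
  pose f3 x := complex.Re (nderiv m.+3 rho x).
  have fE x : f x = complex.Re (nderiv m rho x) by rewrite rf.
  have d1 (x : R) : is_derive x 1 f (f1 x).
    have /isd1_ReIm [] := smooth1_isd m x sr.
    by rewrite (_ : (fun _ => _) = f)//; apply: funext => t; rewrite fE.
  have d2 (x : R) : is_derive x 1 f1 (f2 x) by have /isd1_ReIm [] := smooth1_isd m.+1 x sr.
  have d3 (x : R) : is_derive x 1 f2 (f3 x) by have /isd1_ReIm [] := smooth1_isd m.+2 x sr.
  have [M2 hM2]   := ctest_bounded m.+2 ab (conj sr vr).
  have [M3 hM3] := ctest_bounded m.+3 ab (conj sr vr).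
  pose M := Num.max M2 M3.
  have hf2 x : `|f2 x| <= M.
    by apply: (le_trans (nrm_Re _)); rewrite le_max hM2.
  have hf3 x : `|f3 x| <= M.
    by apply: (le_trans (nrm_Re _)); rewrite le_max hM3 orbT.
  have M0 : 0 <= M by apply: le_trans (hf2 0).
  have f0 x : x <= a \/ b <= x -> f x = 0 by move=> hx; rewrite fE vr.
  have f10 x : x <= a \/ b <= x -> f1 x = 0 by move=> hx; rewrite /f1 vr.
  pose ky y : Y := truncated_taylor f f1 y.
  have Bky y : 0 <= y -> weight_ball (ky y) (K * (1 + y) ^+ L * (M * y ^+ 2)).
    move=> y0 t t0; rewrite /ky /truncated_taylor; case: ifPn => [ty|_]; last first.
      by rewrite normr0 mulr0 mulr_ge0 ?weight_ge0// mulr_ge0// sqr_ge0.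
    apply: ler_pM; [exact: weight_ge0|exact: normr_ge0|by rewrite ler_pM2l// weight_le|].
    apply: (le_trans (real_taylor2 y t d1 d2 hf2)); rewrite ler_wpM2l//.
    rewrite -sqrrN opprB; apply: lerXn2r; rewrite ?nnegrE; lra.
  (* [A] is an antiderivative of h f'' by the uniform expansion of [ky]. It starts from [ky a = 0]
     and ends at [ky b = f], because f and f' vanish at a and at b. This replaces an interchange of
     w with an integral. *)
  pose A y := w (ky y).
  have dA (y : R) : 0 < y -> is_derive y 1 A (h y * f2 y).
    move=> y0; apply: (@is_derive_quadratic R A y _
      (K * (1 + (y + 1)) ^+ L * (2 * M + M * y)) (Num.min 1 y)).
      by rewrite lt_min ltr01.
    move=> z; rewrite lt_min !ltr_norml => /andP[/andP[z1 z2] /andP[z3 z4]].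
    have z0 : 0 < z by lra.
    pose e := z - y.
    (* The error of the first-order expansion of [ky], as a function of t; w turns its size into the
       error of the expansion of [A]. *)
    pose T : Y := (- (e * f2 y)) *: hat y + (ky z - ky y).
    have wT : w T = A z - A y - (z - y) * (h y * f2 y).
      have Bzy := weight_ballD (Bky _ (ltW z0)) (weight_ballZ (-1) (Bky _ (ltW y0))).
      rewrite scaleN1r in Bzy.
      rewrite /T (wl _ _ _ _ _ (Bhat _ (ltW y0)) Bzy) (Bsub _ _ _ _ (Bky _ (ltW z0)) (Bky _ (ltW y0))).
      by rewrite /A /h /e; ring.
    rewrite -wT -/e -mulrA -[X in _ <= X]mulrA; apply: wB => t t0; rewrite mulrA.
    have My0 : 0 <= M * y * e ^+ 2 by rewrite (mulr_ge0 (mulr_ge0 M0 (ltW y0)) (sqr_ge0 e)).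
    have Me0 : 0 <= M * e ^+ 2 by rewrite (mulr_ge0 M0 (sqr_ge0 e)).
    have rhs0 : 0 <= (2 * M + M * y) * e ^+ 2 by lra.
    have TE : T t = - (e * f2 y) * Num.max (y - t) 0 + (ky z t - ky y t) by [].
    have [tyz|tyz] := leP t (Num.max y z); last first.
      rewrite gt_max in tyz; have /andP[yt zt] := tyz.
      rewrite (_ : T t = 0).
        by rewrite normr0 mulr0 mulr_ge0// weight_ge0//; lra.
      rewrite TE /ky /truncated_taylor (leNgt t y) yt (leNgt t z) zt /= max_r; last lra.
      by rewrite mulr0 subrr addr0.
    apply: ler_pM; [exact: weight_ge0|exact: normr_ge0| |].
      rewrite ler_pM2l// weight_le//; apply: (le_trans tyz); rewrite ge_max; lra.
    rewrite TE; exact: truncated_taylor_increment d1 d2 d3 hf2 hf3 y0 t0 tyz.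
  have wf : A b = v (nderiv m.+2 rho).
    rewrite /A (_ : ky b = f).
      by apply: wG; exists rho; split=> //; exists a, b; split.
    apply: funext => t; rewrite /ky /truncated_taylor (f0 b (or_intror (lexx b))).
    rewrite (f10 b (or_intror (lexx b))) mul0r !subr0; case: ifPn => // bt.
    by rewrite f0//; right; rewrite ltW// ltNge.
  have wa : A a = 0.
    rewrite /A (_ : ky a = 0)//; apply: funext => t; rewrite /ky /truncated_taylor.
    rewrite (f0 a (or_introl (lexx a))) (f10 a (or_introl (lexx a))) mul0r !subr0.
    by case: ifPn => // ta; rewrite f0//; left.
  rewrite -wf -[A b]subr0 -wa.
  apply: (@is_derive_eq_cst R A F (fun x => h x * f2 x) 0 (b + 1)).
  - by move=> x /andP[x0 _]; exact: dA.
  - by rewrite (lt_trans a0 ab) ltrDl ltr01.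
  - by rewrite a0/=; lra.
Unshelve. all: by end_near. Qed.

End RealRepresentation.

(** * Densities of complex functionals *)

Section ComplexRepresentation.
Context {R : realType}.
Local Notation C := (R[i]^o).
Local Notation D1 := (1 : R^o).
Implicit Types (h rho tau : R -> C).

Definition re_fun rho : R -> C := fun x => (complex.Re (rho x))%:C.
Definition im_fun rho : R -> C := fun x => (complex.Im (rho x))%:C.

Lemma isd_re_fun rho x (l : C) : isd D1 rho x l -> isd D1 (re_fun rho) x (complex.Re l)%:C.
Proof.
move=> /isd1_ReIm[h1 h2]; apply/isd1_ReIm; split; first exact: h1.
exact: is_derive_cst.
Qed.

Lemma isd_im_fun rho x (l : C) : isd D1 rho x l -> isd D1 (im_fun rho) x (complex.Im l)%:C.
Proof.
move=> /isd1_ReIm[h1 h2]; apply/isd1_ReIm; split; first exact: h2.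
exact: is_derive_cst.
Qed.

Lemma re_im_ctest (a b : R) rho : ctest_in a b rho ->
  [/\ ctest_in a b (re_fun rho), ctest_in a b (im_fun rho) &
   forall n, nderiv n (re_fun rho) = re_fun (nderiv n rho) /\
             nderiv n (im_fun rho) = im_fun (nderiv n rho)].
Proof.
move=> [sr vr].
have jr n x : isd D1 (re_fun (nderiv n rho)) x (re_fun (nderiv n.+1 rho) x).
  exact: isd_re_fun (smooth1_isd n x sr).
have ji n x : isd D1 (im_fun (nderiv n rho)) x (im_fun (nderiv n.+1 rho) x).
  exact: isd_im_fun (smooth1_isd n x sr).
have e n : nderiv n (re_fun rho) = re_fun (nderiv n rho) /\
   nderiv n (im_fun rho) = im_fun (nderiv n rho).
  split; first exact: (@jet_nderiv R (fun n => re_fun (nderiv n rho)) n jr).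
  exact: (@jet_nderiv R (fun n => im_fun (nderiv n rho)) n ji).
split; last exact: e.
- split; first exact: (@jet_smooth1 R (fun n => re_fun (nderiv n rho)) jr).
  by move=> n x hx; rewrite (e n).1 /re_fun vr.
- split; first exact: (@jet_smooth1 R (fun n => im_fun (nderiv n rho)) ji).
  by move=> n x hx; rewrite (e n).2 /im_fun vr.
Qed.

Lemma re_im_decomp rho : rho = 1 *: re_fun rho + ('i%C *: im_fun rho + 0).
Proof.
rewrite !linfunE; apply: funext => x; rewrite addr0 mul1r.
exact: complexE.
Qed.

Section Bounded.
Context (L m : nat) (K : R) (K0 : 0 < K) (u : (R -> C) -> C).
Hypothesis ul : test_linear u.
Hypothesis uK : forall rho A, ctest rho ->
  (forall x, 0 <= x -> (1 + x) ^+ L * nrm (nderiv m rho x) <= A) ->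
  nrm (u (nderiv m.+2 rho)) <= K * A.

(** Re u and Im u are only real-linear, so their densities are first compared with u on real-valued
    test functions; complex linearity then covers all of them. So far the density is correct on
    derivatives of order m + 2 only. *)
Lemma complex_representation : exists h,
  [/\ forall x : R, 0 < x -> {for x, continuous h},
      forall x : R, 0 <= x -> nrm (h x) <= 2 * K * (1 + x) ^+ L.+1 &
      forall rho, ctest rho -> is_pairing h (nderiv m.+2 rho) (u (nderiv m.+2 rho))].
Proof.
have [||h1 [c1 b1 r1]] := @real_representation R L K K0 m (fun rho => complex.Re (u rho)).
- move=> c rho tau cr ct; rewrite ul// raddfD/=; congr (_ + _).
  by case: (u rho) => p q /=; rewrite mul0r subr0.
- move=> rho A cr hA; apply: le_trans (uK cr hA).
  exact: le_trans (ler_norm _) (nrm_Re _).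
have [||h2 [c2 b2 r2]] := @real_representation R L K K0 m (fun rho => complex.Im (u rho)).
- move=> c rho tau cr ct; rewrite ul// raddfD/=; congr (_ + _).
  by case: (u rho) => p q /=; rewrite mul0r addr0.
- move=> rho A cr hA; apply: le_trans (uK cr hA).
  exact: le_trans (ler_norm _) (nrm_Im _).
pose h x : C := h1 x +i* h2 x.
have ch x : 0 < x -> {for x, continuous h}.
  by move=> x0; apply/continuousCP; split; [exact: c1|exact: c2].
have real_case rho f (a b : R) : 0 < a -> a < b -> ctest_in a b rho ->
    (forall n x, nderiv n rho x = (f n x)%:C) ->
    is_pairing h (nderiv m.+2 rho) (u (nderiv m.+2 rho)).
  move=> a0 ab cr rf.
  have [z hz] := is_pairing_exists ch (ctest_nderiv m.+2 (ex_intro _ a (ex_intro _ b (And3 a0 ab cr)))).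
  have cm := mul_vanish_continuous a0 (cr.2 m.+2) ch (cr.1 m.+2).1.
  have [F dF] := complex_antiderivative cm.
  have -> : u (nderiv m.+2 rho) = F b - F a; last by exists a, b, F; split; [exact: a0|exact: ab|exact: cr.2|exact: dF|].
  apply/eqP; rewrite eq_complex; apply/andP; split; apply/eqP.
    rewrite raddfB/=; apply: (r1 rho (f m) a b (fun x => complex.Re (F x))) => // x.
    have /isd1_ReIm[+ _] := dF x; rewrite rf /= mulr0 subr0; exact.
  rewrite raddfB/=; apply: (r2 rho (f m) a b (fun x => complex.Im (F x))) => // x.
  have /isd1_ReIm[_] := dF x; rewrite rf /= mulr0 add0r; exact.
exists h; split=> //.
  move=> x x0; apply: (le_trans (nrm_ReIm _)); rewrite -mulrA mulr_natl mulr2n lerD//=.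
    exact: b1.
  exact: b2.
move=> rho [a [b [a0 ab cr]]]; have [cre cim e] := re_im_ctest cr.
have p1 : is_pairing h (nderiv m.+2 (re_fun rho)) (u (nderiv m.+2 (re_fun rho))).
  apply: (real_case _ (fun n x => complex.Re (nderiv n rho x)) a b a0 ab cre) => n x.
  by rewrite (e n).1.
have p2 : is_pairing h (nderiv m.+2 (im_fun rho)) (u (nderiv m.+2 (im_fun rho))).
  apply: (real_case _ (fun n x => complex.Im (nderiv n rho x)) a b a0 ab cim) => n x.
  by rewrite (e n).2.
have Cre : ctest (nderiv m.+2 (re_fun rho)) by apply: ctest_nderiv; exists a, b; split.
have Cim : ctest (nderiv m.+2 (im_fun rho)) by apply: ctest_nderiv; exists a, b; split.
have eq : nderiv m.+2 rho = 1 *: nderiv m.+2 (re_fun rho) + 'i%C *: nderiv m.+2 (im_fun rho).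
  rewrite (e m.+2).1 (e m.+2).2 {1}(re_im_decomp (nderiv m.+2 rho)) !linfunE scalefunE.
  by apply: funext => x; rewrite addr0.
rewrite eq ul//; last exact: ctestZ.
have -> : u ('i%C *: nderiv m.+2 (im_fun rho)) = 'i%C * u (nderiv m.+2 (im_fun rho)) + u 0.
  rewrite -ul//; last exact: ctest0.
  by congr u; rewrite linfunE scalefunE; apply: funext => x; rewrite addr0.
have u0 : u 0 = 0.
  have := ul (-1) ctest0 ctest0; rewrite (_ : _ *: _ + _ = 0).
    by move=> /eqP; rewrite mulN1r addNr => /eqP.
  by rewrite linfunE; apply: funext => x; rewrite mulr0 addr0.
apply: is_pairing_lin => //; rewrite u0.
rewrite (_ : 'i%C *: _ = 'i%C *: nderiv m.+2 (im_fun rho) + 0); last first.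
  by rewrite linfunE scalefunE; apply: funext => x; rewrite addr0.
apply: is_pairing_lin => //.
exists 1, 2, (cst 0); split; [exact: ltr01|by rewrite ltr1n|by []| |by rewrite subrr].
by move=> x; rewrite mulr0; exact: isd_cst.
Qed.

End Bounded.

(** The du Bois-Reymond lemma: such a functional is a polynomial of degree below m, of which only
    continuity and growth are recorded. By induction tau |-> u(tau') has a density q, and an
    antiderivative H of -q represents u on derivatives. Every test function is a derivative plus a
    multiple of a fixed one, so u differs from H by a constant. *)
Lemma kernel_representation m (u : (R -> C) -> C) : test_linear u ->
  (forall rho, ctest rho -> u (nderiv m rho) = 0) ->
  exists h, [/\ continuous h,
    exists K : R, forall x : R, 0 <= x -> nrm (h x) <= K * (1 + x) ^+ m & represents h u].
Proof.
elim: m u => [|m IH] u ul uk.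
  exists (cst 0); split; first by move=> x; exact: cvg_cst.
    by exists 0 => x _; rewrite nrm0 mul0r.
  move=> rho cr; have := uk rho cr; rewrite /nderiv /= => ->.
  have [a [b [a0 ab [_ vr]]]] := cr.
  exists a, b, (cst 0); split; [exact: a0|exact: ab|exact: (vr 0%N)| |by rewrite subrr].
  by move=> x; rewrite mul0r; exact: isd_cst.
have [||q [cq [K hK] rq]] := IH (fun tau => u (nderiv 1 tau)).
- move=> c rho tau cr ct.
  have [[a [b [_ _ [sr _]]]] [a' [b' [_ _ [st _]]]]] := (cr, ct).
  by rewrite (nderiv_lin c 1 sr st) ul//; exact: ctest_nderiv.
- move=> rho cr; rewrite nderivD add1n; exact: uk.
have [H dH] : exists H : R -> C, forall x, isd D1 H x (- q x).
  by apply: complex_antiderivative => x; apply: cvgCN; exact: cq.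
have cH : continuous H by move=> x; exact: isd_continuous (dH x).
have pairD tau : ctest tau -> is_pairing H (nderiv 1 tau) (u (nderiv 1 tau)).
  move=> ct; have [a [b [a0 ab [st vt]]]] := ct.
  have cm := mul_vanish_continuous a0 (vt 1%N) (fun x _ => cH x) (st 1%N).1.
  have [F dF] := complex_antiderivative cm.
  exists a, b, F; split; [exact: a0|exact: ab|exact: vt|exact: dF|].
  (* Integration by parts; the boundary term H tau vanishes at both ends. *)
  have dG x : isd D1 (fun y => F y - H y * tau y) x (q x * tau x).
    have := isdD (dF x) (isdN (isdM (dH x) (smooth1_isd 0%N x st))).
    by congr (isd _ _ _ _); rewrite -[nderiv 0 tau x]/(tau x); ring.
  have -> := is_pairing_in (rq tau ct) (ltW ab) (vt 0%N) dG.
  have -> : tau b = 0 by apply: (vt 0%N); right.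
  have -> : tau a = 0 by apply: (vt 0%N); left.
  by rewrite !mulr0 !subr0.
have [s [ss s0 s1 cs]] := @bump_exists R.
have Cs : ctest (nderiv 1 s) by exists (1/2), 3; split => //; lra.
have [zs hzs] := is_pairing_exists (fun x _ => cH x) Cs.
(* The constant is read off at s', whose integral is one. *)
pose d : C := u (nderiv 1 s) - zs.
exists (fun x => H x + cst d x); split.
- by move=> x; apply: cvgCD; [exact: cH|exact: cvg_cst].
- exists (nrm (H 0) + `|K| + nrm d) => x x0.
  apply: (le_trans (nrmD _ _)).
  have h1 : nrm (H x - H 0) <= `|K| * (1 + x) ^+ m * (x - 0).
    apply: (@complex_lipschitz R H (fun y => - q y)) => // y /andP[y0 yx].
    rewrite nrmN; apply: (le_trans (hK y y0)).
    apply: (le_trans (ler_wpM2r _ (ler_norm K))); first by rewrite exprn_ge0// addr_ge0.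
    by rewrite ler_wpM2l//; apply: lerXn2r; rewrite ?nnegrE; lra.
  have w1 : 1 <= (1 + x) ^+ m.+1 by apply: exprn_ege1; lra.
  have wm : (1 + x) ^+ m * x <= (1 + x) ^+ m.+1.
    by rewrite exprSr ler_wpM2l ?exprn_ge0//; lra.
  have h2 : nrm (H x) <= nrm (H x - H 0) + nrm (H 0).
    by apply: le_trans (nrmD _ _); rewrite subrK.
  have h3 := ler_wpM2l (nrm_ge0 (H 0)) w1; have h4 := ler_wpM2l (nrm_ge0 d) w1.
  have h5 := ler_wpM2l (normr_ge0 K) wm.
  by rewrite subr0 -mulrA in h1; rewrite /cst; lra.
- move=> rho cr; have [a [b [a0 ab [sr vr]]]] := cr.
  have [G dG] := complex_antiderivative (fun x => (sr 0%N).1 x).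
  pose c : C := G b - G a.
  (* An antiderivative of rho becomes compactly supported once its final value c is removed by c s.
     This gives rho = c s' + tau'. *)
  pose tau := (- c) *: s + (fun x => G x - G a).
  pose jG n : R -> C := if n is k.+1 then nderiv k rho else (fun x => G x - G a).
  have jGd n x : isd D1 (jG n) x (jG n.+1 x).
    case: n => [|n]; last exact: smooth1_isd.
    by rewrite -[jG 1%N x]subr0; apply: (isdD (dG x)); rewrite oppr0; exact: isd_cst.
  have sG : smooth1 (fun x => G x - G a) := @jet_smooth1 R jG jGd.
  have eG n : nderiv n (fun x => G x - G a) = jG n := @jet_nderiv R jG n jGd.
  have [Ga Gb] : (forall x, x <= a -> G x = G a) /\ (forall x, b <= x -> G x = G b).
    split=> x hx.
      apply/esym/isd0_cst => // y /andP[_ ya].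
      by have := dG y; rewrite vr//; left.
    apply: isd0_cst => // y /andP[yb _].
    by have := dG y; rewrite vr//; right.
  pose a1 := Num.min a (1/2); pose b1 := Num.max b 3.
  have a10 : 0 < a1 by rewrite lt_min a0; lra.
  have ab1 : a1 < b1 by rewrite lt_max gt_min ab.
  have le1 : a1 <= a by rewrite ge_min lexx.
  have le2 : b <= b1 by rewrite le_max lexx.
  have le3 : a1 <= 1/2 by rewrite ge_min lexx orbT.
  have le4 : 3 <= b1 by rewrite le_max lexx orbT.
  have st : smooth1 tau by exact: smooth1_lin.
  have ct : ctest tau.
    exists a1, b1; split; [exact: a10|exact: ab1|split; first exact: st].
    move=> n x hx; rewrite /tau (nderiv_lin _ n ss sG) linfunE eG.
    case: n => [|n].
      rewrite /jG -[nderiv 0 s x]/(s x); case: hx => hx.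
        by rewrite s0 ?Ga ?subrr ?mulr0 ?addr0//; lra.
      have hs : 2 <= x by lra.
      have hb : b <= x by lra.
      by rewrite (s1 _ hs) (Gb _ hb) mulr1 -/c addNr.
    rewrite /jG (vanish_offW le1 le2 (vr n) hx) addr0.
    have := vanish_offW le3 le4 (cs.2 n) hx; rewrite nderivD addn1 => ->.
    by rewrite mulr0.
  have e1 : nderiv 1 tau = (- c) *: nderiv 1 s + rho.
    by rewrite /tau (nderiv_lin _ 1 ss sG) eG.
  have e2 : rho = c *: nderiv 1 s + nderiv 1 tau.
    rewrite e1 !linfunE; apply: funext => x; ring.
  have p1 := is_pairing_lin c hzs (pairD tau ct).
  rewrite -e2 in p1.
  have p2 : is_pairing (cst d) rho (d * c).
    exists a, b, (fun x => d * G x); split; [exact: a0|exact: ab|exact: (vr 0%N)| |].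
      by move=> x; exact: isdZ.
    by rewrite /c mulrBr.
  have := is_pairingD p1 p2; congr (is_pairing _ _ _).
  rewrite [in RHS]e2 ul; [|exact: Cs|exact: ctest_nderiv]; clear p1 p2 e1 e2.
  by rewrite addrAC [d * c]mulrC -mulrDr /d [zs + _]addrC subrK.
Qed.

(** The density from the kernels reproduces u on derivatives of order m + 2. The difference of the
    two functionals annihilates these derivatives and so has a density of its own, which is
    added. *)
Lemma test_representation (L m : nat) (K : R) (u : (R -> C) -> C) : 0 < K -> test_linear u ->
  (forall rho A, ctest rho ->
    (forall x, 0 <= x -> (1 + x) ^+ L * nrm (nderiv m rho x) <= A) ->
    nrm (u (nderiv m.+2 rho)) <= K * A) ->
  exists h, [/\ forall x : R, 0 < x -> {for x, continuous h},
    exists K : R, forall x : R, 0 <= x -> nrm (h x) <= K * (1 + x) ^+ (L + m).+3 &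
    represents h u].
Proof.
move=> K0 ul uK; have [h [ch bh rh]] := complex_representation K0 ul uK.
pose p rho : C := xget 0 [set z | is_pairing h rho z].
have pP rho : ctest rho -> is_pairing h rho (p rho).
  move=> cr; have [z hz] := is_pairing_exists ch cr.
  by rewrite /p; case: xgetP => [y _ //|/(_ z)].
have pl : test_linear p.
  move=> c rho tau cr ct; apply: is_pairing_unique (pP _ _) _; first exact: ctest_lin.
  by apply: is_pairing_lin; exact: pP.
have [||g [cg [M hM] rg]] := @kernel_representation m.+2 (fun rho => u rho - p rho).
- move=> c rho tau cr ct; rewrite ul// pl//; clear.
  by move: (u rho) (u tau) (p rho) (p tau) c => x y z t c; ring.
- move=> rho cr; apply/eqP; rewrite subr_eq0; apply/eqP.
  exact: is_pairing_unique (rh _ cr) (pP _ (ctest_nderiv _ cr)).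
exists (fun x => h x + g x); split.
- by move=> x x0; apply: cvgCD; [exact: ch|exact: cg].
- exists (2 * K + `|M|) => x x0; apply: (le_trans (nrmD _ _)).
  have w k : (k <= (L + m).+3)%N -> (1 + x) ^+ k <= (1 + x) ^+ (L + m).+3.
    by move=> kL; apply: ler_weXn2l => //; lra.
  rewrite mulrDl lerD//.
    apply: (le_trans (bh x x0)); apply: ler_wpM2l; first by rewrite mulr_ge0// ltW.
    by apply: w; rewrite !ltnS (leq_trans (leq_addr m L))// leqW.
  apply: (le_trans (hM x x0)); apply: (le_trans (ler_wpM2r _ (ler_norm M))).
    by rewrite exprn_ge0// addr_ge0.
  by rewrite ler_wpM2l// w// !ltnS (leq_trans (leq_addl L m)).
- move=> rho cr; have -> : u rho = p rho + (u rho - p rho) by ring.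
  by apply: is_pairingD; [exact: pP|exact: rg].
Qed.

End ComplexRepresentation.

(** * From densities to regular distributions and Cesaro estimates *)

Section RegularDistributions.
Context {R : realType}.
Local Notation mu := (@lebesgue_measure R).
Local Notation C := (R[i]^o).
Local Notation D1 := (1 : R^o).
Implicit Types (h rho : R -> C) (u : (R -> C) -> C).

Lemma Rintegral_vanish_off (D : set R) (g G : R -> R) (a b : R) : measurable D ->
  a < b -> `[a, b]%classic `<=` D -> continuous g ->
  (forall x, x <= a \/ b <= x -> g x = 0) -> (forall x : R, is_derive x 1 G (g x)) ->
  \int[mu]_(x in D) g x = G b - G a.
Proof.
move=> mD ab sD cg g0 dG.
have -> : \int[mu]_(x in D) g x = \int[mu]_(x in `[a, b]) g x.
  rewrite Rintegral_mkcond [RHS]Rintegral_mkcond; congr (Rintegral _ _ _).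
  apply: funext => x; rewrite !patchE.
  have [xab|xab] := pselect (`[a, b]%classic x).
    by rewrite !mem_set//; exact: sD.
  rewrite (memNset xab); case: ifP => // _; apply: g0.
  have [|ax] := leP x a; first by left.
  by right; rewrite leNgt; apply/negP => xb; apply: xab; rewrite /= in_itv/= !ltW.
rewrite /Rintegral (@continuous_FTC2 _ g G)//.
- exact: continuous_subspaceT.
- split.
  + by move=> x _; have [] := dG x.
  + apply: cvg_at_right_filter; apply: differentiable_continuous.
    by rewrite -derivable1_diffP; have [] := dG a.
  + apply: cvg_at_left_filter; apply: differentiable_continuous.
    by rewrite -derivable1_diffP; have [] := dG b.
- by move=> x _; rewrite derive1E; have [_ ->] := dG x.
Qed.

(** Here the increments of antiderivatives become the Lebesgue integrals of [regular_on]. *)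
Lemma pairing_cintegral (D : set R) (a b : R) h rho z : measurable D -> 0 < a -> a < b ->
  `[a, b]%classic `<=` D -> (forall x : R, 0 < x -> {for x, continuous h}) ->
  ctest_in a b rho -> is_pairing h rho z -> z = cintegral D (fun x => h x * rho x).
Proof.
move=> mD a0 ab sD ch [sr vr] hz.
have cm := mul_vanish_continuous a0 (vr 0%N) ch (sr 0%N).1.
have [F dF] := complex_antiderivative cm.
rewrite (is_pairing_in hz (ltW ab) (vr 0%N) dF) /cintegral.
have v0 x : x <= a \/ b <= x -> h x * rho x = 0.
  by move=> hx; have := vr 0%N x hx; rewrite /nderiv /= => ->; rewrite mulr0.
have e1 : \int[mu]_(x in D) complex.Re (h x * rho x) = complex.Re (F b) - complex.Re (F a).
  apply: (@Rintegral_vanish_off D (fun x => complex.Re (h x * rho x)) (fun x => complex.Re (F x)) a b mD ab sD).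
  - by move=> x; have /continuousCP[] := cm x.
  - by move=> x /v0 ->.
  - by move=> x; have /isd1_ReIm[] := dF x.
have e2 : \int[mu]_(x in D) complex.Im (h x * rho x) = complex.Im (F b) - complex.Im (F a).
  apply: (@Rintegral_vanish_off D (fun x => complex.Im (h x * rho x)) (fun x => complex.Im (F x)) a b mD ab sD).
  - by move=> x; have /continuousCP[] := cm x.
  - by move=> x /v0 ->.
  - by move=> x; have /isd1_ReIm[] := dF x.
by rewrite e1 e2; case: (F b) => p q; case: (F a).
Qed.

Lemma continuous_locally_integrable (D : set R) (g : R -> R) : open D ->
  (forall x, D x -> {for x, continuous g}) -> locally_integrable D g.
Proof.
move=> oD cg; have mg : measurable_fun D g.
  by apply: open_continuous_measurable_fun => // x /set_mem; exact: cg.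
split=> // K KD cK.
have : mu.-integrable K (EFin \o g).
  apply: continuous_compact_integrable => //.
  apply: continuous_in_subspaceT => x /set_mem Kx; exact/cg/KD.
by move=> /integrableP[_].
Qed.

Lemma supp_subset (D : set R) rho : test1 D rho ->
  rho = 0 \/ exists a b : R, [/\ D a, D b & forall x, rho x != 0 -> a <= x <= b].
Proof.
move=> [_ cs sD]; have [[x0 hx0]|h] := pselect (exists x, rho x != 0); last first.
  left; apply: funext => x; apply/eqP/negPn/negP => hx; apply: h; by exists x.
right; have sn0 : supp rho !=set0 by exists x0; exact: subset_closure.
have ci : {within supp rho, continuous (@id R)} by apply: continuous_subspaceT => x; exact: cvg_id.
have [b bs hb] := compact_EVT_max sn0 cs ci.
have [a as_ ha] := compact_EVT_min sn0 cs ci.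
exists a, b; split; [exact/sD/set_mem|exact/sD/set_mem|] => x hx.
have sx : supp rho x by exact: subset_closure.
by rewrite ha ?hb//; exact: mem_set.
Qed.

Lemma test1_ctest_in (D : set R) rho (a b a' b' : R) : test1 D rho ->
  (forall x, rho x != 0 -> a <= x <= b) -> a' < a -> b < b' -> ctest_in a' b' rho.
Proof.
move=> [sr _ _] hab aa bb; split=> // n x hx.
have z y : ~~ (a <= y <= b) -> rho y = 0.
  by move=> hy; apply/eqP/negPn/negP => /hab; rewrite (negbTE hy).
case: hx => hx.
  have H := @nderiv_open_eq0 R [set t | t < a] rho n (@open_lt _ _) sr.
  by apply: H => /=; [move=> y ya; apply: z; rewrite leNgt ya|exact: le_lt_trans aa].
have H := @nderiv_open_eq0 R [set t | b < t] rho n (@open_gt _ _) sr.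
apply: H => /=; last exact: lt_le_trans hx.
by move=> y yb; apply: z; rewrite [y <= b]leNgt yb andbF.
Qed.

Lemma represents_regular_on (D : set R) h u :
  (D = `]0, +oo[%classic \/ D = `]0, 1[%classic) ->
  (forall x : R, 0 < x -> {for x, continuous h}) -> represents h u -> regular_on D u h.
Proof.
move=> hD ch rh.
have mD : measurable D by case: hD => ->; exact: measurable_itv.
have oD : open D by case: hD => ->; exact: interval_open.
have D0 : D `<=` [set x | 0 < x].
  by case: hD => -> x /=; rewrite in_itv/= ?andbT// => /andP[].
split.
- by apply: continuous_locally_integrable => // x /D0/ch/continuousCP[].
- by apply: continuous_locally_integrable => // x /D0/ch/continuousCP[].
- move=> rho ht.
  suff [a [b [a0 ab sD cr]]] : exists a b : R, [/\ 0 < a, a < b, `[a, b]%classic `<=` D & ctest_in a b rho].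
    by apply: (pairing_cintegral mD a0 ab sD ch cr); apply: rh; exists a, b; split.
  have [->|[a [b [Da Db hab]]]] := supp_subset ht.
    exists (1/4), (1/2); split; [lra|lra| |].
      by case: hD => -> x /=; rewrite !in_itv/= ?andbT; lra.
    by split; [exact: smooth1_0|move=> n x _; rewrite nderiv_0].
  have a0 := D0 _ Da; rewrite /= in a0.
  have [/andP[ab1 ab2]|nab] := boolP (a <= b <= b); last first.
    have r0 x : rho x = 0.
      apply/eqP/negPn/negP => /hab /andP[ax xb]; move: nab; rewrite lexx andbT.
      by rewrite (le_trans ax xb).
    exists (1/4), (1/2); split; [lra|lra| |].
      by case: hD => -> x /=; rewrite !in_itv/= ?andbT; lra.
    rewrite (_ : rho = 0); last exact/funext.
    by split; [exact: smooth1_0|move=> n x _; rewrite nderiv_0].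
  (* The extreme points of the support lie in the open set D, so there is room to enlarge the
     interval on both sides within D. *)
  case: hD => eD; rewrite eD /= in_itv/= in Db.
    exists (a / 2), (b + 1); split; [lra|lra| |].
      by rewrite eD => x /=; rewrite !in_itv/= ?andbT; lra.
    by apply: (test1_ctest_in ht hab); lra.
  exists (a / 2), ((b + 1) / 2); split; [lra|lra| |].
    by rewrite eD => x /=; rewrite !in_itv/= ?andbT; lra.
  by apply: (test1_ctest_in ht hab); lra.
Qed.

Lemma represents_continuous_on_pos h u :
  (forall x : R, 0 < x -> {for x, continuous h}) -> represents h u -> continuous_on_pos u.
Proof.
move=> ch rh; exists h; first exact: ch.
by apply: represents_regular_on => //; left.
Qed.

(** The zero polynomial serves at both ends. At infinity the growth exponent N is at most alpha + m.
    Near 0 the exponent m - alpha is at most 0, so boundedness of h is enough. *)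
Lemma primitive_cesaro h (g : (R -> C) -> C) (m : nat) (alpha K : R) (N : nat) :
  (forall x : R, 0 < x -> {for x, continuous h}) -> represents h (primitive m g) ->
  (forall x : R, 0 <= x -> nrm (h x) <= K * (1 + x) ^+ N) ->
  N%:R <= alpha -> m%:R <= alpha ->
  cesaro_infty m alpha g /\ cesaro_zero m alpha g.
Proof.
move=> ch rh bh Na ma; split.
  exists 0, h, 0; split; [by apply: represents_regular_on => //; left|by rewrite size_poly0|].
  (* For x >= 1 one has 1 + x <= 2 x. *)
  exists (`|K| * 2 ^+ N); near=> x.
  have x1 : 1 <= x by near: x; exact: nbhs_pinfty_ge.
  rewrite horner0 subr0 normcNc lecR; apply: (le_trans (bh x _)); first by lra.
  apply: (le_trans (ler_wpM2r _ (ler_norm K))); first by apply: exprn_ge0; lra.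
  rewrite -mulrA ler_wpM2l//; apply: (@le_trans _ _ ((2 * x) ^+ N)).
    by apply: lerXn2r; rewrite ?nnegrE; lra.
  rewrite exprMn ler_wpM2l ?exprn_ge0// -powR_mulrn; last by lra.
  by apply: ler_powR => //; rewrite (le_trans Na)// lerDl.
exists 1, h, 0; split; [by []|by apply: represents_regular_on => //; right|by rewrite size_poly0|].
exists (`|K| * 2 ^+ N); near=> x.
have x0 : 0 < x by near: x; exact: nbhs_right_gt.
have x1 : x <= 1 by near: x; apply: nbhs_right_le; exact: ltr01.
rewrite horner0 subr0 normcNc lecR; apply: (le_trans (bh x _)); first by lra.
apply: (le_trans (ler_wpM2r _ (ler_norm K))); first by apply: exprn_ge0; lra.
rewrite -[leLHS]mulr1; apply: ler_pM => //.
- by rewrite mulr_ge0// exprn_ge0//; lra.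
- by rewrite ler_wpM2l//; apply: lerXn2r; rewrite ?nnegrE; lra.
- by rewrite -[leLHS](powRr0 x); apply: ger_powR; [rewrite x0 x1|lra].
Unshelve. all: by end_near. Qed.

End RegularDistributions.

(** * Schwartz functions of one variable *)

Section SchwartzSeminorms.
Context {R : realType}.
Local Notation C := (R[i]^o).
Local Notation D1 := (1 : R^o).
Implicit Types (f rho tau : R -> C).

Definition sball (J : nat) rho (A : R) : Prop := forall k n, (k <= J)%N -> (n <= J)%N ->
  forall x, `|x| ^+ k * nrm (nderiv n rho x) <= A.

Lemma schwartz1_sball rho : schwartz1 rho <-> smooth1 rho /\ forall J, exists A, sball J rho A.
Proof.
rewrite schwartz1P; split=> -[sr h]; split=> //.
  move=> J; have /choice[A hA] : forall k, exists a : nat -> R,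
      forall n x, `|x| ^+ k * nrm (nderiv n rho x) <= a n.
    by move=> k; have /choice[a ha] := h k; exists a.
  exists (\sum_(k < J.+1) \sum_(n < J.+1) `|A k n|) => k n kJ nJ x.
  apply: (le_trans (hA k n x)); apply: (le_trans (ler_norm _)).
  have kJ' : (k < J.+1)%N by []. have nJ' : (n < J.+1)%N by [].
  rewrite (bigD1 (Ordinal kJ'))//= (bigD1 (Ordinal nJ'))//= -addrA lerDl.
  by rewrite addr_ge0//; apply: sumr_ge0 => i _ //; apply: sumr_ge0.
move=> k n; have [A hA] := h (maxn k n); exists A => x; apply: hA; first exact: leq_maxl.
exact: leq_maxr.
Qed.

Lemma sballW J J' rho A A' : (J <= J')%N -> A' <= A -> sball J' rho A' -> sball J rho A.
Proof.
move=> JJ AA h k n kJ nJ x; apply: le_trans AA; apply: h; exact: leq_trans JJ.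
Qed.

Lemma sball_ge0 J rho A : sball J rho A -> 0 <= A.
Proof.
move=> h; apply: le_trans (h 0%N 0%N _ _ 0) => //.
by rewrite expr0 mul1r nrm_ge0.
Qed.

Lemma sball_lin J rho tau A B (c : R[i]) : smooth1 rho -> smooth1 tau ->
  sball J rho A -> sball J tau B -> sball J (c *: rho + tau) (nrm c * A + B).
Proof.
move=> sr st hA hB k n kJ nJ x; rewrite nderiv_lin// linfunE.
apply: (@le_trans _ _ (`|x| ^+ k * (nrm c * nrm (nderiv n rho x) + nrm (nderiv n tau x)))).
  by rewrite ler_wpM2l ?exprn_ge0// -nrmM; exact: nrmD.
rewrite mulrDr mulrCA lerD//; last exact: hB.
by rewrite ler_wpM2l ?nrm_ge0//; exact: hA.
Qed.

Lemma schwartz1_smooth rho : schwartz1 rho -> smooth1 rho. Proof. by case. Qed.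

Lemma schwartz1_lin (c : R[i]) rho tau : schwartz1 rho -> schwartz1 tau ->
  schwartz1 (c *: rho + tau).
Proof.
move=> /schwartz1_sball[sr hr] /schwartz1_sball[st ht]; apply/schwartz1_sball.
split; first exact: smooth1_lin.
by move=> J; have [A hA] := hr J; have [B hB] := ht J; exists (nrm c * A + B); exact: sball_lin.
Qed.

Lemma schwartz1_0 : schwartz1 (0 : R -> C).
Proof.
apply/schwartz1_sball; split; first exact: smooth1_0.
by move=> J; exists 0 => k n _ _ x; rewrite nderiv_0 nrm0 mulr0.
Qed.

Lemma schwartz1B rho tau : schwartz1 rho -> schwartz1 tau -> schwartz1 (rho - tau).
Proof. by move=> hr ht; rewrite addrC -scaleN1r; exact: schwartz1_lin. Qed.

Lemma schwartz1_nderiv n rho : schwartz1 rho -> schwartz1 (nderiv n rho).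
Proof.
move=> /schwartz1_sball[sr hr]; apply/schwartz1_sball; split; first exact: smooth1_nderiv.
move=> J; have [A hA] := hr (J + n)%N; exists A => k l kJ lJ x; rewrite nderivD.
by apply: hA; rewrite ?leq_add2r// (leq_trans kJ)// leq_addr.
Qed.

Lemma ctest_in_schwartz1 (a b : R) rho : a < b -> ctest_in a b rho -> schwartz1 rho.
Proof.
move=> ab cr; apply/schwartz1P; split; first exact: cr.1.
move=> k n; have [M hM] := ctest_bounded n ab cr; exists ((`|a| + `|b|) ^+ k * M) => x.
have M0 : 0 <= M by apply: le_trans (nrm_ge0 _) (hM 0).
have P0 : 0 <= (`|a| + `|b|) ^+ k * M by rewrite mulr_ge0// exprn_ge0// addr_ge0.
have [xa|ax] := leP x a; first by rewrite cr.2 ?nrm0 ?mulr0//; left.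
have [bx|xb] := leP b x; first by rewrite cr.2 ?nrm0 ?mulr0//; right.
have hx : `|x| <= `|a| + `|b|.
  rewrite ler_norml; have := ler_norm b; have := ler_norm (- a); have := normr_ge0 a.
  have := normr_ge0 b; rewrite normrN; lra.
apply: ler_pM; [exact: exprn_ge0|exact: nrm_ge0| |exact: hM].
by apply: lerXn2r => //; rewrite nnegrE addr_ge0.
Qed.

Lemma ctest_schwartz1 rho : ctest rho -> schwartz1 rho.
Proof. by move=> [a [b [_ ab cr]]]; exact: ctest_in_schwartz1 ab cr. Qed.

Lemma schwartz1_nbhdP N e rho0 rho :
  schwartz1_nbhd N e rho0 rho <-> schwartz1 rho /\ sball N (rho - rho0) e.
Proof.
split=> -[sr h]; split=> // k n kN nN x.
  by have := h k n kN nN x; rewrite normcNc nrmM nrm_real normrX lecR.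
by rewrite normcNc nrmM nrm_real normrX lecR; exact: h.
Qed.

Lemma tempered1P (u : (R -> C) -> C) : tempered1 u <->
  (forall (c : R[i]) rho tau, schwartz1 rho -> schwartz1 tau ->
     u (c *: rho + tau) = c * u rho + u tau) /\
  exists (N : nat) (K : R), forall rho A, schwartz1 rho -> sball N rho A -> nrm (u rho) <= K * A.
Proof.
split=> -[ul h]; split=> //.
  have u0 : u 0 = 0.
    have := ul (-1) _ _ schwartz1_0 schwartz1_0; rewrite scaler0 addr0.
    by move=> /eqP; rewrite mulN1r addNr => /eqP.
  have [N [d [d0 hd]]] := h 0 schwartz1_0 1 ltr01.
  exists N, (d^-1) => rho A sr hA; have A0 := sball_ge0 hA.
  rewrite leNgt; apply/negP => lt.
  have nu0 : 0 < nrm (u rho) by apply: le_lt_trans lt; rewrite mulr_ge0// invr_ge0 ltW.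
  (* If the bound failed, rho / |u(rho)| would lie in the neighbourhood of 0 on which |u| < 1,
     although u has modulus 1 there. *)
  pose c : R := (nrm (u rho))^-1.
  have cu : u (c%:C *: rho) = c%:C * u rho.
    by rewrite -[_ *: rho]addr0 ul ?u0 ?addr0//; exact: schwartz1_0.
  have /hd : schwartz1_nbhd N d 0 (c%:C *: rho).
    apply/schwartz1_nbhdP; rewrite subr0; split.
      by rewrite -[_ *: rho]addr0; apply: schwartz1_lin => //; exact: schwartz1_0.
    move=> k n kN nN x; rewrite nderivZ; last exact: schwartz1_smooth.
    rewrite scalefunE nrmM nrm_real mulrCA gtr0_norm ?invr_gt0// ler_pdivrMl//.
    by apply: (le_trans (hA k n kN nN x)); move: lt; rewrite ltr_pdivrMl// mulrC => /ltW.
  rewrite u0 subr0 cu normcNc nrmM nrm_real ltcR gtr0_norm ?invr_gt0//.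
  by rewrite mulVf ?gt_eqF// ltxx.
move=> rho0 s0 e e0; have [N [K hK]] := h; exists N, (e / (`|K| + 1)).
have K1 : 0 < `|K| + 1 by rewrite ltr_wpDl.
split; first by rewrite divr_gt0.
move=> rho /schwartz1_nbhdP[sr hr]; rewrite normcNc ltcR.
have -> : u rho - u rho0 = u (rho - rho0).
  rewrite (_ : rho - rho0 = (-1) *: rho0 + rho); last by rewrite scaleN1r addrC.
  by rewrite ul// mulN1r addrC.
apply: (le_lt_trans (hK _ _ (schwartz1B sr s0) hr)).
rewrite mulrCA -[ltRHS]mulr1 ltr_pM2l// ltr_pdivrMr// mul1r.
by rewrite (le_lt_trans (ler_norm _))// ltrDl.
Qed.

End SchwartzSeminorms.

(** * Antiderivatives of rapidly decreasing functions *)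

Section Decay.
Context {R : realType}.
Local Notation C := (R[i]^o).
Local Notation D1 := (1 : R^o).

Lemma inv_pow_derive (k : nat) (x : R) : -1 < x ->
  is_derive x 1 (fun t : R => - (1 + t) ^- k.+1) (k.+1%:R * (1 + x) ^- k.+2).
Proof.
move=> x1; have n0 : 1 + x != 0 by rewrite gt_eqF//; lra.
have d1 : is_derive x 1 (fun t : R => 1 + t) 1.
  rewrite -[X in is_derive _ _ _ X]add0r.
  exact: (is_deriveD (is_derive_cst _ _ _) (is_derive_id _ _)).
have dX : is_derive x 1 (fun t : R => (1 + t) ^+ k.+1) (k.+1%:R * (1 + x) ^+ k).
  have := @is_deriveX R R (fun t : R => 1 + t) k.+1 x 1 1 d1.
  rewrite (_ : (fun t : R => 1 + t) ^+ k.+1 = fun t => (1 + t) ^+ k.+1); last by rewrite exprfctE.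
  by rewrite /GRing.scale/= mulr1.
have dV := @is_deriveV R (fun t : R => (1 + t) ^+ k.+1) x _ _ (expf_neq0 _ n0) dX.
have := is_deriveN dV; congr (is_derive _ _ _ _).
rewrite /GRing.scale/= -mulNr opprK mulrCA; congr (_ * _).
rewrite -exprM [(k.+1 * 2)%N](_ : _ = (k + k.+2)%N); last by rewrite muln2 -addnn addSn !addnS.
by rewrite exprD invfM mulrAC mulVf ?mul1r// expf_neq0.
Qed.

Lemma decay_increment (F f : R -> C) (A : R) (k : nat) : 
  (forall x, 0 <= x -> isd D1 F x (f x)) ->
  (forall x, 0 <= x -> nrm (f x) <= A * (1 + x) ^- k.+2) ->
  forall x y, 0 <= x -> x <= y -> nrm (F y - F x) <= A * (1 + x) ^- k.+1.
Proof.
move=> dF hA x y x0 xy.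
have A0 : 0 <= A.
  by have := le_trans (nrm_ge0 _) (hA 0 (lexx 0)); rewrite addr0 expr1n invr1 mulr1.
have y0 := le_trans x0 xy.
have h := @complex_comparison R F f (fun t => A * - (1 + t) ^- k.+1)
  (fun t => A * (k.+1%:R * (1 + t) ^- k.+2)) x y xy
  (fun z hz => dF z (le_trans x0 (andP hz).1)) _ _.
apply: (le_trans (h _ _)).
- move=> z /andP[xz _]; apply: (@is_deriveZ _ _ _ (fun t : R => - (1 + t) ^- k.+1) A).
  by apply: inv_pow_derive; lra.
- move=> z /andP[xz _]; have z0 := le_trans x0 xz.
  apply: (le_trans (hA z z0)); rewrite ler_wpM2l// ler_peMl ?ler1n//.
  by rewrite invr_ge0 exprn_ge0//; lra.
- rewrite mulrN mulrN opprK addrC gerDl oppr_le0 mulr_ge0// invr_ge0 exprn_ge0//; lra.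
Qed.

(** The limit is obtained once, from quadratic decay, and then serves for all rates [k] and
    constants [B]. *)
Lemma decay_limit (F f : R -> C) (A : R) :
  (forall x, 0 <= x -> isd D1 F x (f x)) ->
  (forall x, 0 <= x -> nrm (f x) <= A * (1 + x) ^- 2) ->
  exists L : C, forall k B, (forall x, 0 <= x -> nrm (f x) <= B * (1 + x) ^- k.+2) ->
    forall x, 0 <= x -> nrm (F x - L) <= B * (1 + x) ^- k.+1.
Proof.
move=> dF hA; have inc := decay_increment dF hA.
have [|L hL] := @complex_effective_limit R R 0 (fun x => F `|x|) (fun x => A * (1 + `|x|) ^- 1).
  move=> x y; have A0 t : 0 <= A * (1 + `|t|) ^- 1.
    apply: le_trans (nrm_ge0 (F `|t| - F `|t|)) _; exact: inc.
  have [xy|/ltW yx] := leP `|x| `|y|.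
    by rewrite nrmBC; apply: (le_trans (inc _ _ _ xy)) => //; rewrite lerDl.
  by apply: (le_trans (inc _ _ _ yx)) => //; rewrite lerDr.
exists L => k B hB x x0; have incB := decay_increment dF hB.
apply/ler_addgt0Pr => e e0.
(* Far enough out for F y to be within e of the limit; the 2 is the factor lost in
   [complex_effective_limit]. *)
pose y := Num.max x (2 * `|A| / e).
have y0 : 0 <= y by rewrite le_max x0.
have xy : x <= y by rewrite le_max lexx.
have h1 := incB x y x0 xy.
have h2 : nrm (F y - L) <= e.
  have := hL y; rewrite ger0_norm// => /le_trans; apply.
  rewrite expr1 mulrA ler_pdivrMr; last by lra.
  have ye : 2 * `|A| / e <= y by rewrite le_max lexx orbT.
  rewrite ler_pdivrMr// in ye; have := ler_norm A.
  have : e * (1 + y) = e + y * e by ring.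
  lra.
have -> : F x - L = (F x - F y) + (F y - L) by ring.
by apply: (le_trans (nrmD _ _)); rewrite lerD// nrmBC.
Qed.

Lemma weight_bound (z : R) (k : nat) (x A : R) : 0 <= z ->
  z <= A -> `|x| ^+ k * z <= A -> z <= 2 ^+ k * A * (2 * (1 + `|x|) ^- k).
Proof.
move=> z0 h1 h2; have A0 := le_trans z0 h1.
have w0 : 0 < (1 + `|x|) ^+ k by rewrite exprn_gt0// ltr_pwDl.
rewrite mulrA -[leRHS]/(_ / _) ler_pdivlMr//.
have [x1|/ltW x1] := leP `|x| 1.
  have : (1 + `|x|) ^+ k <= 2 ^+ k by apply: lerXn2r; rewrite ?nnegrE ?addr_ge0//; lra.
  move=> h3; apply: (@le_trans _ _ (A * 2 ^+ k)); first exact: ler_pM.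
  by rewrite mulrC ler_peMr ?mulr_ge0 ?exprn_ge0//; lra.
have h3 : (1 + `|x|) ^+ k <= 2 ^+ k * `|x| ^+ k.
  by rewrite -exprMn; apply: lerXn2r; rewrite ?nnegrE ?addr_ge0 ?mulr_ge0//; lra.
apply: (@le_trans _ _ (z * (2 ^+ k * `|x| ^+ k))); first by rewrite ler_wpM2l.
rewrite mulrCA [z * _]mulrC; apply: (@le_trans _ _ (2 ^+ k * A)).
  by rewrite ler_wpM2l ?exprn_ge0.
by rewrite ler_peMr ?mulr_ge0 ?exprn_ge0//; lra.
Qed.

End Decay.

(** * Primitives in the dual of Schwartz functions *)

Section Primitives.
Context {R : realType}.
Local Notation C := (R[i]^o).
Local Notation D1 := (1 : R^o).
Implicit Types (f g : (R -> C) -> C) (rho tau : R -> C).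

Lemma isd_translate (F : R -> C) (c x : R) (l : C) : isd D1 F (x + c) l ->
  isd D1 (fun y => F (y + c)) x l.
Proof.
move=> hF; have h : isd D1 (fun y : R => (y + c)%:C : C) x (1 : R)%:C.
  apply/isd1_ReIm => /=; split; last exact: is_derive_cst.
  rewrite -[X in is_derive _ _ _ X]addr0.
  exact: (is_deriveD (is_derive_id _ _) (is_derive_cst _ _ _)).
by have := isd_comp h hF; rewrite mul1r.
Qed.

Lemma isd_reflect (F : R -> C) (x : R) (l : C) : isd D1 F (- x) l ->
  isd D1 (fun y => F (- y)) x (- l).
Proof.
move=> hF; have h : isd D1 (fun y : R => (- y)%:C : C) x (- 1 : R)%:C.
  apply/isd1_ReIm => /=; split; last exact: is_derive_cst.
  exact: (is_deriveN (is_derive_id _ _)).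
by have := isd_comp h hF; rewrite rmorphN1 mulN1r.
Qed.

Lemma left_step_exists : exists theta : R -> C,
  [/\ smooth1 theta, forall x, x <= -3 -> theta x = 0, forall x, -2 <= x -> theta x = 1,
      forall n x, (x <= -4 \/ -1 <= x) -> nderiv n.+1 theta x = 0 &
      exists M : nat -> R, forall n x, nrm (nderiv n theta x) <= M n].
Proof.
have [s [ss s0 s1 cs]] := @bump_exists R.
(* The rise from 0 to 1 is moved from [1, 2] to [-3, -2]. *)
pose theta x := s (x + 4).
have sth : smooth1 theta.
  by apply: (@jet_smooth1 R (fun n y => nderiv n s (y + 4))) => n x; exact: isd_translate (smooth1_isd n _ ss).
have nth n : nderiv n theta = fun y => nderiv n s (y + 4).
  by apply: (@jet_nderiv R (fun n y => nderiv n s (y + 4))) => k x; exact: isd_translate (smooth1_isd k _ ss).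
have z n x : x <= -4 \/ -1 <= x -> nderiv n.+1 theta x = 0.
  move=> hx; rewrite nth -addn1 -nderivD; apply: cs.2.
  by case: hx => hx; [left|right]; lra.
exists theta; split; [exact: sth| | |exact: z|].
- by move=> x hx; apply: s0; lra.
- by move=> x hx; apply: s1; lra.
have h31 : (1 / 2 : R) < 3 by lra.
have /choice[M hM] : forall n, exists M, forall x, nrm (nderiv n theta x) <= M.
  have b n : exists M, forall x, nrm (nderiv n.+1 theta x) <= M.
    have [M hM] := ctest_bounded n h31 cs; exists M => x.
    by rewrite nth -addn1 -nderivD; exact: hM.
  move=> [|n]; last exact: b.
  have [M hM] := b 0%N; exists (1 + `|M|) => x.
  have [x3|x3] := leP x (-3); first by rewrite /nderiv /= /theta s0 ?nrm0 ?addr_ge0//; lra.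
  have [x2|x2] := leP (-2) x.
    by rewrite /nderiv /= /theta s1; [rewrite nrm1 lerDl|lra].
  have := @complex_lipschitz R theta (nderiv 1 theta) M (-3) x (ltW x3)
     (fun y _ => smooth1_isd 0%N y sth) (fun y _ => hM y).
  rewrite [theta (-3)]/theta s0 ?subr0; last lra.
  move=> /le_trans; apply; have := ler_norm M; have M0 := le_trans (nrm_ge0 _) (hM 0).
  have : M * (x - -3) <= M * 1 by rewrite ler_wpM2l//; lra.
  lra.
by exists M.
Qed.

Lemma schwartz1_ray_eq0 rho (a : C) (b : R) : schwartz1 rho ->
  (forall x, b <= x -> rho x = a) -> a = 0.
Proof.
move=> /schwartz1P[_ h] hr; have [M hM] := h 1%N 0%N.
apply/eqP/negPn/negP => an0.
have na : 0 < nrm a by rewrite lt_def nrm_ge0 andbT; apply: contra_neq an0; exact: nrm_eq0.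
pose x := Num.max b ((`|M| + 1) / nrm a).
have := hM x; rewrite expr1 /nderiv /= hr ?le_max ?lexx// => h1.
have : (`|M| + 1) / nrm a <= `|x|.
  by apply: (le_trans _ (ler_norm _)); rewrite le_max lexx orbT.
rewrite ler_pdivrMr// => h2; have := ler_norm M; lra.
Qed.

Lemma schwartz1_left_ray_eq0 rho (a : C) (b : R) : schwartz1 rho ->
  (forall x, x <= b -> rho x = a) -> a = 0.
Proof.
move=> /schwartz1P[_ h] hr; have [M hM] := h 1%N 0%N.
apply/eqP/negPn/negP => an0.
have na : 0 < nrm a by rewrite lt_def nrm_ge0 andbT; apply: contra_neq an0; exact: nrm_eq0.
pose x := Num.min b (- ((`|M| + 1) / nrm a)).
have := hM x; rewrite expr1 /nderiv /= hr ?ge_min ?lexx// => h1.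
have : (`|M| + 1) / nrm a <= `|x|.
  rewrite -[leRHS]normrN; apply: (le_trans _ (ler_norm _)).
  by rewrite lerNr ge_min lexx orbT.
rewrite ler_pdivrMr// => h2; have := ler_norm M; lra.
Qed.

Section Operator.
Variables (theta : R -> C) (M : nat -> R).
Hypotheses (sth : smooth1 theta) (th0 : forall x, x <= -3 -> theta x = 0)
  (th1 : forall x, -2 <= x -> theta x = 1)
  (thz : forall n x, (x <= -4 \/ -1 <= x) -> nderiv n.+1 theta x = 0)
  (thM : forall n x, nrm (nderiv n theta x) <= M n).

(* The multiple of [theta'] makes the primitive vanish at +oo; as [theta'] lives on the
   negative axis, primitives of functions supported there remain supported there. *)
Definition cut_primitive rho tau : Prop :=
  schwartz1 tau /\ exists c : C, forall x, isd D1 tau x (rho x - c * nderiv 1 theta x).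

(** Two candidates differ by d theta + e. A Schwartz function that is constant on a ray vanishes
    there: the left ray gives e = 0, the right ray d = 0. *)
Lemma cut_primitive_unique rho tau tau' : cut_primitive rho tau -> cut_primitive rho tau' ->
  tau = tau'.
Proof.
move=> [st [c dt]] [st' [c' dt']]; apply: funext => x.
have sd := schwartz1B st st'.
pose d := c' - c.
have dd y : isd D1 (fun y => (tau y - tau' y) + - (d * theta y)) y 0.
  have := isdD (isdD (dt y) (isdN (dt' y))) (isdN (isdZ d (smooth1_isd 0%N y sth))).
  by congr (isd _ _ _ _); rewrite /d; ring.
have cst y z : y <= z -> (tau z - tau' z) - d * theta z = (tau y - tau' y) - d * theta y.
  by move=> yz; apply: (isd0_cst (fun y _ => dd y) yz).
pose e := tau (-3) - tau' (-3).
have eE y : tau y - tau' y = d * theta y + e.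
  have -> : tau y - tau' y = (tau y - tau' y - d * theta y) + d * theta y by ring.
  rewrite [RHS]addrC; congr (_ + _).
  have [/cst h|/ltW /cst h] := leP (-3) y.
    by rewrite h th0// mulr0 subr0.
  by rewrite -h th0// mulr0 subr0.
have e0 : e = 0.
  apply: (schwartz1_left_ray_eq0 (b := -3) sd) => y y3.
  by rewrite -[LHS]/(tau y - tau' y) eE th0// mulr0 add0r.
have d0 : d = 0.
  apply: (schwartz1_ray_eq0 (b := -2) sd) => y y2.
  by rewrite -[LHS]/(tau y - tau' y) eE th1// mulr1 e0 addr0.
by apply/eqP; rewrite -subr_eq0 eE d0 mul0r e0 addr0.
Qed.

(** The first term bounds the two tails of the antiderivative. The second bounds the cut-off: the
    total integral of rho is at most 2^4 A, and the weights matter only for |x| <= 4. The last 1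
    accounts for the derivatives of rho itself. *)
Definition cut_primitive_const (J : nat) : R :=
  2 ^+ J.+3 + 2 ^+ 4 * (4 ^+ J * \sum_(n < J.+1) M n) + 1.

Lemma cut_primitive_exists rho : schwartz1 rho -> exists tau, cut_primitive rho tau /\
  forall J A, sball J.+2 rho A -> sball J tau (cut_primitive_const J * A).
Proof.
move=> hr; have /schwartz1_sball[sr br] := hr.
have [F dF] := complex_antiderivative (fun x => (sr 0%N).1 x).
have M0 n : 0 <= M n by apply: le_trans (thM n 0); exact: nrm_ge0.
have wb k J A : (k <= J)%N -> sball J.+2 rho A -> forall x,
    nrm (rho x) <= 2 ^+ k.+3 * A * (1 + `|x|) ^- k.+2.
  move=> kJ hA x.
  have h1 := hA 0%N 0%N isT isT x; rewrite expr0 mul1r in h1.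
  have h2 := hA k.+2 0%N kJ isT x.
  apply: (le_trans (weight_bound (nrm_ge0 _) h1 h2)).
  by rewrite [2 ^+ k.+3]exprS mulrCA !mulrA.
have [A0 hA0] := br 2%N.
have dFn x : isd D1 (fun y => F (- y)) x (- rho (- x)) by exact: isd_reflect (dF (- x)).
have [|Lp hLp] := @decay_limit R F rho (2 ^+ 3 * A0) (fun x _ => dF x).
  by move=> x x0; have := wb 0%N 0%N A0 isT hA0 x; rewrite ger0_norm.
have [|Lm hLm] := @decay_limit R _ _ (2 ^+ 3 * A0) (fun x _ => dFn x).
  move=> x x0; rewrite nrmN.
  by have := wb 0%N 0%N A0 isT hA0 (- x); rewrite normrN ger0_norm.
(* [c] is the integral of rho. Where theta = 1 the primitive below is F - Lp, and where theta = 0 it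
   is F - Lm, so it decays at both ends. Bounding it with weight k takes decay of order k + 2 of
   rho, whence the seminorm of order J + 2. *)
pose c := Lp - Lm.
pose tau x := F x - Lm - c * theta x.
pose jt n : R -> C := if n is k.+1 then fun x => nderiv k rho x - c * nderiv k.+1 theta x
  else tau.
have jd n x : isd D1 (jt n) x (jt n.+1 x).
  case: n => [|n] /=.
    rewrite -[rho x]subr0.
    exact: (isdD (isdD (dF x) (isdN (isd_cst _ Lm x))) (isdN (isdZ c (smooth1_isd 0%N x sth)))).
  exact: (isdD (smooth1_isd n x sr) (isdN (isdZ c (smooth1_isd n.+1 x sth)))).
have stau : smooth1 tau := @jet_smooth1 R jt jd.
have ntau n : nderiv n tau = jt n := @jet_nderiv R jt n jd.
have est J A : sball J.+2 rho A -> sball J tau (cut_primitive_const J * A).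
  move=> hA k n kJ nJ x; rewrite ntau; have A_0 := sball_ge0 hA.
  have W k' : (k' <= J)%N -> (2 : R) ^+ k'.+3 <= 2 ^+ J.+3.
    by move=> kk; apply: ler_weXn2l; [lra|rewrite !ltnS].
  have R1 k' y : (k' <= J)%N -> 0 <= y -> nrm (F y - Lp) <= 2 ^+ k'.+3 * A * (1 + y) ^- k'.+1.
    move=> kk y0; apply: hLp => // z z0.
    by have := wb k' J A kk hA z; rewrite ger0_norm.
  have R2 k' y : (k' <= J)%N -> 0 <= y -> nrm (F (- y) - Lm) <= 2 ^+ k'.+3 * A * (1 + y) ^- k'.+1.
    move=> kk y0; apply: hLm => // z z0; rewrite nrmN.
    by have := wb k' J A kk hA (- z); rewrite normrN ger0_norm.
  have pw (k' : nat) (y z : R) : (k' <= J)%N -> 0 <= y -> 0 <= z -> z <= 2 ^+ k'.+3 * A * (1 + y) ^- k'.+1 ->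
      y ^+ k' * z <= 2 ^+ J.+3 * A.
    move=> kk y0 z0 hz; apply: (@le_trans _ _ (2 ^+ k'.+3 * A)); last by rewrite ler_wpM2r// W.
    have w0 : 0 < (1 + y) ^+ k'.+1 by rewrite exprn_gt0//; lra.
    rewrite -[leRHS]/(_ / _) ler_pdivlMr// in hz.
    apply: le_trans hz; rewrite mulrC ler_wpM2l//.
    apply: (@le_trans _ _ ((1 + y) ^+ k')); first by apply: lerXn2r; rewrite ?nnegrE; lra.
    by apply: ler_weXn2l => //; lra.
  have hc : nrm c <= 2 ^+ 4 * A.
    have h1 := R1 0%N 0 (leq0n J) (lexx 0); have h2 := R2 0%N 0 (leq0n J) (lexx 0).
    rewrite oppr0 addr0 expr1n invr1 mulr1 in h1 h2.
    have -> : c = (F 0 - Lm) - (F 0 - Lp) by rewrite /c; ring.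
    by apply: (le_trans (nrmB _ _)); rewrite exprS; lra.
  have Mn : M n <= \sum_(n < J.+1) M n.
    have nJ' : (n < J.+1)%N by [].
    by rewrite (bigD1 (Ordinal nJ'))//= lerDl sumr_ge0.
  have th_part : `|x| <= 4 -> `|x| ^+ k * (nrm c * nrm (nderiv n theta x)) <=
      2 ^+ 4 * (4 ^+ J * \sum_(n < J.+1) M n) * A.
    move=> x4; rewrite mulrCA.
    have h1 : `|x| ^+ k <= 4 ^+ J.
      apply: (@le_trans _ _ (4 ^+ k)).
        by apply: lerXn2r; [rewrite nnegrE normr_ge0|rewrite nnegrE; lra|].
      by apply: ler_weXn2l => //; lra.
    have h2 : `|x| ^+ k * nrm (nderiv n theta x) <= 4 ^+ J * \sum_(n < J.+1) M n.
      by apply: ler_pM; rewrite ?exprn_ge0 ?nrm_ge0// (le_trans (thM n x)).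
    have := ler_pM (nrm_ge0 c) (mulr_ge0 (exprn_ge0 k (normr_ge0 x)) (nrm_ge0 (nderiv n theta x))) hc h2.
    lra.
  have SM0 : 0 <= 2 ^+ 4 * (4 ^+ J * \sum_(n < J.+1) M n) * A.
    by rewrite !mulr_ge0 ?exprn_ge0 ?sumr_ge0.
  have P20 : 0 <= 2 ^+ J.+3 * A by rewrite mulr_ge0// exprn_ge0.
  rewrite /cut_primitive_const !mulrDl mul1r.
  case: n nJ ntau Mn th_part => [|n] nJ ntau Mn th_part /=.
    have [x0|x0] := leP 0 x.
      have -> : tau x = F x - Lp by rewrite /tau /c th1; [ring|lra].
      have h := R1 k x kJ x0; rewrite -{1}(ger0_norm x0) in h.
      have := pw k x _ kJ x0 (nrm_ge0 _) (R1 k x kJ x0); rewrite ger0_norm//; lra.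
    have h := pw k (- x) _ kJ _ (nrm_ge0 _) (R2 k (- x) kJ _).
    rewrite opprK in h; have nx : `|x| = - x by rewrite ltr0_norm.
    have xm : 0 <= - x by lra.
    have {}h := h xm xm; rewrite -nx in h.
    have h3 : nrm (tau x) <= nrm (F x - Lm) + nrm c * nrm (theta x).
      by rewrite -nrmM; exact: nrmB.
    have h4 := ler_wpM2l (exprn_ge0 k (normr_ge0 x)) h3.
    rewrite mulrDr in h4.
    have [x4|x4] := leP `|x| 4.
      by have := th_part x4; rewrite -[nderiv 0 theta x]/(theta x); lra.
    move: h4; rewrite th0 ?nrm0 ?mulr0; lra.
  have h1 := hA k n (leq_trans kJ (leqW (leqnSn J))) (leq_trans (ltnW nJ) (leqW (leqnSn J))) x.
  have h3 : nrm (nderiv n rho x - c * nderiv n.+1 theta x) <=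
      nrm (nderiv n rho x) + nrm c * nrm (nderiv n.+1 theta x).
    by rewrite -nrmM; exact: nrmB.
  have h4 := ler_wpM2l (exprn_ge0 k (normr_ge0 x)) h3.
  rewrite mulrDr in h4.
  have [x4|x4] := leP `|x| 4; first by have := th_part x4; lra.
  suff z : nrm (nderiv n.+1 theta x) = 0 by move: h4; rewrite z !mulr0; lra.
  suff -> : nderiv n.+1 theta x = 0 by exact: nrm0.
  by apply: thz; move: x4; rewrite ltNge ler_norml negb_and -!ltNge => /orP[h|h]; [left|right]; lra.
exists tau; split; last exact: est.
split; last by exists c => x; exact: (jd 0%N x).
apply/schwartz1_sball; split=> // J; have [A hA] := br J.+2.
by exists (cut_primitive_const J * A); exact: est.
Qed.

End Operator.

End Primitives.

Section PrimitiveExists.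
Context {R : realType}.
Local Notation C := (R[i]^o).
Local Notation D1 := (1 : R^o).
Implicit Types (f g : (R -> C) -> C) (rho tau : R -> C).

Lemma test1_neg_of_vanish (a b : R) tau : smooth1 tau -> b < 0 ->
  (forall x, x <= a \/ b <= x -> tau x = 0) -> test1 `]-oo, 0[%classic tau.
Proof.
move=> st b0 z.
have sI : supp tau `<=` `[a, b]%classic.
  rewrite (closure_id `[a, b]%classic).1; last exact: itv_closed.
  apply: closure_subset => x /= tx; rewrite in_itv/=; apply/andP; split.
    by rewrite leNgt; apply: contra tx => xa; apply/eqP/z; left; exact: ltW.
  by rewrite leNgt; apply: contra tx => xa; apply/eqP/z; right; exact: ltW.
split; [exact: st| |].
  by apply: (subclosed_compact _ (@segment_compact _ a b)) => //; exact: closed_closure.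
by move=> x /sI /=; rewrite !in_itv/= => /andP[_ xb]; exact: le_lt_trans b0.
Qed.

Lemma test1_neg_schwartz1 rho : test1 `]-oo, 0[%classic rho -> schwartz1 rho.
Proof.
move=> ht; have [->|[a [b [_ _ h]]]] := supp_subset ht; first exact: schwartz1_0.
have m1 : Num.min a b - 1 < a by rewrite ltrBlDr gt_min; apply/orP; left; lra.
have m2 : Num.min a b - 1 < b by rewrite ltrBlDr gt_min; apply/orP; right; lra.
have b1 : b < b + 1 by lra.
exact: (ctest_in_schwartz1 (lt_trans m2 b1) (test1_ctest_in ht h m1 b1)).
Qed.

Lemma cut_primitive_lin (theta : R -> C) (c : R[i]) rho rho' tau tau' :
  cut_primitive theta rho tau -> cut_primitive theta rho' tau' ->
  cut_primitive theta (c *: rho + rho') (c *: tau + tau').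
Proof.
move=> [st [a da]] [st' [a' da']]; split; first exact: schwartz1_lin.
exists (c * a + a') => x; rewrite !linfunE.
have := isdD (isdZ c (da x)) (da' x).
by congr (isd _ _ _ _); ring.
Qed.

Lemma cut_primitive_neg (theta : R -> C) rho tau :
  (forall n (x : R), (x <= -4 \/ -1 <= x) -> nderiv n.+1 theta x = 0) ->
  test1 `]-oo, 0[%classic rho -> cut_primitive theta rho tau ->
  test1 `]-oo, 0[%classic tau.
Proof.
move=> thz ht [st [c dt]].
have [a [b [b0 z]]] : exists a b : R, b < 0 /\ forall x, x <= a \/ b <= x -> rho x = 0.
  have [->|[a [b [Da Db h]]]] := supp_subset ht; first by exists 0, (-1); split; [lra|].
  rewrite /= in_itv/= in Db; exists (a - 1), (b / 2); split; first lra.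
  move=> x hx; apply/eqP/negPn/negP => /h; case: hx => hx; lra.
apply: (@test1_neg_of_vanish (Num.min a (-4)) (Num.max b (-1))).
- exact: schwartz1_smooth.
- by rewrite gt_max b0 /=; lra.
have dz x : x <= Num.min a (-4) \/ Num.max b (-1) <= x -> isd D1 tau x 0.
  move=> hx; have := dt x; rewrite z.
    rewrite (thz 0%N) ?mulr0 ?subrr//.
    by case: hx; rewrite ?le_min ?ge_max => /andP[? ?]; [left|right].
  by case: hx; rewrite ?le_min ?ge_max => /andP[? ?]; [left|right].
move=> x [] hx.
  apply: (@schwartz1_left_ray_eq0 R tau _ x st) => y yx.
  apply/esym/(@isd0_cst R) => // t /andP[_ tx]; apply: dz; left; exact: le_trans hx.
apply: (@schwartz1_ray_eq0 R tau _ x st) => y xy.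
apply: (@isd0_cst R) => // t /andP[tx _]; apply: dz; right; exact: le_trans tx.
Qed.

(** The primitive is minus the transpose of rho |-> tau. Uniqueness of cut primitives makes this map
    linear and gives T(rho') = rho, so that differentiation undoes it. *)
Lemma splus_primitive1 f : Splus f ->
  exists g, Splus g /\ forall rho, schwartz1 rho -> dist_deriv 1 g rho = f rho.
Proof.
move=> [/tempered1P[fl [N [K fK]]] f0].
have [theta [sth th0 th1 thz [M thM]]] := @left_step_exists R.
pose T rho := xget 0 [set tau | cut_primitive theta rho tau].
have TP rho : schwartz1 rho -> cut_primitive theta rho (T rho).
  move=> hr; have [tau [ht _]] := cut_primitive_exists sth th0 th1 thz thM hr.
  exact: (@xgetPex _ 0 [set tau | cut_primitive theta rho tau]) (ex_intro _ tau ht).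
have TE rho tau : cut_primitive theta rho tau -> schwartz1 rho -> T rho = tau.
  by move=> ht hr; exact: (cut_primitive_unique sth th0 th1 (TP _ hr) ht).
exists (fun rho => - f (T rho)); split; first split.
- apply/tempered1P; split.
    move=> c rho tau hr ht.
    rewrite (TE _ _ (cut_primitive_lin c (TP _ hr) (TP _ ht)) (schwartz1_lin c hr ht)).
    by rewrite (fl _ _ _ (TP _ hr).1 (TP _ ht).1) opprD mulrN.
  exists N.+2, (K * cut_primitive_const M N) => rho A hr hA; rewrite nrmN -mulrA.
  have [tau [ht hb]] := cut_primitive_exists sth th0 th1 thz thM hr.
  by rewrite (TE _ _ ht hr); apply: fK; [case: ht|exact: hb].
- move=> rho hr; rewrite f0 ?oppr0//.
  have sr : schwartz1 rho by exact: test1_neg_schwartz1.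

  exact: (cut_primitive_neg thz hr (TP _ sr)).
move=> rho hr; rewrite /dist_deriv expr1 mulN1r opprK.
congr (f _); apply: (TE _ _ _ (schwartz1_nderiv 1 hr)); split; first exact: hr.
exists 0 => x; rewrite mul0r subr0; exact: (smooth1_isd 0 x (schwartz1_smooth hr)).
Qed.

Lemma splus_primitive_exists m f : Splus f ->
  exists g, Splus g /\ forall rho, schwartz1 rho -> dist_deriv m g rho = f rho.
Proof.
move=> hf; elim: m => [|m [g [sg hg]]].
  by exists f; split=> // rho _; rewrite /dist_deriv expr0 mul1r.
have [g' [sg' hg']] := splus_primitive1 sg; exists g'; split=> // rho hr.
rewrite -hg// /dist_deriv -(hg' _ (schwartz1_nderiv m hr)) /dist_deriv nderivD.
by rewrite exprS expr1 mulN1r mulNr mulN1r mulrN add1n.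
Qed.

Lemma primitiveP m f : Splus f ->
  Splus (primitive m f) /\ forall rho, schwartz1 rho -> dist_deriv m (primitive m f) rho = f rho.
Proof.
move=> /(splus_primitive_exists m) h.
exact: (@xgetPex _ 0 [set g | Splus g /\ forall rho, schwartz1 rho -> dist_deriv m g rho = f rho] h).
Qed.

End PrimitiveExists.

(** * Functionals excluded by Cesaro admissibility *)

Section CesaroThreshold.
Context {R : realType}.
Local Notation C := (R[i]^o).
Local Notation D1 := (1 : R^o).
Implicit Types (f g : (R -> C) -> C) (rho tau : R -> C).

Lemma weighted_le (x w w' A : R) (p q : nat) : 0 <= x -> 0 <= w -> (p <= q)%N ->
  (1 + x) ^+ q * w <= A -> (1 + x) ^+ p * w <= A.
Proof.
move=> x0 w0 pq; apply: le_trans; rewrite ler_wpM2r//; apply: ler_weXn2l => //; lra.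
Qed.

Lemma ctest_decay_step rho (A : R) (p : nat) : ctest rho ->
  (forall x, 0 <= x -> (1 + x) ^+ p.+2 * nrm (nderiv 1 rho x) <= A) ->
  forall x, 0 <= x -> (1 + x) ^+ p.+1 * nrm (rho x) <= A.
Proof.
move=> [a [b [a0 ab cr]]] h x x0.
have pw k (y : R) : 0 <= y -> 0 < (1 + y) ^+ k by move=> y0; rewrite exprn_gt0//; lra.
have inc := @decay_increment R rho (nderiv 1 rho) A p
  (fun y _ => smooth1_isd 0%N y cr.1) _.
have b0 : 0 <= b by lra.
have [bx|/ltW xb] := leP b x.
  rewrite -[rho x]/(nderiv 0 rho x) cr.2; last by right.
  rewrite nrm0 mulr0; apply: le_trans (h 0 (lexx 0)).
  by rewrite mulr_ge0 ?nrm_ge0// ltW ?pw.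
have {}h y : 0 <= y -> nrm (nderiv 1 rho y) <= A * (1 + y) ^- p.+2.
  by move=> y0; rewrite -[leRHS]/(_ / _) ler_pdivlMr ?pw// mulrC h.
have := inc h x b x0 xb.
rewrite -[rho b]/(nderiv 0 rho b) cr.2; last by right.
by rewrite sub0r nrmN -[leRHS]/(_ / _) ler_pdivlMr ?pw// mulrC.
Qed.

(** A compactly supported function is recovered from its derivative by integrating from the right
    end of the support, which costs one power of 1 + x at each of the M steps. *)
Lemma ctest_decay (M p : nat) rho (A : R) : ctest rho ->
  (forall x, 0 <= x -> (1 + x) ^+ (p.+1 + M) * nrm (nderiv M rho x) <= A) ->
  forall n x, (n <= M)%N -> 0 <= x -> (1 + x) ^+ p.+1 * nrm (nderiv n rho x) <= A.
Proof.
move=> cr; elim: M => [|M IH] h n x nM x0.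
  by move: nM; rewrite leqn0 => /eqP ->; have := h x x0; rewrite addn0.
move: nM; rewrite leq_eqVlt => /predU1P[->|nM].
  by apply: weighted_le (h x x0); rewrite ?nrm_ge0// leq_addr.
apply: IH => // y y0; rewrite addSn; apply: ctest_decay_step => //; first exact: ctest_nderiv.
by move=> z z0; rewrite nderivD -addSn -addnS; exact: h.
Qed.

(** Weight 2 M + 1 on the derivative of order M leaves weight M + 1 on all lower derivatives, more
    than the power J <= M asked for. *)
Lemma ctest_sball (J M : nat) rho (A : R) : (J <= M)%N -> ctest rho ->
  (forall x, 0 <= x -> (1 + x) ^+ (M.+1 + M) * nrm (nderiv M rho x) <= A) -> sball J rho A.
Proof.
move=> JM cr h k n kJ nJ x; have d := ctest_decay cr h.
have [x0|x0] := leP 0 x; last first.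
  have [a [b [a0 ab cr']]] := cr.
  rewrite cr'.2; last by left; apply: ltW (lt_trans x0 a0).
  rewrite nrm0 mulr0; apply: le_trans (d 0%N 0 (leq0n M) (lexx 0)).
  by rewrite mulr_ge0 ?nrm_ge0 ?exprn_ge0 ?addr0.
apply: le_trans (d n x (leq_trans nJ JM) x0).
rewrite ger0_norm// ler_wpM2r ?nrm_ge0//.
apply: (@le_trans _ _ ((1 + x) ^+ k)); first by apply: lerXn2r; rewrite ?nnegrE; lra.
by apply: ler_weXn2l; [lra|exact: leq_trans kJ (leqW JM)].
Qed.

Lemma schwartz1_posP rho : schwartz1_pos rho <->
  schwartz1 rho /\ forall x : R, x < 0 -> rho x = 0.
Proof.
split=> -[sr h]; split=> //.
  move=> x x0; apply/eqP/negPn/negP => rx.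
  have sx : supp rho x by exact: subset_closure.
  by have := h _ sx; rewrite /= in_itv/= andbT leNgt x0.
rewrite (closure_id (`[0, +oo[%classic : set R)).1; last exact: interval_closed.
apply: closure_subset => x /= rx; rewrite in_itv/= andbT leNgt.
by apply: contra rx => x0; apply/eqP/h.
Qed.

Lemma ctest_schwartz1_pos rho : ctest rho -> schwartz1_pos rho.
Proof.
move=> cr; apply/schwartz1_posP; split; first exact: ctest_schwartz1.
move=> x x0; have [a [b [a0 _ [_ z]]]] := cr.
by apply: (z 0%N); left; apply: ltW (lt_trans x0 a0).
Qed.

Lemma Splus_lin (c : R[i]) f g : Splus f -> Splus g -> Splus (c *: f + g).
Proof.
move=> [/tempered1P[fl [N [K fK]]] f0] [/tempered1P[gl [N' [K' gK]]] g0]; split.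
  apply/tempered1P; split.
    by move=> s rho tau hr ht; rewrite !linfunE fl// gl//; move: (f rho) (f tau) (g rho) (g tau); clear => *; ring.
  exists (maxn N N'), (nrm c * K + K') => rho A hr hA; rewrite linfunE.
  apply: (le_trans (nrmD _ _)); rewrite mulrDl lerD//.
    rewrite nrmM -mulrA ler_wpM2l ?nrm_ge0//; apply: fK => //.
    by apply: sballW hA; rewrite ?leq_maxl.
  by apply: gK => //; apply: sballW hA; rewrite ?leq_maxr.
by move=> rho ht; rewrite linfunE f0// g0// mulr0 addr0.
Qed.

Lemma Splus_0 : Splus (0 : (R -> C) -> C).
Proof.
split=> //; apply/tempered1P; split; first by move=> c rho tau _ _; rewrite mulr0 addr0.
by exists 0%N, 0 => rho A _ _; rewrite mul0r nrm0.
Qed.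

Lemma Splus_sum (N : nat) (b : nat -> R[i]) (f : nat -> (R -> C) -> C) :
  (forall n, Splus (f n)) -> Splus (\sum_(n < N) b n *: f n).
Proof.
move=> hf; elim: N => [|N IH]; first by rewrite big_ord0; exact: Splus_0.
by rewrite big_ord_recr /= addrC; exact: Splus_lin.
Qed.

Lemma Splus_test_linear f : Splus f -> test_linear f.
Proof. by move=> [[fl _] _] c rho tau cr ct; apply: fl; exact: ctest_schwartz1. Qed.

Lemma half_integer_notin_int (n : nat) : (n%:R + 1 / 2 : R) \isn't a Num.int.
Proof.
apply/negP => /intrP[k hk].
have : (2 * (k - n%:Z))%:~R = 1%:~R :> R.
  by rewrite intrM intrB -hk; lra.
by move/intr_inj/(congr1 absz); rewrite abszM => /(congr1 odd); rewrite oddM.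
Qed.

Lemma sum_functionalE (N : nat) (b : nat -> R[i]) (f : nat -> (R -> C) -> C) rho :
  (\sum_(n < N) b n *: f n) rho = \sum_(n < N) (b n : C) * f n rho.
Proof.
elim: N => [|N IH]; first by rewrite !big_ord0.
by rewrite !big_ord_recr /= -IH.
Qed.

(** Up to sign, u at the derivative of order M + 2 of rho is g(rho), which the preceding estimates
    bound by the derivative of order M alone. *)
Lemma bounded_primitive_represented (J M : nat) (K : R) g u : (J <= M)%N -> 0 < K ->
  (forall rho A, schwartz1_pos rho -> sball J rho A -> nrm (g rho) <= K * A) ->
  Splus u -> (forall rho, schwartz1 rho -> dist_deriv M.+2 u rho = g rho) ->
  exists h : R -> C, [/\ forall x : R, 0 < x -> {for x, continuous h},
    exists K : R, forall x : R, 0 <= x -> nrm (h x) <= K * (1 + x) ^+ (M.+1 + M + M).+3 &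
    represents h u].
Proof.
move=> JM K0 gK su ug; apply: (@test_representation R _ _ K) => //; first exact: Splus_test_linear.
move=> rho A cr hA.
have -> : nrm (u (nderiv M.+2 rho)) = nrm (g rho).
  rewrite -ug; last exact: ctest_schwartz1.
  rewrite /dist_deriv nrmM.
  suff -> : nrm ((-1 : C) ^+ M.+2) = 1 by rewrite mul1r.
  by elim: (M.+2) => [|k IH]; rewrite ?expr0 ?nrm1// exprS nrmM nrmN nrm1 mul1r.
by apply: gK; [exact: ctest_schwartz1_pos|exact: (ctest_sball JM cr hA)].
Qed.

Lemma P2_threshold (f : nat -> (R -> C) -> C) : (forall n, Splus (f n)) -> P2 f ->
  forall J : nat, exists nu : nat, forall (N : nat) (b : nat -> R[i]), (nu <= N)%N ->
  (exists K, forall rho A, schwartz1_pos rho -> sball J rho A ->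
    nrm ((\sum_(n < N.+1) b n *: f n) rho) <= K * A) ->
  forall n, (nu <= n <= N)%N -> b n = 0.
Proof.
move=> sf [m [mi hm]] J.
have mge j : (j <= m j)%N by elim: j => // j /leq_ltn_trans; apply; exact: mi.
(* The index J + 2 ensures that the order of the primitive is M + 2 with M >= J; two orders are
   spent on the kernels (x - t)_+. *)
have := mge J.+2; case em : (m J.+2) => [//|[//|M]]; rewrite !ltnS => JM.
(* An exponent above both the growth of the density and the order of the primitive; adding 1/2 keeps
   alpha away from the integers. *)
pose e : nat := ((M.+1 + M + M).+3 + M.+2)%N.
have e0 : 0 < e%:R + 1 / 2 :> R by rewrite ltr_wpDl//; lra.
have [nu hnu] := hm J.+2 _ e0 (half_integer_notin_int e).
exists nu => N b nuN [K hK].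
set g := \sum_(n < N.+1) b n *: f n in hK *.
have sg : Splus g by exact: Splus_sum.
have K1 : 0 < `|K| + 1 by rewrite ltr_pwDr.
have {}hK rho A : schwartz1_pos rho -> sball J rho A -> nrm (g rho) <= (`|K| + 1) * A.
  move=> hr hA; apply: (le_trans (hK _ _ hr hA)); rewrite ler_wpM2r ?(sball_ge0 hA)//.
  by have := ler_norm K; lra.
rewrite em in hnu.
have [sp pg] := primitiveP M.+2 sg.
have [h [ch [B hB] rh]] := bounded_primitive_represented JM K1 hK sp pg.
have [||ci cz] := primitive_cesaro (alpha := e%:R + 1 / 2) ch rh hB.
- apply: (@le_trans _ _ e%:R); last lra.
  by rewrite ler_nat /e leq_addr.
- apply: (@le_trans _ _ e%:R); last lra.
  by rewrite ler_nat /e leq_addl.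
(* The continuity condition concerns the combination of the chosen primitives, not the chosen
   primitive of the combination. The two may differ off Schwartz functions, so the representation is
   applied to each. *)
have [|h' [ch' _ rh']] := bounded_primitive_represented JM K1 hK
    (Splus_sum N.+1 b (fun n => (primitiveP M.+2 (sf n)).1)).
  move=> rho hr; rewrite /dist_deriv /g.
  rewrite (sum_functionalE N.+1 b (fun n => primitive M.+2 (f n))) sum_functionalE.
  rewrite big_distrr; apply: eq_bigr => n _ /=.
  rewrite mulrCA; congr (_ * _); exact: (primitiveP M.+2 (sf n)).2.
exact: hnu nuN ci (represents_continuous_on_pos ch' rh') cz.
Qed.

End CesaroThreshold.

(** * Small test functions dual to the sequence *)

Section DualSequence.
Context {R : realType}.
Local Notation C := (R[i]^o).
Local Notation E := (R -> R[i]^o).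
Implicit Types (rho tau : R -> C).

Lemma schwartz1_pos_subspace : subspace_set (@schwartz1_pos R : set E).
Proof.
split; first by apply/schwartz1_posP; split; [exact: schwartz1_0|].
move=> s x y /schwartz1_posP[sx x0] /schwartz1_posP[sy y0]; apply/schwartz1_posP.
split; first exact: schwartz1_lin.
by move=> t t0; rewrite linfunE x0// y0// mulr0 addr0.
Qed.

Variable f : nat -> (R -> C) -> C.
Hypothesis sf : forall n, Splus (f n).

Lemma Splus_linear_on k : linear_on (@schwartz1_pos R : set E) (f k).
Proof. by move=> s x y [sx _] [sy _]; rewrite (sf k).1.1. Qed.

Lemma last_combinationE n (b : nat -> R[i]) rho :
  (\sum_(k < n.+1) (if (k : nat) == n then 1 else b k) *: f k) rho =
  f n rho + \sum_(k < n) (b k : C) * f k rho.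
Proof.
rewrite (sum_functionalE n.+1 (fun k => if k == n then 1 else b k)) big_ord_recr /= eqxx mul1r.
by rewrite addrC; congr (_ + _); apply: eq_bigr => k _; rewrite ltn_eqF.
Qed.

Definition dual_at n rho := [/\ schwartz1_pos rho, f n rho = 1 &
  forall k, (k < n)%N -> f k rho = 0].

(** With the gauge that assigns every size a >= 0 to every function, bounded means zero on S(0,oo).
    A bounded combination would thus lie in [N0], against (P1). *)
Lemma dual_exists n : P1 f -> exists rho, dual_at n rho.
Proof.
move=> p1; pose B (_ : E) (a : R) : Prop := 0 <= a.
have B0 x a : B x a -> 0 <= a by [].
have BD x y a b : B x a -> B y b -> B (x + y) (a + b) by exact: addr_ge0.
have BZ x a (s : R[i]) : B x a -> B (s *: x) (nrm s * a).
  by apply: mulr_ge0; exact: nrm_ge0.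
have BW x a b : B x a -> a <= b -> B x b by exact: le_trans.
have Bt : total_on_set B (@schwartz1_pos R : set E) by move=> x _; exists 0; exact: lexx.
have [[b [c c0 hb]]|h] := bounded_combination_or_dual B0 BD BZ BW n
  schwartz1_pos_subspace Bt Splus_linear_on.
  have := p1 n (fun k => if k == n then 1 else b k) _ n (leqnn n).
  rewrite eqxx => H; have /eqP : (1 : R[i]) = 0; last by rewrite oner_eq0.
  apply: H; split.
    exact: (Splus_sum n.+1 (fun k => if k == n then 1 else b k) sf).
  move=> rho hr; rewrite last_combinationE; apply/nrm_eq0/le_anti.
  by have := hb rho 0 hr (lexx 0); rewrite mulr0 nrm_ge0 => ->.
by have [rho [h1 _ h2 h3]] := h 1 ltr01; exists rho.
Qed.

Lemma small_dual_exists (nu : nat) (J : nat) n (e : R) :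
  (forall (N : nat) (b : nat -> R[i]), (nu <= N)%N ->
  (exists K, forall rho A, schwartz1_pos rho -> sball J rho A ->
    nrm ((\sum_(n < N.+1) b n *: f n) rho) <= K * A) ->
  forall n, (nu <= n <= N)%N -> b n = 0) ->
  (nu <= n)%N -> 0 < e -> exists rho, dual_at n rho /\ sball J rho e.
Proof.
move=> hnu nun e0.
(* Smoothness is part of the gauge because [nderiv] is linear on smooth functions only. *)
pose B (x : E) (a : R) : Prop := smooth1 x /\ sball J x a.
have B0 x a : B x a -> 0 <= a by move=> [_]; exact: sball_ge0.
have BD x y a b : B x a -> B y b -> B (x + y) (a + b).
  move=> [sx hx] [sy hy]; rewrite -[x]scale1r; split; first exact: smooth1_lin.
  by rewrite -[a]mul1r -(@nrm1 R); exact: sball_lin.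
have BZ x a (s : R[i]) : B x a -> B (s *: x) (nrm s * a).
  move=> [sx hx]; split; first exact: smooth1Z.
  rewrite -[_ *: x]addr0 -[_ * a]addr0; apply: sball_lin => //; first exact: smooth1_0.
  by move=> k l _ _ y; rewrite nderiv_0 nrm0 mulr0.
have BW x a b : B x a -> a <= b -> B x b by move=> [sx hx] ab; split=> //; exact: sballW hx.
have Bt : total_on_set B (@schwartz1_pos R : set E).
  by move=> x [/schwartz1_sball[sx /(_ J)[a ha]] _]; exists a.
have [[b [c c0 hb]]|h] := bounded_combination_or_dual B0 BD BZ BW n
  schwartz1_pos_subspace Bt Splus_linear_on.
  have := hnu n (fun k => if k == n then 1 else b k) nun _ n.
  rewrite eqxx nun leqnn => H; have /eqP : (1 : R[i]) = 0; last by rewrite oner_eq0.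
  apply: H => //; exists c => rho A hr hA; rewrite last_combinationE.
  by apply: hb => //; split=> //; exact: schwartz1_smooth hr.1.
by have [rho [h1 [_ h4] h2 h3]] := h e e0; exists rho.
Qed.

Lemma dual_sequence : P1 f -> P2 f -> exists nu : nat -> nat, forall n e, 0 < e ->
  exists rho, dual_at n rho /\ forall j, (j <= n)%N -> (nu j <= n)%N -> sball j rho e.
Proof.
move=> p1 p2; have /choice[nu hnu] := P2_threshold sf p2.
exists nu => n e e0.
have [exj|nexj] := pselect (exists j, ((j <= n) && (nu j <= n))%N); last first.
  have [rho hr] := dual_exists n p1; exists rho; split=> // j jn nuj.
  by case: nexj; exists j; rewrite jn.
have ub j : ((j <= n) && (nu j <= n))%N -> (j <= n)%N by case/andP.
(* The seminorms increase with their order, so smallness for the largest admissible j covers all the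
   others. *)
case: (ex_maxnP exj ub) => j /andP[jn nuj] jmax.
have [rho [hr hs]] := small_dual_exists (hnu j) nuj e0; exists rho; split=> // k kn nuk.
by apply: sballW hs => //; apply: jmax; rewrite kn.
Qed.

End DualSequence.

(** * Radial lifts *)

Section ChainRule.
Context {R : realType} (d : nat).
Local Notation C := (R[i]^o).
Local Notation D1 := (1 : R^o).
Local Notation Rd := 'rV[R]_d.
Local Notation e_ j := (delta_mx 0 j : Rd).

Lemma isd_line (E : lmodType R) (v w : E) (G : E -> C) (s : R) (l : C) :
  isd v G (w + s *: v) l -> isd D1 (fun t : R => G (w + t *: v)) s l.
Proof.
move=> H; rewrite /isd (_ : diff_quot D1 _ s = diff_quot v G (w + s *: v)); first exact: H.
apply: funext => h; rewrite /diff_quot; congr (_ *: (G _ - _)).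
by rewrite -addrA -scalerDl [h *: _]mulr1.
Qed.

Lemma rV_near (y : Rd) (P : Rd -> Prop) : (\forall z \near y, P z) ->
  exists2 de : R, 0 < de & forall h : Rd, (forall j, `|h 0 j| < de) -> P (y + h).
Proof.
move=> /nbhs_ballP[de /= de0 hP]; exists de => // h hh; apply: hP; split=> // i j.
by rewrite ord1 mxE /ball /= opprD addrA subrr add0r normrN; exact: hh.
Qed.

Variables (G : Rd -> C) (g : 'I_d -> Rd -> C).
Hypotheses (dG : forall z j, isd (e_ j) G z (g j z)) (cg : forall j, continuous (g j)).

Lemma C1_increment_step (y h : Rd) (k : 'I_d) (e de t : R) :
  (forall h : Rd, (forall j, `|h 0 j| < de) -> nrm (g k (y + h) - g k y) <= e) ->
  (forall j, `|h 0 j| < de) -> h 0 k = 0 -> `|t| < de ->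
  nrm (G (y + h + t *: e_ k) - G (y + h) - t%:C * g k y) <= e * `|t|.
Proof.
move=> he hh hk td.
pose F s : C := G (y + h + s *: e_ k) - s%:C * g k y.
have dF s : isd D1 F s (g k (y + h + s *: e_ k) - g k y).
  have ds : isd D1 (fun s : R => s%:C : C) s (1 : R)%:C.
    by apply/isd1_ReIm => /=; split; [exact: is_derive_id|exact: is_derive_cst].
  have := isdD (isd_line (@dG (y + h + s *: e_ k) k)) (isdN (isdM ds (isd_cst D1 (g k y) s))).
  by rewrite mulr0 addr0 rmorph1 mul1r; apply.
have bF s : `|s| <= `|t| -> nrm (g k (y + h + s *: e_ k) - g k y) <= e.
  move=> st; rewrite -addrA; apply: he => j; rewrite !mxE /=.
  case: eqP => [->|_]; last by rewrite mulr0 addr0.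
  by rewrite hk add0r mulr1; exact: le_lt_trans td.
have -> : G (y + h + t *: e_ k) - G (y + h) - t%:C * g k y = F t - F 0.
  by rewrite /F scale0r addr0 mul0r subr0 addrAC.
have [t0|/ltW t0] := leP 0 t.
  rewrite ger0_norm// -[X in _ * X]subr0; apply: (@complex_lipschitz R F (fun s => g k (y + h + s *: e_ k) - g k y)) => [//|s _|s /andP[s0 s1]].
    exact: dF.
  by apply: bF; rewrite !ger0_norm.
rewrite nrmBC ler0_norm// -[X in _ * X]add0r; apply: (@complex_lipschitz R F (fun s => g k (y + h + s *: e_ k) - g k y)) => [//|s _|s /andP[s0 s1]].
  exact: dF.
by apply: bF; rewrite !ler0_norm// lerN2.
Qed.

(** Continuity of the partial derivatives gives total differentiability: the coordinates of h are
    switched on one at a time, and each switch is a one-variable increment. *)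
Lemma C1_increment (y : Rd) (e : R) : 0 < e -> exists2 de : R, 0 < de &
  forall h : Rd, (forall j, `|h 0 j| < de) ->
  nrm (G (y + h) - G y - \sum_j (h 0 j)%:C * g j y) <= e * \sum_j `|h 0 j|.
Proof.
move=> e0.
have [de de0 hde] : exists2 de : R, 0 < de & forall h : Rd, (forall j, `|h 0 j| < de) ->
    forall k, nrm (g k (y + h) - g k y) <= e.
  have := @rV_near y (fun z => forall k, nrm (g k z - g k y) <= e); apply.
  apply: (@filter_forall Rd 'I_d (fun k z => nrm (g k z - g k y) <= e) (nbhs y) _) => k.
  by have /cvgCP/(_ e e0) := @cg k y; apply: filterS => z /ltW.
exists de => // h hh.
pose H k : Rd := \row_j (if (j < k)%N then h 0 j else 0).
have Hk k j : `|H k 0 j| < de by rewrite mxE; case: ifP => // _; rewrite normr0.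
suff claim k : (k <= d)%N ->
    nrm (G (y + H k) - G y - \sum_j (H k 0 j)%:C * g j y) <= e * \sum_j `|H k 0 j|.
  have <- : H d = h by apply/rowP => j; rewrite mxE ltn_ord.
  exact: claim.
elim: k => [_|k IH kd].
  have -> : H 0%N = 0 by apply/rowP => j; rewrite !mxE.
  rewrite addr0 subrr sub0r !big1 ?oppr0 ?nrm0 ?mulr0//.
    by move=> j _; rewrite mxE normr0.
  by move=> j _; rewrite mxE mul0r.
pose i := Ordinal kd; set t := h 0 i.
have HE : H k.+1 = H k + t *: e_ i.
  apply/rowP => j; rewrite !mxE /= ltnS leq_eqVlt.
  have [->|ji] := eqVneq j i; first by rewrite eqxx ltnn mulr1 add0r.
  rewrite mulr0 addr0; case: eqP => //= jk; case/eqP: ji; exact: val_inj.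
have Hki : H k 0 i = 0 by rewrite mxE ltnn.
have h1 := C1_increment_step (fun h hh => hde h hh i) (Hk k) Hki (hh i).
have S1 : \sum_j (H k.+1 0 j)%:C * g j y = \sum_j (H k 0 j)%:C * g j y + t%:C * g i y.
  rewrite HE (bigD1 i)//= [in RHS](bigD1 i)//= !mxE !eqxx ltnn mulr1 !add0r mul0r add0r addrC.
  congr (_ + _); apply: eq_bigr => j ji; rewrite !mxE (negbTE ji) ?andbF mulr0 addr0//.
have S2 : \sum_j `|H k.+1 0 j| = \sum_j `|H k 0 j| + `|t|.
  rewrite HE (bigD1 i)//= [in RHS](bigD1 i)//= !mxE !eqxx ltnn mulr1 !add0r normr0 add0r addrC.
  congr (_ + _); apply: eq_bigr => j ji; rewrite !mxE (negbTE ji) ?andbF mulr0 addr0//.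
rewrite S1 S2 mulrDr HE addrA.
have rearrange (a b c s u : C) : (c - b - s) + (a - c - u) = a - b - (s + u) by ring.
by have := le_trans (nrmD _ _) (lerD (IH (ltnW kd)) h1); rewrite rearrange.
Qed.

Lemma isd_chain (E : lmodType R) (v x : E) (Y : E -> Rd) (dY : 'I_d -> R) :
  (forall j, isd v (fun z => (Y z 0 j)%:C : C) x (dY j)%:C) ->
  isd v (fun z => G (Y z)) x (\sum_j (dY j)%:C * g j (Y x)).
Proof.
move=> hY.
(* The linear part of G at Y x composed with Y. Its derivative is the claimed one, and its
   difference quotient differs from that of G o Y by a quantity tending to 0. *)
pose Lin z : C := \sum_j (Y z 0 j)%:C * g j (Y x).
have dL : isd v Lin x (\sum_j (dY j)%:C * g j (Y x)).
  apply: isd_sum => j; have := isdM (hY j) (isd_cst v (g j (Y x)) x).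
  by rewrite mulr0 addr0.
suff D0 : (diff_quot v (fun z => G (Y z)) x h - diff_quot v Lin x h) @[h --> 0^'] --> (0 : C).
  rewrite /isd -[X in _ --> X]add0r.
  rewrite (_ : diff_quot v _ x = fun h => (diff_quot v (fun z => G (Y z)) x h - diff_quot v Lin x h)
     + diff_quot v Lin x h); first exact: cvgCD D0 dL.
  by apply: funext => h; rewrite subrK.
apply/cvgCP => e e0.
pose K := \sum_j (`|dY j| + 1); have K0 : 0 <= K by apply: sumr_ge0 => j _; rewrite addr_ge0.
pose e' := e / (K + 1) / 2.
have K1 : 0 < K + 1 by lra.
have e'0 : 0 < e' by rewrite !divr_gt0.
have [de de0 hde] := C1_increment (Y x) e'0.
near=> h; rewrite subr0.
have hn0 : h != 0 by near: h; exact: nbhs_dnbhs_neq.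
have hq : forall j, `|h^-1 * (Y (x + h *: v) 0 j - Y x 0 j)| <= `|dY j| + 1.
  near: h; apply: filter_forall => j.
  have /cvgCP/(_ 1 ltr01) := hY j; apply: filterS => h.
  have -> : diff_quot v (fun z => (Y z 0 j)%:C : C) x h = (h^-1 * (Y (x + h *: v) 0 j - Y x 0 j))%:C.
    by rewrite rmorphM rmorphB.
  rewrite -rmorphB nrm_real => hh.
  by have := ler_normB (h^-1 * (Y (x + h *: v) 0 j - Y x 0 j) - dY j) (- dY j); rewrite opprK subrK normrN; lra.
have hd : forall j, `|(Y (x + h *: v) - Y x) 0 j| < de.
  near: h; apply: filter_forall => j.
  have /cvgCP/(_ de de0) := isd_shift (hY j); apply: filterS => h.
  by rewrite -rmorphB nrm_real !mxE.
have YE : Y x + (Y (x + h *: v) - Y x) = Y (x + h *: v) by rewrite addrC subrK.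
have := hde _ hd; rewrite YE.
have -> : \sum_j ((Y (x + h *: v) - Y x) 0 j)%:C * g j (Y x) = Lin (x + h *: v) - Lin x.
  rewrite /Lin -sumrB; apply: eq_bigr => j _.
  by rewrite !mxE -mulrBl -rmorphB.
move=> hh; rewrite /diff_quot -scalerBr [_ *: _]/(_ * _) nrmM nrm_real.
have h0 : 0 < `|h^-1| by rewrite normr_gt0 invr_eq0.

apply: (le_lt_trans (ler_wpM2l (ltW h0) hh)); rewrite mulrCA mulr_sumr.
apply: (@le_lt_trans _ _ (e' * K)).
  rewrite ler_wpM2l ?(ltW e'0)//; apply: ler_sum => j _.
  by rewrite -normrM !mxE.
have : e' * (K + 1) = e / 2 by rewrite /e' mulrAC divfK// gt_eqF.
rewrite mulrDr; lra.
Unshelve. all: by end_near. Qed.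

End ChainRule.

Section EuclideanNorm.
Context {R : realType} {d : nat}.
Local Notation C := (R[i]^o).
Local Notation D1 := (1 : R^o).
Local Notation Rd := 'rV[R]_d.
Local Notation e_ j := (delta_mx 0 j : Rd).
Implicit Types x : Rd.

Let sum_sqr_ge0 x : 0 <= \sum_i x 0 i ^+ 2.
Proof. by apply: sumr_ge0 => i _; exact: sqr_ge0. Qed.

Lemma enorm_ge0 x : 0 <= enorm x. Proof. exact: sqrtr_ge0. Qed.

Lemma enorm_sqr x : enorm x ^+ 2 = \sum_i x 0 i ^+ 2.
Proof. by rewrite sqr_sqrtr. Qed.

Lemma coord_le_enorm x j : `|x 0 j| <= enorm x.
Proof.
rewrite -sqrtr_sqr ler_wsqrtr// (bigD1 j)//= lerDl.
by apply: sumr_ge0 => i _; exact: sqr_ge0.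
Qed.

Lemma enorm_eq0 x : (enorm x == 0) = (x == 0).
Proof.
apply/eqP/eqP => [h|->]; last first.
  by rewrite /enorm big1 ?sqrtr0// => i _; rewrite mxE expr0n.
apply/rowP => j; rewrite mxE; apply/eqP; rewrite -normr_le0.
by apply: le_trans (coord_le_enorm x j) _; rewrite h.
Qed.

Lemma enorm_gt0 x : (0 < enorm x) = (x != 0).
Proof. by rewrite lt_def enorm_ge0 andbT enorm_eq0. Qed.

Lemma enormZ (l : R) x : enorm (l *: x) = `|l| * enorm x.
Proof.
rewrite /enorm -sqrtr_sqr -sqrtrM ?sqr_ge0//; congr Num.sqrt.
by rewrite mulr_sumr; apply: eq_bigr => i _; rewrite mxE exprMn.
Qed.

Lemma enorm_delta j : enorm (e_ j) = 1.
Proof.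
rewrite /enorm (bigD1 j)//= big1 => [|i ij]; first by rewrite mxE !eqxx expr1n addr0 sqrtr1.
by rewrite mxE (negbTE ij) andbF expr0n.
Qed.

Lemma enorm_normalize x : x != 0 -> enorm ((enorm x)^-1 *: x) = 1.
Proof.
by move=> x0; rewrite enormZ ger0_norm ?invr_ge0 ?enorm_ge0// mulVf// enorm_eq0.
Qed.

Lemma enorm_continuous : continuous (@enorm R d).
Proof.
move=> x; apply: (@continuous_comp _ _ _ (fun x : Rd => \sum_i x 0 i ^+ 2) Num.sqrt).
  apply: (@continuous_big R^o 'I_d +%R 0 xpredT (@add_continuous R^o)) => i _ {}x.
  apply: (@continuous_comp _ _ _ (fun x : Rd => x 0 i) (fun t : R => t ^+ 2)).
    exact: coord_continuous.
  exact: exprn_continuous.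
exact: sqrt_continuous.
Qed.

Lemma isd_coord (i j : 'I_d) x :
  isd (e_ i) (fun z : Rd => (z 0 j)%:C : C) x ((j == i)%:R)%:C.
Proof.
rewrite /isd; have near_h : \forall h \near (0 : R)^', (((j == i)%:R)%:C : C) =
    diff_quot (e_ i) (fun z : Rd => (z 0 j)%:C : C) x h.
  near=> h; have hn0 : h != 0 by near: h; exact: nbhs_dnbhs_neq.
  have -> : diff_quot (e_ i) (fun z : Rd => (z 0 j)%:C : C) x h =
      (h^-1 * (x 0 j + h * (j == i)%:R - x 0 j))%:C.
    by rewrite rmorphM rmorphB /diff_quot !mxE.
  by rewrite addrAC subrr add0r mulrA mulVf// mul1r.
exact: (cvgC_near_eq near_h (cvg_cst _)).
Unshelve. all: by end_near. Qed.

Lemma isd_enorm (i : 'I_d) x : x != 0 ->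
  isd (e_ i) (fun z : Rd => (enorm z)%:C : C) x (x 0 i / enorm x)%:C.
Proof.
move=> x0; have ex := x0; rewrite -enorm_gt0 in ex.
have dS : isd (e_ i) (fun z : Rd => (\sum_j z 0 j ^+ 2)%:C : C) x (2 * x 0 i)%:C.
  rewrite (_ : (fun z => _) = fun z : Rd => \sum_j (z 0 j)%:C * (z 0 j)%:C); last first.
    by apply: funext => z; rewrite rmorph_sum; apply: eq_bigr => j _; rewrite rmorphXn expr2.
  have := isd_sum (s := index_enum 'I_d) (P := xpredT) (fun j => isdM (@isd_coord i j x) (@isd_coord i j x)).
  congr (isd _ _ _ _); rewrite (bigD1 i)//= big1 => [|j ji].
    by rewrite eqxx rmorph1 mul1r mulr1 addr0 -rmorphD mulr_natl mulr2n.
  by rewrite (negbTE ji) rmorph0 mul0r mulr0 addr0.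
have S0 : 0 < \sum_j x 0 j ^+ 2 by rewrite -enorm_sqr exprn_gt0.
have dsq : isd D1 (fun t : R => (Num.sqrt t)%:C : C) (\sum_j x 0 j ^+ 2) ((2 * enorm x)^-1)%:C.
  by apply/isd1_ReIm => /=; split; [exact: is_derive1_sqrt|exact: is_derive_cst].
have := isd_comp dS dsq; congr (isd _ _ _ _).
rewrite -rmorphM invfM; congr (_%:C); field.
by rewrite gt_eqF.
Qed.

Lemma isd_inv_enorm (i : 'I_d) x : x != 0 ->
  isd (e_ i) (fun z : Rd => ((enorm z)^-1)%:C : C) x (- (x 0 i * (enorm x)^-1 ^+ 3))%:C.
Proof.
move=> x0; have ex := x0; rewrite -enorm_gt0 in ex.
have dV : isd D1 (fun t : R => (t^-1)%:C : C) (enorm x) (- (enorm x) ^- 2)%:C.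
  apply/isd1_ReIm => /=; split; last exact: is_derive_cst.
  have := @is_deriveV R id (enorm x) 1 1 (lt0r_neq0 ex) (is_derive_id _ _).
  by rewrite /GRing.scale /= mulr1.
have := isd_comp (isd_enorm (i := i) x0) dV; congr (isd _ _ _ _).
rewrite -rmorphM; congr (_%:C); rewrite -exprVn mulrN -mulrA -exprS; by [].
Qed.

Lemma nrm_continuous : continuous (fun z : C => nrm z : R).
Proof.
move=> z; apply/(@cvgrPdist_lt R R^o C (nbhs z) (nbhs_filter z)) => e e0.
have /cvgCP/(_ e e0) := @cvg_id C (nbhs z); apply: filterS => y; apply: le_lt_trans.
rewrite ler_norml; have := nrmD (y - z) z; have := nrmD (z - y) y.
by rewrite !subrK (nrmBC z); lra.
Qed.

(** The box contains the Euclidean unit sphere, so this bounds every angular factor. *)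
Lemma continuous_bounded_box (g : Rd -> C) : continuous g ->
  exists M : R, forall x, (forall j, `|x 0 j| <= 1) -> nrm (g x) <= M.
Proof.
move=> cg.
pose A := [set v : Rd | forall j, `[-1, 1]%classic (v ord0 j)].
have cA : compact A by apply: (@rV_compact R d (fun=> `[-1, 1]%classic)) => j; exact: segment_compact.
have A0 : A !=set0 by exists 0 => j /=; rewrite mxE in_itv/=; lra.
have cn : {within A, continuous (fun x => nrm (g x) : R)}.
  apply: continuous_subspaceT => x.
  exact: (cvg_comp _ _ (cg x) (@nrm_continuous (g x))).
have [c cA' hc] := compact_EVT_max A0 cA cn.
exists (nrm (g c)) => x hx; apply: hc; apply: mem_set => j /=.
by rewrite in_itv/= -ler_norml; exact: hx.
Qed.

End EuclideanNorm.

(** * Differential calculus of radial lifts *)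

Section RadialCalculus.
Context {R : realType} {d : nat}.
Local Notation C := (R[i]^o).
Local Notation D1 := (1 : R^o).
Local Notation Rd := 'rV[R]_d.
Local Notation e_ j := (delta_mx 0 j : Rd).
Implicit Types (x : Rd) (rho : R -> C) (B : R).
Variable Psi : Rd -> C.
Hypothesis sPsi : smooth Psi.

(* Partial derivatives of a radial lift stay in the span of such coefficients times
   [nderiv n rho (enorm x)]; negative powers of the norm are absorbed by the flatness
   of [rho] at 0. *)
Inductive coef : (Rd -> C) -> Prop :=
| coef_cst c : coef (fun=> c)
| coef_coord j : coef (fun x => (x 0 j)%:C)
| coef_inv : coef (fun x => ((enorm x)^-1)%:C)
| coef_angle m : coef (fun x => partial m Psi ((enorm x)^-1 *: x))
| coef_add S T : coef S -> coef T -> coef (fun x => S x + T x)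
| coef_mul S T : coef S -> coef T -> coef (fun x => S x * T x).

Lemma coef_sum (I : Type) (s : seq I) (S : I -> Rd -> C) :
  (forall j, coef (S j)) -> coef (fun x => \sum_(j <- s) S j x).
Proof.
move=> hS; elim: s => [|j s IH].
  by rewrite (_ : (fun _ => _) = fun=> 0); [exact: coef_cst|apply: funext => x; rewrite big_nil].
rewrite (_ : (fun _ => _) = fun x => S j x + \sum_(j <- s) S j x); first exact: coef_add.
by apply: funext => x; rewrite big_cons.
Qed.

Lemma partial_isd m (j : 'I_d) (z : Rd) : isd (e_ j) (partial m Psi) z (partial (j :: m) Psi z).
Proof. exact: rderivableE ((sPsi m).2 j z). Qed.

Lemma coef_deriv S : coef S -> forall i, exists S', coef S' /\
  forall x, x != 0 -> isd (e_ i) S x (S' x).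
Proof.
move=> cS i; elim: cS => {S} [c|j| |m|S T _ [S' [cS' dS]] _ [T' [cT' dT]]|S T cS [S' [cS' dS]] cT [T' [cT' dT]]].
- by exists (fun=> 0); split; [exact: coef_cst|move=> x _; exact: isd_cst].
- by exists (fun=> ((j == i)%:R)%:C); split; [exact: coef_cst|move=> x _; exact: isd_coord].
- exists (fun x => (- 1) * ((x 0 i)%:C * (((enorm x)^-1)%:C * (((enorm x)^-1)%:C * ((enorm x)^-1)%:C)))); split.
    apply: coef_mul; first exact: coef_cst.
    by repeat (apply: coef_mul; first by [exact: coef_coord|exact: coef_inv]); exact: coef_inv.
  move=> x x0; have := isd_inv_enorm (i := i) x0; congr (isd _ _ _ _).
  by rewrite mulN1r !exprS expr0 mulr1 rmorphN !rmorphM.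
- pose dY j x : C := (- 1) * ((x 0 i)%:C * (((enorm x)^-1)%:C * (((enorm x)^-1)%:C * ((enorm x)^-1)%:C)))
    * (x 0 j)%:C + ((enorm x)^-1)%:C * ((j == i)%:R)%:C.
  exists (fun x => \sum_j dY j x * partial (j :: m) Psi ((enorm x)^-1 *: x)); split.
    apply: coef_sum => j; apply: coef_mul; last exact: coef_angle.
    apply: coef_add; apply: coef_mul; [|exact: coef_coord|exact: coef_inv|exact: coef_cst].
    apply: coef_mul; first exact: coef_cst.
    by repeat (apply: coef_mul; first by [exact: coef_coord|exact: coef_inv]); exact: coef_inv.
  move=> x x0.
  pose rY j : R := - (x 0 i * (enorm x)^-1 ^+ 3) * x 0 j + (enorm x)^-1 * (j == i)%:R.
  have dYE j : dY j x = (rY j)%:C.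
    by rewrite /dY /rY mulN1r !exprS expr0 mulr1 rmorphD !rmorphM rmorphN !rmorphM.
  under eq_bigr do rewrite dYE.
  have := @isd_chain R d (partial m Psi) (fun j => partial (j :: m) Psi)
    (fun z j => @partial_isd m j z) (fun j => (sPsi (j :: m)).1)
    Rd (e_ i) x (fun z => (enorm z)^-1 *: z) rY.
  apply=> j.
  rewrite (_ : (fun z => _) = fun z : Rd => ((enorm z)^-1)%:C * (z 0 j)%:C); last first.
    by apply: funext => z; rewrite mxE rmorphM.
  by have := isdM (isd_inv_enorm (i := i) x0) (@isd_coord _ _ i j x); rewrite -!rmorphM -rmorphD.
- exists (fun x => S' x + T' x); split; first exact: coef_add.
  by move=> x x0; apply: isdD; [exact: dS|exact: dT].
- exists (fun x => S' x * T x + S x * T' x); split.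
    by apply: coef_add; apply: coef_mul.
  by move=> x x0; apply: isdM; [exact: dS|exact: dT].
Qed.

Lemma add_inv_ge1 (r : R) : 0 < r -> 1 <= r + r^-1.
Proof.
move=> r0; have ri : 0 < r^-1 by rewrite invr_gt0.
have [r1|r1] := leP 1 r; first lra.
have : 1 <= r^-1 by rewrite invr_ge1 ?unitfE ?gt_eqF// ltW.
lra.
Qed.

(** The weight |x| + 1/|x| covers growth both at infinity and at the origin, and being at least 1 it
    allows the exponents of two coefficients to be raised to a common one. *)
Lemma coef_bound S : coef S -> exists (M : R) (s : nat), 0 <= M /\
  forall x, x != 0 -> nrm (S x) <= M * (enorm x + (enorm x)^-1) ^+ s.
Proof.
elim=> {S} [c|j| |m|S T _ [M [s [M0 hM]]] _ [N [t [N0 hN]]]|S T _ [M [s [M0 hM]]] _ [N [t [N0 hN]]]].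
- by exists (nrm c), 0%N; split; [exact: nrm_ge0|move=> x _; rewrite expr0 mulr1].
- exists 1, 1%N; split=> // x; rewrite -enorm_gt0 => x0.
  have ri : 0 < (enorm x)^-1 by rewrite invr_gt0.
  by rewrite nrm_real expr1 mul1r; have := coord_le_enorm x j; lra.
- exists 1, 1%N; split=> // x; rewrite -enorm_gt0 => x0.
  have ri : 0 < (enorm x)^-1 by rewrite invr_gt0.
  by rewrite nrm_real expr1 mul1r gtr0_norm//; lra.
- have [M hM] := continuous_bounded_box (sPsi m).1.
  exists M, 0%N; split; first by apply: le_trans (hM 0 _); [exact: nrm_ge0|move=> j; rewrite mxE normr0].
  move=> x; rewrite -enorm_gt0 => x0; rewrite expr0 mulr1; apply: hM => j.
  by rewrite mxE normrM gtr0_norm ?invr_gt0// ler_pdivrMl// mulr1 coord_le_enorm.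
- exists (M + N), (s + t)%N; split=> [|x x0]; first exact: addr_ge0.
  have w1 : 1 <= enorm x + (enorm x)^-1 by apply: add_inv_ge1; rewrite enorm_gt0.
  apply: (le_trans (nrmD _ _)); rewrite mulrDl lerD//.
    by apply: (le_trans (hM x x0)); rewrite ler_wpM2l//; apply: ler_weXn2l => //; exact: leq_addr.
  by apply: (le_trans (hN x x0)); rewrite ler_wpM2l//; apply: ler_weXn2l => //; exact: leq_addl.
- exists (M * N), (s + t)%N; split=> [|x x0]; first exact: mulr_ge0.
  by rewrite nrmM exprD mulrACA; apply: ler_pM; rewrite ?nrm_ge0// ?hM ?hN.
Qed.

Lemma complex_cst_continuous : continuous (fun t : R => t%:C : C).
Proof.
move=> t; apply/cvgCP => e e0; have /cvgrPdist_lt/(_ e e0) := @cvg_id R (nbhs t).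
by apply: filterS => s; rewrite -rmorphB nrm_real distrC.
Qed.

Lemma enorm_inv_continuous x : x != 0 -> {for x, continuous (fun z : Rd => (enorm z)^-1)}.
Proof.
rewrite -enorm_eq0 => x0; exact: (cvgV x0 (@enorm_continuous R d x)).
Qed.

Lemma coef_continuous S : coef S -> forall x, x != 0 -> {for x, continuous S}.
Proof.
elim=> {S} [c|j| |m|S T _ hS _ hT|S T _ hS _ hT] x x0.
- exact: (@cst_continuous Rd C c x).
- exact: (cvg_comp _ _ (@coord_continuous R 1 d 0 j x) (@complex_cst_continuous _)).
- exact: (cvg_comp _ _ (enorm_inv_continuous x0) (@complex_cst_continuous _)).
- have cY : (fun z : Rd => (enorm z)^-1 *: z) z @[z --> x] --> (enorm x)^-1 *: x.
    exact: (@cvgZ R Rd Rd (nbhs x) _ (fun z => (enorm z)^-1) id _ _ (enorm_inv_continuous x0) cvg_id).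
  exact: (cvg_comp _ _ cY ((sPsi m).1 _)).
- exact: (cvgCD (hS x x0) (hT x x0)).
- exact: (cvgCM (hS x x0) (hT x x0)).
Qed.

Lemma schwartz1_pos_at0 n rho : schwartz1_pos rho -> nderiv n rho 0 = 0.
Proof.
move=> /schwartz1_posP[/schwartz1_smooth sr r0].
have z (x : R) : x < 0 -> nderiv n rho x = 0.
  exact: (@nderiv_open_eq0 R [set t | t < 0] rho n (@open_lt _ _) sr).
apply/nrm_eq0/le_anti; rewrite nrm_ge0 andbT.
apply/ler_addgt0Pr => e e0; rewrite add0r.
have /cvgCP/(_ e e0) := (sr n).1 0; move=> /nbhs_ballP[de /= de0 hd].
have bd : ball (0 : R) de (- (de / 2)) by rewrite /ball /= opprK add0r gtr0_norm; lra.
have /ltW := hd _ bd; rewrite z; last by lra.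
by rewrite sub0r nrmN.
Qed.

(** All derivatives of rho vanish at 0; each factor r is gained by integrating a derivative one
    order higher from 0. *)
Lemma flat_bound (J n t : nat) rho B (r : R) : schwartz1_pos rho -> sball J rho B ->
  (n + t <= J)%N -> 0 <= r -> nrm (nderiv n rho r) <= B * r ^+ t.
Proof.
move=> hr hB; have sr := schwartz1_smooth hr.1; elim: t n r => [|t IH] n r nJ r0.
  rewrite addn0 in nJ; have := hB 0%N n isT nJ r; by rewrite !expr0 mul1r mulr1.
have B0 := sball_ge0 hB.
have -> : nderiv n rho r = nderiv n rho r - nderiv n rho 0 by rewrite schwartz1_pos_at0// subr0.
rewrite exprSr mulrA -[X in _ * _ * X]subr0.
apply: (@complex_lipschitz R (nderiv n rho) (nderiv n.+1 rho)) => [//|s _|s /andP[s0 sr']].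
  exact: smooth1_isd.
apply: (le_trans (IH n.+1 s _ s0)); first by rewrite addSnnS.
by rewrite ler_wpM2l//; apply: lerXn2r => //; rewrite nnegrE.
Qed.

(** Operators in rho rather than single functions: the same coefficients, and hence the same
    constants, must serve every rho, since the estimates express continuity of the lift. *)
Inductive oper : ((R -> C) -> Rd -> C) -> Prop :=
| oper_term S n : coef S -> oper (fun rho x => S x * nderiv n rho (enorm x))
| oper_add T U : oper T -> oper U -> oper (fun rho x => T rho x + U rho x).

Lemma oper_at0 T : oper T -> forall rho, schwartz1_pos rho -> T rho 0 = 0.
Proof.
have e0 : enorm (0 : Rd) = 0 by apply/eqP; rewrite enorm_eq0.
elim=> {T} [S n _|T U _ hT _ hU] rho hr; first by rewrite e0 schwartz1_pos_at0// mulr0.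
by rewrite hT// hU// addr0.
Qed.

(** For r <= 1 the sum r + 1/r is at most 2/r, and flatness at the origin absorbs the powers; for r
    >= 1 it is at most 2 r, and decay at infinity does. *)
Lemma weight_split (r w z M B : R) (s p q : nat) : 0 < r -> 0 <= M -> 0 <= B -> 0 <= z -> 0 <= w ->
  w <= M * (r + r^-1) ^+ s -> z <= B * r ^+ (s + q) -> r ^+ (s + p) * z <= B ->
  r ^+ p * (w * z) <= M * 2 ^+ s * B * r ^+ q.
Proof.
move=> r0 M0 B0 z0 w0 hw h1 h2.
have rp k : 0 < r ^+ k by exact: exprn_gt0.
have hz : r ^+ p * (w * z) <= M * (r ^+ p * ((r + r^-1) ^+ s * z)).
  by rewrite [leRHS]mulrCA ler_wpM2l ?(ltW (rp p))// mulrA ler_wpM2r.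
apply: (le_trans hz); rewrite -!mulrA ler_wpM2l//.
have [r1|/ltW r1] := leP r 1.
  have ri : 1 <= r^-1 by rewrite invr_ge1 ?unitfE ?gt_eqF.
  apply: (@le_trans _ _ (1 * ((2 * r^-1) ^+ s * (B * r ^+ (s + q))))).
    apply: ler_pM; rewrite ?exprn_ge0// ?mulr_ge0 ?exprn_ge0 ?addr_ge0 ?invr_ge0 ?(ltW r0)//.
      by rewrite exprn_ile1// ltW.
    apply: ler_pM; rewrite ?exprn_ge0// ?addr_ge0 ?invr_ge0 ?(ltW r0)//.
    by apply: lerXn2r; rewrite ?nnegrE; lra.
  by rewrite mul1r exprMn exprVn exprD [B * (_ * _)]mulrCA -mulrA mulKf ?gt_eqF.
have rq : 1 <= r ^+ q by exact: exprn_ege1.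
have ri : r^-1 <= r.
  by apply: (le_trans _ r1); rewrite invf_le1.
apply: (@le_trans _ _ (r ^+ p * ((2 * r) ^+ s * z))).
  rewrite ler_wpM2l ?(ltW (rp p))// ler_wpM2r//; apply: lerXn2r; rewrite ?nnegrE ?mulr_ge0 ?addr_ge0 ?invr_ge0 ?(ltW r0)//.
  lra.
rewrite exprMn mulrCA -mulrA ler_wpM2l ?exprn_ge0// mulrA -exprD.
apply: (@le_trans _ _ B); first exact: h2.
by rewrite -[leLHS]mulr1 ler_wpM2l.
Qed.

(** The exponent p measures decay at infinity and q flatness at the origin: q = 2 yields the
    derivative at 0, q = 1 continuity there, q = 0 the Schwartz bounds. *)
Lemma oper_bound T (p q : nat) : oper T -> exists (J : nat) (K : R), 0 <= K /\
  forall rho B, schwartz1_pos rho -> sball J rho B ->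
  forall x, enorm x ^+ p * nrm (T rho x) <= K * B * enorm x ^+ q.
Proof.
elim=> {T} [S n cS|T U oT [J [K [K0 hK]]] oU [J' [K' [K0' hK']]]].
  have [M [s [M0 hM]]] := coef_bound cS.
  exists (n + s + q + p)%N, (M * 2 ^+ s); split; first by rewrite mulr_ge0 ?exprn_ge0.
  move=> rho B hr hB x; have B0 := sball_ge0 hB.
  have [->|x0] := eqVneq x 0.
    rewrite (oper_at0 (oper_term n cS) hr) nrm0 mulr0.
    by rewrite !mulr_ge0 ?exprn_ge0 ?enorm_ge0.
  have r0 : 0 < enorm x by rewrite enorm_gt0.
  rewrite nrmM; apply: weight_split; rewrite ?nrm_ge0//; first exact: hM.
    apply: (flat_bound hr hB); last exact: ltW.
    by rewrite addnA leq_addr.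
  have := hB (s + p)%N n _ _ (enorm x); rewrite ger0_norm ?enorm_ge0//; apply.
    by rewrite -[(n + s + q + p)%N]addnA addnACA leq_addl.
  by rewrite -!addnA leq_addr.
exists (maxn J J'), (K + K'); split; first exact: addr_ge0.
move=> rho B hr hB x; rewrite 2!mulrDl.
apply: (@le_trans _ _ (enorm x ^+ p * (nrm (T rho x) + nrm (U rho x)))).
  by rewrite ler_wpM2l ?exprn_ge0 ?enorm_ge0// nrmD.
rewrite mulrDr lerD//.
  by apply: hK => //; apply: sballW hB => //; exact: leq_maxl.
by apply: hK' => //; apply: sballW hB => //; exact: leq_maxr.
Qed.

Lemma oper_isd_at0 T rho (i : 'I_d) : oper T -> schwartz1_pos rho -> isd (e_ i) (T rho) 0 0.
Proof.
move=> oT hr; have [J [K [K0 hK]]] := oper_bound 0 2 oT.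
have [_ /(_ J)[B hB]] := (schwartz1_sball rho).1 hr.1; have B0 := sball_ge0 hB.
have KB : 0 < K * B + 1 by rewrite ltr_wpDl// mulr_ge0.
apply/cvgCP => e e0; near=> h.
have h0 : h != 0 by near: h; exact: nbhs_dnbhs_neq.
have hd : `|h| < e / (K * B + 1) by near: h; apply: dnbhs0_lt; exact: divr_gt0.
rewrite subr0 /diff_quot (oper_at0 oT hr) subr0 add0r [_ *: _]/(_ * _) nrmM nrm_real.
have := hK rho B hr hB (h *: e_ i); rewrite expr0 mul1r enormZ enorm_delta mulr1 => H.
rewrite normfV; have hp : 0 < `|h| by rewrite normr_gt0.
rewrite mulrC ltr_pdivrMr//; apply: (le_lt_trans H); rewrite expr2 mulrA ltr_pM2r//.
rewrite ltr_pdivlMr// in hd; apply: le_lt_trans hd; rewrite mulrC ler_wpM2l//; lra.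
Unshelve. all: by end_near. Qed.

Lemma oper_deriv T (i : 'I_d) : oper T -> exists T', oper T' /\
  forall rho, schwartz1_pos rho -> forall x, isd (e_ i) (T rho) x (T' rho x).
Proof.
elim=> {T} [S n cS|T U oT [T' [oT' hT]] oU [U' [oU' hU]]]; last first.
  exists (fun rho x => T' rho x + U' rho x); split; first exact: oper_add.
  by move=> rho hr x; apply: isdD; [exact: hT|exact: hU].
have [S' [cS' dS]] := coef_deriv cS i.
have o1 := oper_term n cS'.
have o2 := oper_term n.+1 (coef_mul cS (coef_mul (coef_coord i) coef_inv)).
have o3 := oper_add o1 o2.
exists (fun rho x => S' x * nderiv n rho (enorm x) +
  S x * ((x 0 i)%:C * ((enorm x)^-1)%:C) * nderiv n.+1 rho (enorm x)); split; first exact: o3.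
move=> rho hr x; have [->|x0] := eqVneq x 0.
  by rewrite (oper_at0 o3 hr); exact: (oper_isd_at0 i (oper_term n cS) hr).
have := isdM (dS x x0) (isd_comp (isd_enorm (i := i) x0)
  (smooth1_isd n (enorm x) (schwartz1_smooth hr.1))).
by rewrite mulrA rmorphM.
Qed.

Lemma oper_continuous T rho : oper T -> schwartz1_pos rho -> continuous (T rho).
Proof.
move=> oT hr x; have [->|x0] := eqVneq x 0; last first.
  elim: oT => {T} [S n cS|T U _ hT _ hU]; last exact: (cvgCD hT hU).
  exact: (cvgCM (coef_continuous cS x0)
    (cvg_comp _ _ (@enorm_continuous R d x) ((schwartz1_smooth hr.1 n).1 _))).
have [J [K [K0 hK]]] := oper_bound 0 1 oT.
have [_ /(_ J)[B hB]] := (schwartz1_sball rho).1 hr.1; have B0 := sball_ge0 hB.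
have KB : 0 < K * B + 1 by rewrite ltr_wpDl// mulr_ge0.
rewrite /continuous_at (oper_at0 oT hr).
apply/(@cvgCP R Rd (nbhs (0 : Rd)) (nbhs_filter _)) => e e0.
have en0 : enorm (0 : Rd) = 0 by apply/eqP; rewrite enorm_eq0.
have /(@cvgrPdist_lt R R^o Rd (nbhs (0 : Rd)) (nbhs_filter _))/(_ (e / (K * B + 1))) :=
  @enorm_continuous R d 0.
rewrite divr_gt0// => /(_ isT); apply: filterS => z; rewrite en0 sub0r normrN.
rewrite ger0_norm ?enorm_ge0// ltr_pdivlMr// => hz.
have := hK rho B hr hB z; rewrite expr0 mul1r expr1 subr0 => /le_lt_trans; apply.
apply: le_lt_trans hz; rewrite mulrC ler_wpM2l ?enorm_ge0//; lra.
Qed.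

Lemma oper_partial T m : oper T -> exists U, oper U /\
  forall rho, schwartz1_pos rho -> partial m (T rho) = U rho.
Proof.
move=> oT; elim: m => [|i m [U [oU hU]]]; first by exists T.
have [U' [oU' hU']] := oper_deriv i oU; exists U'; split=> // rho hr.
by apply: funext => x; rewrite /= (hU rho hr); apply: rderiveEC; exact: hU'.
Qed.

Lemma monom_le_enorm (k : seq 'I_d) x : `|monom k x| <= enorm x ^+ size k.
Proof.
elim: k => [|j k IH]; first by rewrite /monom big_nil normr1.
by rewrite /monom big_cons normrM exprS; apply: ler_pM => //; exact: coord_le_enorm.
Qed.

Lemma oper_schwartz_bound T (k m : seq 'I_d) : oper T -> exists (J : nat) (K : R), 0 <= K /\
  forall rho B, schwartz1_pos rho -> sball J rho B ->
  forall x, nrm ((monom k x)%:C * partial m (T rho) x) <= K * B.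
Proof.
move=> oT; have [U [oU hU]] := oper_partial m oT.
have [J [K [K0 hK]]] := oper_bound (size k) 0 oU; exists J, K; split=> // rho B hr hB x.
rewrite nrmM nrm_real hU// -[leRHS]mulr1; apply: le_trans (hK rho B hr hB x).
by rewrite ler_wpM2r ?nrm_ge0// monom_le_enorm.
Qed.

Lemma oper_schwartz T rho : oper T -> schwartz1_pos rho -> schwartz (T rho).
Proof.
move=> oT hr; split=> [m|k m].
  have [U [oU hU]] := oper_partial m oT; rewrite hU//; split; first exact: oper_continuous.
  by move=> i x; have [U' [_ dU]] := oper_deriv i oU; exists (U' rho x); exact: dU.
have [J [K [K0 hK]]] := oper_schwartz_bound k m oT.
have [_ /(_ J)[B hB]] := (schwartz1_sball rho).1 hr.1.
by apply/tvs_boundedC; exists (K * B) => x; exact: hK.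
Qed.

End RadialCalculus.

Section RadialLift.
Context {R : realType} {d : nat}.
Local Notation C := (R[i]^o).
Local Notation Rd := 'rV[R]_d.
Implicit Types (psi : Rd -> C) (rho : R -> C) (B : R).

Definition radial_lift psi rho : Rd -> C := fun x =>
  (enorm x ^ (1 - d%:Z))%:C * rho (enorm x) * psi ((enorm x)^-1 *: x).

Lemma coef_exp (Psi : Rd -> C) S n : coef Psi S -> coef Psi (fun x => S x ^+ n).
Proof.
move=> cS; elim: n => [|n IH].
  by rewrite (_ : (fun _ => _) = fun=> 1); [exact: coef_cst|apply: funext => x; rewrite expr0].
rewrite (_ : (fun _ => _) = fun x => S x * S x ^+ n); first exact: coef_mul.
by apply: funext => x; rewrite exprS.
Qed.

Lemma radial_lift_at0 psi rho : schwartz1_pos rho -> radial_lift psi rho 0 = 0.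
Proof.
move=> hr; have e0 : enorm (0 : Rd) = 0 by apply/eqP; rewrite enorm_eq0.
by rewrite /radial_lift e0 -[rho 0]/(nderiv 0 rho 0) (schwartz1_pos_at0 0 hr) mulr0 mul0r.
Qed.

(** For d > 0 the radial factor is the power d - 1 of 1/|x|, a product of generators of [coef]. At
    the origin both sides vanish, because rho does. *)
Lemma radial_lift_oper psi : (0 < d)%N -> smooth_on_sphere psi ->
  exists (Psi : Rd -> C) T, [/\ smooth Psi, oper Psi T &
    forall rho, schwartz1_pos rho -> radial_lift psi rho = T rho].
Proof.
move=> d0 [Psi sPsi hPsi].
exists Psi, (fun rho x => ((((enorm x)^-1)%:C ^+ d.-1) * partial [::] Psi ((enorm x)^-1 *: x))
  * nderiv 0 rho (enorm x)); split; first exact: sPsi.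
  apply: oper_term; apply: coef_mul; last exact: coef_angle.
  by apply: coef_exp; exact: coef_inv.
move=> rho hr; apply: funext => x; have [->|x0] := eqVneq x 0.
  have e0 : enorm (0 : Rd) = 0 by apply/eqP; rewrite enorm_eq0.
  by rewrite radial_lift_at0// e0 schwartz1_pos_at0// mulr0.
rewrite /radial_lift /= hPsi ?/sphere /= ?enorm_normalize// mulrAC; congr (_ * _ * _).
rewrite -rmorphXn; congr (_%:C); case: d d0 x x0 => // d' _ x x0.
have -> : 1 - d'.+1%:Z = - d'%:Z :> int by rewrite -addn1 PoszD opprD addrCA subrr addr0.
by rewrite -exprnN exprVn.
Qed.

Lemma radial_lift_schwartz psi rho : (0 < d)%N -> smooth_on_sphere psi ->
  schwartz1_pos rho -> schwartz (radial_lift psi rho).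
Proof.
move=> d0 /(radial_lift_oper d0)[Psi [T [sPsi oT hT]]] hr.
by rewrite (hT rho hr); exact: (oper_schwartz sPsi oT hr).
Qed.

Lemma radial_lift_bound psi (k m : seq 'I_d) : (0 < d)%N -> smooth_on_sphere psi ->
  exists (J : nat) (K : R), 0 <= K /\
  forall rho B, schwartz1_pos rho -> sball J rho B ->
  forall x, nrm ((monom k x)%:C * partial m (radial_lift psi rho) x) <= K * B.
Proof.
move=> d0 /(radial_lift_oper d0)[Psi [T [sPsi oT hT]]].
have [J [K [K0 hK]]] := oper_schwartz_bound sPsi k m oT.
exists J, K; split; [exact: K0|move=> rho B hr hB x].
by rewrite (hT rho hr); exact: hK.
Qed.

Lemma radial_lift_supp psi rho (V : set Rd) x : open_cone V ->
  sphere_test (V `&` @sphere R d) psi -> schwartz1_pos rho ->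
  radial_lift psi rho x != 0 -> V x.
Proof.
move=> [_ cV] [_ sV] hr; have [->|x0] := eqVneq x 0; first by rewrite radial_lift_at0// eqxx.
rewrite mulf_eq0 negb_or => /andP[_ px].
have x1 := enorm_normalize x0.
have [Vw _] : (V `&` @sphere R d) ((enorm x)^-1 *: x) by apply: sV; exact: subset_closure.
have ex : 0 < enorm x by rewrite enorm_gt0.
by have := cV _ _ ex Vw; rewrite scalerA mulfV ?gt_eqF// scale1r.
Qed.

End RadialLift.

(** * Series in a Frechet space *)

Section FrechetSeries.
Context {R : realType} {X : tvsType R[i]}.
Local Notation C := (R[i]^o).
Implicit Types (v w l : X).

Lemma seminormZ (q : X -> R) (s : R[i]) v : seminorm q -> q (s *: v) = nrm s * q v.
Proof. by move=> [_ _ /(_ s v)]; rewrite normcNc -rmorphM => /complexI. Qed.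

Lemma seminorm0 (q : X -> R) : seminorm q -> q 0 = 0.
Proof. by move=> sq; rewrite -(scale0r (0 : X)) seminormZ// nrm0 mul0r. Qed.

Lemma seminormN (q : X -> R) v : seminorm q -> q (- v) = q v.
Proof. by move=> sq; rewrite -scaleN1r seminormZ// nrmN nrm1 mul1r. Qed.

Lemma seminorm_sum (q : X -> R) (I : Type) (r : seq I) (f : I -> X) : seminorm q ->
  q (\sum_(i <- r) f i) <= \sum_(i <- r) q (f i).
Proof.
move=> sq; elim/big_rec2 : _ => [|i y x _ h]; first by rewrite seminorm0.
by have [_ qD _] := sq; apply: (le_trans (qD _ _)); rewrite lerD2l.
Qed.

Variable q : nat -> X -> R.
Hypothesis sq : forall n, seminorm (q n).
Hypothesis nq : forall U : set X, nbhs 0 U <->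
  exists (N : nat) (eps : R), 0 < eps /\ [set x | forall n, (n <= N)%N -> q n x < eps] `<=` U.

Lemma cvg_seminormP (T : Type) (F : set_system T) {FF : Filter F} (f : T -> X) l :
  f @ F --> l <-> forall i (e : R), 0 < e -> \forall t \near F, q i (f t - l) < e.
Proof.
split=> [h i e e0|h U Ul].
  have U0 : nbhs 0 [set x | q i x < e] by apply/nq; exists i, e; split=> // x; exact.
  have H : F (f @^-1` (+%R l @` [set x | q i x < e])) := h _ (nbhsT l U0).
  apply: filterS H => t [x /= qx <-].
  by rewrite addrAC subrr add0r.
have := nbhsB (- l) Ul; rewrite addNr => /nq[N [e [e0 he]]].
have : \forall t \near F, forall i : 'I_N.+1, q i (f t - l) < e.
  by apply: filter_forall => i; exact: h.
apply: filterS => t ht; have [|u Uu] := he (f t - l).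
  by move=> n nN; have nN' : (n < N.+1)%N by []; exact: (ht (Ordinal nN')).
by rewrite addrC => /addIr hu; rewrite /= -hu.
Qed.

Lemma seminorm_limit_le (T : Type) (F : set_system T) {FF : ProperFilter F} (f : T -> X) l v i (K : R) :
  f @ F --> l -> (\forall t \near F, q i (f t - v) <= K) -> q i (l - v) <= K.
Proof.
move=> /cvg_seminormP h hK; apply/ler_addgt0Pr => e e0.
have [t [h1 h2]] := filter_ex (filterI (h i e e0) hK).
have [_ qD _] := sq i; have -> : l - v = (f t - v) + - (f t - l) by rewrite opprB [RHS]addrC addrA subrK.
by apply: (le_trans (qD _ _)); rewrite seminormN// lerD// ltW.
Qed.

Lemma cvg_lin (T : Type) (F : set_system T) {FF : Filter F} (f g : T -> X) l l' (s : R[i]) :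
  f @ F --> l -> g @ F --> l' -> (s *: f t + g t) @[t --> F] --> s *: l + l'.
Proof.
move=> /cvg_seminormP hf /cvg_seminormP hg; apply/cvg_seminormP => i e e0.
have s1 : 0 < 2 * (nrm s + 1) by rewrite mulr_gt0// ltr_wpDl// nrm_ge0.
have e2 : 0 < e / 2 by lra.
near=> t.
have h1 : q i (f t - l) < e / (2 * (nrm s + 1)) by near: t; apply: hf; exact: divr_gt0.
have h2 : q i (g t - l') < e / 2 by near: t; exact: hg.
have [_ qD _] := sq i; rewrite opprD addrACA -scalerBr; apply: (le_lt_trans (qD _ _)).
rewrite seminormZ//; rewrite ltr_pdivlMr// in h1.
have q0 : 0 <= q i (f t - l) by have [q0 _ _] := sq i.
have n0 := nrm_ge0 s; move: h1; rewrite mulrC; lra.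
Unshelve. all: by end_near. Qed.

Hypothesis hX : hausdorff_space X.
Hypothesis completeX : forall u : nat -> X, tvs_cauchy u -> exists l : X, u @ \oo --> l.
Variable c : nat -> X.

Definition wsum (s : nat -> C) (N : nat) : X := \sum_(n < N) (s n : R[i]) *: c n.

Definition is_vsum (s : nat -> C) l : Prop := wsum s N @[N --> \oo] --> l.

Lemma is_vsum_unique s l l' : is_vsum s l -> is_vsum s l' -> l = l'.
Proof. by move=> h h'; exact: (cvg_unique _ h h'). Qed.

Lemma wsum_lin (a : R[i]) s s' N :
  wsum (fun n => (a : C) * s n + s' n) N = a *: wsum s N + wsum s' N.
Proof.
rewrite /wsum scaler_sumr -big_split; apply: eq_bigr => n _ /=.
by rewrite scalerA -scalerDl.
Qed.

Lemma is_vsum_lin (a : R[i]) s s' l l' : is_vsum s l -> is_vsum s' l' ->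
  is_vsum (fun n => (a : C) * s n + s' n) (a *: l + l').
Proof.
move=> h h'; rewrite /is_vsum; under eq_fun do rewrite wsum_lin.
exact: cvg_lin.
Qed.

(** Geometric domination of the terms s_n c_n in every seminorm. The constants K will be shared by a
    whole family of coefficient sequences, which makes the tails uniformly small. *)
Definition vdom (K : nat -> R) (s : nat -> C) : Prop :=
  forall i n, nrm (s n) * q i (c n) <= K i * 2^-1 ^+ n.

Lemma vdom_ge0 K s i : vdom K s -> 0 <= K i.
Proof.
move=> /(_ i 0%N); rewrite expr0 mulr1; apply: le_trans.
by rewrite mulr_ge0 ?nrm_ge0//; case: (sq i).
Qed.

Lemma wsum_cauchy K s i N M : vdom K s -> (N <= M)%N ->
  q i (wsum s M - wsum s N) <= 2 * K i * 2^-1 ^+ N.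
Proof.
move=> hK NM; have K0 := vdom_ge0 i hK.
(* Keeping the negative term makes the bound telescope, so that induction on M applies. *)
suff : q i (wsum s M - wsum s N) <= 2 * K i * (2^-1 ^+ N - 2^-1 ^+ M).
  move=> /le_trans; apply; rewrite ler_wpM2l ?mulr_ge0// gerBl.
  by apply: exprn_ge0; rewrite invr_ge0.
elim: M NM => [|M IH].
  by rewrite leqn0 => /eqP ->; rewrite !subrr seminorm0// mulr0.
rewrite leq_eqVlt => /predU1P[->|NM]; first by rewrite !subrr seminorm0// mulr0.
have [_ qD _] := sq i.
have -> : wsum s M.+1 - wsum s N = (wsum s M - wsum s N) + (s M : R[i]) *: c M.
  by rewrite /wsum big_ord_recr /= addrAC.
apply: (le_trans (qD _ _)); rewrite seminormZ//.
have := IH NM; have := hK i M; rewrite exprS; lra.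
Qed.

Lemma vsum_le K s l i N : vdom K s -> is_vsum s l -> q i (l - wsum s N) <= 2 * K i * 2^-1 ^+ N.
Proof.
move=> hK hl; apply: (seminorm_limit_le hl); exists N => // M NM; exact: wsum_cauchy.
Qed.

Lemma geometric_small (K e : R) : 0 < e -> exists N : nat, K * 2^-1 ^+ N < e.
Proof.
move=> e0; have : (K * 2^-1 ^+ N) @[N --> \oo] --> (K * 0 : R).
  apply: cvgM; first exact: cvg_cst.
  by apply: cvg_expr; rewrite ger0_norm ?invr_ge0//; lra.
rewrite mulr0 => /cvgrPdist_lt/(_ e e0)[N _ /(_ N (leqnn N))] /=.
by rewrite sub0r normrN => h; exists N; exact: le_lt_trans (ler_norm _) h.
Qed.

Lemma vsum_exists K s : vdom K s -> exists l, is_vsum s l.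
Proof.
move=> hK; apply: completeX => U /nq[N [e [e0 he]]].
have [M hM] := geometric_small (\sum_(i < N.+1) 2 * (2 * K i)) e0.
exists M => m n Mm Mn; apply: he => i iN.
have iN' : (i < N.+1)%N by [].
apply: le_lt_trans hM; have [_ qD _] := sq i.
have -> : wsum s m - wsum s n = (wsum s m - wsum s M) + - (wsum s n - wsum s M).
  by rewrite opprB addrA subrK.
apply: (le_trans (qD _ _)); rewrite seminormN//.
have := wsum_cauchy i hK Mm; have := wsum_cauchy i hK Mn.
have : 2 * (2 * K i) * 2^-1 ^+ M <= (\sum_(i < N.+1) 2 * (2 * K i)) * 2^-1 ^+ M.
  rewrite ler_wpM2r ?exprn_ge0 ?invr_ge0// (bigD1 (Ordinal iN'))//= lerDl.
  by apply: sumr_ge0 => j _; rewrite !mulr_ge0// (vdom_ge0 j hK).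
lra.
Qed.

(** Dominated convergence for vector series: the tails are uniformly small and the remaining finite
    sum converges term by term. It yields both continuity and termwise differentiation. *)
Lemma vsum_exchange (T : Type) (F : set_system T) {FF : Filter F} K
    (s : T -> nat -> C) (s0 : nat -> C) (l : T -> X) l0 :
  (forall t, vdom K (s t)) -> vdom K s0 -> (forall n, s t n @[t --> F] --> s0 n) ->
  (forall t, is_vsum (s t) (l t)) -> is_vsum s0 l0 -> l t @[t --> F] --> l0.
Proof.
move=> hK hK0 hs hl hl0; apply/cvg_seminormP => i e e0.
have e2 : 0 < e / 2 by lra.
have [N hN] := geometric_small (2 * (2 * K i)) e2.
pose Q := \sum_(n < N) q i (c n).
have Q0 : 0 <= Q by apply: sumr_ge0 => n _; case: (sq i).
have d0 : 0 < e / (2 * (Q + 1)) by rewrite divr_gt0// mulr_gt0// ltr_wpDl.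
near=> t.
have ht : forall n : 'I_N, nrm (s t n - s0 n) < e / (2 * (Q + 1)).
  near: t; apply: filter_forall => n; have /cvgCP := hs n; exact.
have [_ qD _] := sq i.
have -> : l t - l0 = ((l t - wsum (s t) N) + - (l0 - wsum s0 N)) + (wsum (s t) N - wsum s0 N).
  by rewrite opprB -addrA [_ - l0 + _]addrC !subrKA.
apply: (le_lt_trans (qD _ _)).
have h1 : q i ((l t - wsum (s t) N) + - (l0 - wsum s0 N)) <= 2 * (2 * K i) * 2^-1 ^+ N.
  apply: (le_trans (qD _ _)); rewrite seminormN//.
  have := vsum_le i N (hK t) (hl t); have := vsum_le i N hK0 hl0; lra.
have h2 : q i (wsum (s t) N - wsum s0 N) <= e / (2 * (Q + 1)) * Q.
  rewrite /wsum -sumrB; apply: (le_trans (seminorm_sum _ _ (sq i))).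
  rewrite mulr_sumr; apply: ler_sum => n _.
  rewrite -scalerBl seminormZ// ler_wpM2r ?(ltW (ht n))//; by case: (sq i).
have h3 : e / (2 * (Q + 1)) * Q <= e / 2.
  rewrite mulrAC ler_pdivrMr ?mulr_gt0 ?ltr_wpDl//.
  have -> : e / 2 * (2 * (Q + 1)) = e * Q + e by field.
  lra.
lra.
Unshelve. all: by end_near. Qed.

Lemma seminorm_bounded (T : Type) (u : T -> X) :
  (forall i, exists K : R, forall t, q i (u t) <= K) -> tvs_bounded (range u).
Proof.
move=> /choice[K hK] U /nq[N [e [e0 he]]].
have S i : (i <= N)%N -> K i <= \sum_(j < N.+1) `|K j|.
  move=> iN; have iN' : (i < N.+1)%N by [].
  by rewrite (bigD1 (Ordinal iN'))//= (le_trans (ler_norm _))// lerDl sumr_ge0.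
pose M := (\sum_(j < N.+1) `|K j|) / e.
near=> t => _ [x _ <-].
have t0 : 0 < t by near: t; exact: nbhs_pinfty_gt.
have tK : M < t by near: t; apply: nbhs_pinfty_gt; exact: num_real.
have tn0 : (t%:C : R[i]) != 0 by rewrite eq_complex /= gt_eqF.
exists ((t%:C)^-1 *: u x); last by rewrite scalerA mulfV// scale1r.
apply: he => i iN; rewrite seminormZ// Normc.normcV nrm_real gtr0_norm// mulrC.
rewrite ltr_pdivrMr//; rewrite /M ltr_pdivrMr// mulrC in tK.
by apply: le_lt_trans tK; apply: le_trans (S i iN); exact: hK.
Unshelve. all: by end_near. Qed.

Lemma continuous_functional_bound (x' : {linear X -> C}) : continuous x' ->
  exists (N : nat) (K : R), 0 <= K /\ forall v (b : R), (forall i, (i <= N)%N -> q i v <= b) ->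
    nrm (x' v) <= K * b.
Proof.
move=> cx; have : nbhs (0 : X) [set v | nrm (x' v) < 1].
  have H : nbhs (0 : X) (x' @^-1` [set z | nrm (z - x' 0) < 1]).
    apply: cx; have /cvgCP/(_ 1 ltr01) := @cvg_id C (nbhs (x' 0)); exact.
  by apply: filterS H => v; rewrite /= linear0 subr0.
move=> /nq[N [e [e0 he]]].
exists N, (2 / e); split; first by rewrite divr_ge0// ltW.
move=> v b hb; have b0 : 0 <= b by apply: le_trans (hb 0%N isT); case: (sq 0).
apply/ler_addgt0Pr => d d0.
(* A scale slightly above b, positive even when b = 0. *)
pose t : R := b + d * e / 2.
have t0 : 0 < t by rewrite ltr_wpDl// divr_gt0// mulr_gt0.
have : nrm (x' ((e / 2 / t)%:C *: v)) < 1.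
  apply: he => i iN; rewrite seminormZ// nrm_real gtr0_norm ?divr_gt0//.
  have h1 : q i v < t by apply: (le_lt_trans (hb i iN)); rewrite ltrDl divr_gt0// mulr_gt0.
  apply: (@le_lt_trans _ _ (e / 2)); last lra.
  by rewrite mulrAC ler_pdivrMr// ler_wpM2l ?divr_ge0// ltW.
have -> : x' ((e / 2 / t)%:C *: v) = (e / 2 / t)%:C * x' v by rewrite linearZ.
rewrite nrmM nrm_real gtr0_norm ?divr_gt0//.
rewrite mulrAC ltr_pdivrMr// mul1r => h.
have : e / 2 * nrm (x' v) <= e / 2 * (2 / e * b + d).
  rewrite mulrDr mulrA -[e / 2 * (2 / e)](_ : 1 = _); last by field; rewrite gt_eqF.
  by move: h; rewrite /t mul1r; lra.
by rewrite ler_pM2l ?divr_gt0.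
Qed.

End FrechetSeries.

Section SchwartzFunctions.
Context {R : realType} {d : nat}.
Local Notation C := (R[i]^o).
Local Notation Rd := 'rV[R]_d.
Local Notation e_ j := (delta_mx 0 j : Rd).
Implicit Types (f g : Rd -> C).

Lemma smooth_isd f m j (x : Rd) : smooth f -> isd (e_ j) (partial m f) x (partial (j :: m) f x).
Proof. by move=> sf; exact: rderivableE ((sf m).2 j x). Qed.

Lemma partial_lin (a : R[i]) f g m : smooth f -> smooth g ->
  partial m (a *: f + g) = a *: partial m f + partial m g.
Proof.
move=> sf sg; elim: m => // j m IH; apply: funext => x; rewrite /= IH !linfunE.
by apply: rderiveEC; apply: isdD; [apply: isdZ|]; exact: smooth_isd.
Qed.

Lemma smooth_lin (a : R[i]) f g : smooth f -> smooth g -> smooth (a *: f + g).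
Proof.
move=> sf sg m; rewrite partial_lin// linfunE; split.
  move=> x; apply: (@cvgCD R Rd (nbhs x) (nbhs_filter x)); last exact: (sg m).1 x.
  apply: (@cvgCM R Rd (nbhs x) (nbhs_filter x)); last exact: (sf m).1 x.
  exact: cvg_cst.
move=> j x; exists (a * partial (j :: m) f x + partial (j :: m) g x).
by apply: isdD; [apply: isdZ|]; exact: smooth_isd.
Qed.

Lemma schwartz_lin (a : R[i]) f g : schwartz f -> schwartz g -> schwartz (a *: f + g).
Proof.
move=> [sf hf] [sg hg]; split; first exact: smooth_lin.
move=> k m; apply/tvs_boundedC.
have /tvs_boundedC[M hM] := hf k m; have /tvs_boundedC[M' hM'] := hg k m.
exists (nrm a * M + M') => x; rewrite partial_lin//.
have -> : (monom k x)%:C *: ((a *: partial m f + partial m g) x : C) =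
    a * ((monom k x)%:C * partial m f x) + (monom k x)%:C * partial m g x.
  rewrite -[LHS]/((monom k x)%:C * (a * partial m f x + partial m g x)).
  by rewrite mulrDr mulrCA.
apply: (le_trans (nrmD _ _)); rewrite lerD//; last exact: hM'.
by rewrite nrmM ler_wpM2l ?nrm_ge0//; exact: hM.
Qed.

Lemma partial_0 m : partial m (0 : Rd -> C) = 0.
Proof.
elim: m => // j m IH; apply: funext => x; rewrite /= IH.
by apply: rderiveEC; exact: isd_cst.
Qed.

Lemma schwartz_0 : schwartz (0 : Rd -> C).
Proof.
split=> [m|k m]; rewrite partial_0.
  split; first by move=> x; exact: (@cst_continuous Rd C 0 x).
  by move=> j x; exists 0; exact: isd_cst.
apply/tvs_boundedC; exists 0 => x.
by rewrite -[_ *: _]/((monom k x)%:C * 0 : C) mulr0 nrm0.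
Qed.

Variables (P : nat -> Rd -> C) (b : nat -> R[i]).
Hypothesis sP : forall n, schwartz (P n).

Lemma combination_recr N :
  \sum_(n < N.+1) b n *: P n = b N *: P N + \sum_(n < N) b n *: P n.
Proof. by rewrite big_ord_recr [LHS]addrC. Qed.

Lemma schwartz_sum N : schwartz (\sum_(n < N) b n *: P n).
Proof.
elim: N => [|N IH]; first by rewrite big_ord0; exact: schwartz_0.
rewrite combination_recr; exact: (schwartz_lin (b N) (sP N) IH).
Qed.

Lemma partial_sum N m x : partial m (\sum_(n < N) b n *: P n) x =
  \sum_(n < N) (b n : C) * partial m (P n) x.
Proof.
elim: N => [|N IH]; first by rewrite !big_ord0 partial_0.
rewrite combination_recr (partial_lin (b N) m (sP N).1 (schwartz_sum N).1).
by rewrite [RHS]big_ord_recr [RHS]addrC -IH.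
Qed.

Lemma tempered_sum (F : (Rd -> C) -> C) N : tempered F ->
  F (\sum_(n < N) b n *: P n) = \sum_(n < N) (b n : C) * F (P n).
Proof.
move=> [lF _]; elim: N => [|N IH].
  rewrite !big_ord0; have := lF (-1) _ _ schwartz_0 schwartz_0.
  by rewrite scaler0 addr0 mulN1r addNr.
rewrite combination_recr (lF _ _ _ (sP N) (schwartz_sum N)) IH.
by rewrite [RHS]big_ord_recr [RHS]addrC.
Qed.

End SchwartzFunctions.

(** There are finitely many words of bounded length, so thresholds that exist for each word have a
    common upper bound. *)
Lemma finite_words (d : nat) (N : nat) (p : seq 'I_d -> nat -> Prop) :
  (forall k, exists M, forall n, (M <= n)%N -> p k n) ->
  exists M, forall k, (size k <= N)%N -> forall n, (M <= n)%N -> p k n.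
Proof.
elim: N p => [|N IH] p hp.
  by have [M hM] := hp [::]; exists M => -[|//] _.
have /choice[M hM] : forall j, exists M, forall k, (size k <= N)%N -> forall n, (M <= n)%N -> p (j :: k) n.
  by move=> j; apply: (IH (fun k n => p (j :: k) n)) => k; exact: hp.
have [M0 hM0] := hp [::].
exists (maxn M0 (\max_j M j)) => -[_ n|j k kN n]; rewrite geq_max => /andP[h1 h2]; first exact: hM0.
by apply: hM => //; apply: leq_trans h2; exact: leq_bigmax.
Qed.

(** It transfers domination from the series of derivatives to the difference quotients, for every h,
    including h = 0, where the quotient is 0 by convention. *)
Lemma diff_quot_bound (R : realType) (E : lmodType R) (v : E) (f g : E -> R[i]^o) (M : R) :
  (forall z, isd v f z (g z)) -> (forall z, nrm (g z) <= M) ->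
  forall x h, nrm (diff_quot v f x h) <= M.
Proof.
move=> dF hM x h; have M0 := le_trans (nrm_ge0 _) (hM x).
have [->|h0] := eqVneq h 0.
  by rewrite /diff_quot invr0 scale0r nrm0.
have dL s : isd (1 : R^o) (fun t : R => f (x + t *: v)) s (g (x + s *: v)).
  exact: isd_line.
have : nrm (f (x + h *: v) - f x) <= M * `|h|.
  have -> : f x = f (x + 0 *: v) by rewrite scale0r addr0.
  have [hp|/ltW hn] := leP 0 h.
    rewrite ger0_norm// -[X in _ * X]subr0.
    by apply: (@complex_lipschitz R (fun t : R => f (x + t *: v)) (fun t : R => g (x + t *: v))) => // s _; exact: dL.
  rewrite nrmBC ler0_norm// -[X in _ * X]add0r.
  by apply: (@complex_lipschitz R (fun t : R => f (x + t *: v)) (fun t : R => g (x + t *: v))) => // s _; exact: dL.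
have hp : 0 < `|h| by rewrite normr_gt0.
rewrite -[diff_quot v f x h]/((h^-1)%:C * (f (x + h *: v) - f x)).
by rewrite nrmM nrm_real normfV ler_pdivrMl// mulrC.
Qed.

(** * Schwartz functions defined by vector-valued series *)

Section SmoothSeries.
Context {R : realType} {d : nat} {X : tvsType R[i]}.
Local Notation C := (R[i]^o).
Local Notation Rd := 'rV[R]_d.
Local Notation e_ j := (delta_mx 0 j : Rd).
Variable q : nat -> X -> R.
Hypothesis sq : forall n, seminorm (q n).
Hypothesis nq : forall U : set X, nbhs 0 U <->
  exists (N : nat) (eps : R), 0 < eps /\ [set x | forall n, (n <= N)%N -> q n x < eps] `<=` U.
Hypothesis hX : hausdorff_space X.
Hypothesis completeX : forall u : nat -> X, tvs_cauchy u -> exists l : X, u @ \oo --> l.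
Variables (c : nat -> X) (P : nat -> Rd -> C).
Hypothesis sP : forall n, schwartz (P n).
Hypothesis domP : forall k m : seq 'I_d, exists K : nat -> R, forall x : Rd,
  vdom q c K (fun n => (monom k x)%:C * partial m (P n) x).

Lemma domP0 m : exists K : nat -> R, forall x : Rd, vdom q c K (fun n => partial m (P n) x).
Proof.
have [K hK] := domP [::] m; exists K => x i n.
by have := hK x i n; rewrite /monom big_nil rmorph1 mul1r.
Qed.

Definition series_partial m (x : Rd) : X :=
  xget 0 [set l | is_vsum c (fun n => partial m (P n) x) l].

Lemma series_partialP m x : is_vsum c (fun n => partial m (P n) x) (series_partial m x).
Proof.
have [K hK] := domP0 m; have [l hl] := vsum_exists sq nq completeX (hK x).
exact: (@xgetPex _ 0 [set l | is_vsum c (fun n => partial m (P n) x) l]) (ex_intro _ l hl).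
Qed.

Lemma is_vsum0 : is_vsum c (fun=> 0) 0.
Proof.
rewrite /is_vsum (_ : wsum c _ = fun=> 0); first exact: cvg_cst.
by apply: funext => N; rewrite /wsum big1// => n _; rewrite scale0r.
Qed.

Lemma is_vsumZ (a : R[i]) s l : is_vsum c s l -> is_vsum c (fun n => (a : C) * s n) (a *: l).
Proof.
move=> h; have := is_vsum_lin sq nq (a := a) h is_vsum0; rewrite addr0.
by rewrite (_ : (fun n => _ + 0) = fun n => (a : C) * s n)//; apply: funext => n; rewrite addr0.
Qed.

Lemma series_continuous m : continuous (series_partial m).
Proof.
move=> x; have [K hK] := domP0 m.
apply: (@vsum_exchange R X q sq nq c Rd (nbhs x) (nbhs_filter x) K
  (fun z n => partial m (P n) z) _ _ _ hK (hK x)).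
- by move=> n; exact: ((sP n).1 m).1.
- by move=> z; exact: series_partialP.
- exact: series_partialP.
Qed.

Lemma series_isd m j x : isd (e_ j) (series_partial m) x (series_partial (j :: m) x).
Proof.
have [K hK] := domP0 (j :: m).
apply: (vsum_exchange sq nq (c := c) (K := K)
  (s := fun h n => diff_quot (e_ j) (partial m (P n)) x h)
  (s0 := fun n => partial (j :: m) (P n) x)).
- move=> h i n; have Q0 : 0 <= q i (c n) by case: (sq i).
  (* The bound on the derivative is obtained by dividing by this seminorm, so a vanishing value is
     treated apart. *)
  have [Q|Q] := eqVneq (q i (c n)) 0.
    by rewrite Q mulr0; have := hK x i n; rewrite Q mulr0.
  have Qp : 0 < q i (c n) by rewrite lt_def Q.
  rewrite -ler_pdivlMr//; apply: (@diff_quot_bound _ _ _ _ (partial (j :: m) (P n))).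
    by move=> z; apply: smooth_isd; case: (sP n).
  by move=> z; rewrite ler_pdivlMr//; exact: hK.
- exact: hK.
- by move=> n; apply: smooth_isd; case: (sP n).
- move=> h; have H := is_vsumZ (a := (h^-1)%:C) (is_vsum_lin sq nq (a := -1)
    (@series_partialP m x) (@series_partialP m (x + h *: e_ j))).
  rewrite (_ : (fun n => diff_quot _ _ _ _) = fun n => ((h^-1)%:C : C) *
      (-1 * partial m (P n) x + partial m (P n) (x + h *: e_ j))); last first.
    by apply: funext => n; rewrite mulN1r [in RHS]addrC.
  rewrite (_ : diff_quot (e_ j) (series_partial m) x h = (h^-1)%:C *:
    (-1 *: series_partial m x + series_partial m (x + h *: e_ j))); first exact: H.
  by rewrite scaleN1r [in RHS]addrC.
- exact: series_partialP.
Qed.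

Lemma partial_series m : partial m (series_partial [::]) = series_partial m.
Proof.
elim: m => // j m IH; apply: funext => x; rewrite /= IH.
by apply: (rderiveE hX); exact: series_isd.
Qed.

Lemma series_monom_le k m : exists K : nat -> R, forall i (x : Rd) N,
  q i ((monom k x)%:C *: (series_partial m x - wsum c (fun n => partial m (P n) x) N))
  <= 2 * K i * 2^-1 ^+ N.
Proof.
have [K hK] := domP k m; exists K => i x N.
have := vsum_le sq nq i N (hK x) (is_vsumZ (a := (monom k x)%:C) (@series_partialP m x)).
congr (q i _ <= _); rewrite scalerBr; congr (_ - _).
by rewrite /wsum scaler_sumr; apply: eq_bigr => n _; rewrite scalerA.
Qed.

Lemma series_schwartz : schwartz (series_partial [::]).
Proof.
split=> [m|k m]; rewrite partial_series.
  split; first exact: series_continuous.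
  by move=> j x; exists (series_partial (j :: m) x); exact: series_isd.
apply: (seminorm_bounded sq nq) => i; have [K hK] := series_monom_le k m.
exists (2 * K i) => x; have := hK i x 0%N.
by rewrite expr0 mulr1 /wsum big_ord0 subr0.
Qed.

Lemma series_supp (V : set Rd) : (forall n x, P n x != 0 -> V x) ->
  supp (series_partial [::]) `<=` closure V.
Proof.
move=> hV; apply: closure_subset => x /= hx; apply: contrapT => nV.
move/eqP: hx; apply.
apply: (is_vsum_unique hX (@series_partialP [::] x)).
rewrite (_ : (fun n => _) = fun=> 0); first exact: is_vsum0.
by apply: funext => n /=; apply/eqP/negPn/negP => /hV.
Qed.

Section Functional.
Variable x' : {linear X -> C}.
Hypothesis cx : continuous x'.

Lemma isd_functional (f : Rd -> X) j x l : isd (e_ j) f x l -> isd (e_ j) (x' \o f) x (x' l).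
Proof.
move=> hf; rewrite /isd (_ : diff_quot _ (x' \o f) x = fun h => x' (diff_quot (e_ j) f x h)).
  exact: (cvg_comp _ _ hf (@cx l)).
by apply: funext => h; rewrite /diff_quot [RHS]linearZ (linearB x').
Qed.

Lemma partial_functional m : partial m (x' \o series_partial [::]) = x' \o series_partial m.
Proof.
elim: m => // j m IH; apply: funext => x; rewrite /= IH.
by apply: rderiveEC; apply: isd_functional; exact: series_isd.
Qed.

Lemma functional_monom_le k m : exists K : R, forall (x : Rd) N,
  nrm ((monom k x)%:C * (x' (series_partial m x) - x' (wsum c (fun n => partial m (P n) x) N)))
  <= K * 2^-1 ^+ N.
Proof.
have [N0 [L [L0 hL]]] := continuous_functional_bound sq nq cx.
have [K hK] := series_monom_le k m.
exists (L * \sum_(i < N0.+1) `|2 * K i|) => x N.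
have -> : (monom k x)%:C * (x' (series_partial m x) - x' (wsum c (fun n => partial m (P n) x) N)) =
   x' ((monom k x)%:C *: (series_partial m x - wsum c (fun n => partial m (P n) x) N)).
  by rewrite linearZ linearB.
rewrite -mulrA; apply: hL => i iN; apply: (le_trans (hK i x N)).
have iN' : (i < N0.+1)%N by [].
rewrite ler_wpM2r ?exprn_ge0 ?invr_ge0// (bigD1 (Ordinal iN'))//=.
by apply: (le_trans (ler_norm _)); rewrite lerDl sumr_ge0.
Qed.

Lemma functional_schwartz : schwartz (x' \o series_partial [::]).
Proof.
split=> [m|k m]; rewrite partial_functional.
  split; first by move=> x; exact: (cvg_comp _ _ (@series_continuous m x) (@cx _)).
  by move=> j x; exists (x' (series_partial (j :: m) x)); apply: isd_functional; exact: series_isd.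
apply/tvs_boundedC; have [K hK] := functional_monom_le k m; exists K => x.
by have := hK x 0%N; rewrite expr0 mulr1 /wsum big_ord0 linear0 subr0.
Qed.

Lemma functional_wsum m x N : x' (wsum c (fun n => partial m (P n) x) N) =
  partial m (\sum_(n < N) x' (c n) *: P n) x.
Proof.
rewrite (partial_sum (fun n => x' (c n)) sP) /wsum linear_sum; apply: eq_bigr => n _.
by rewrite linearZ mulrC.
Qed.

(** The composition of x' with the sum is the limit in S(R^d) of finite combinations of the P_n, on
    which F is eventually equal to a; continuity of F concludes. *)
Lemma series_pairing (F : (Rd -> C) -> C) (N0 : nat) (a : C) : tempered F ->
  (forall N, (N0 <= N)%N -> \sum_(n < N) x' (c n) * F (P n) = a) ->
  F (x' \o series_partial [::]) = a.
Proof.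
move=> tF hN; apply/eqP; rewrite eq_sym -subr_eq0; apply/eqP/nrm_eq0/le_anti.
rewrite nrm_ge0 andbT; apply/ler_addgt0Pr => e e0; rewrite add0r.
have [N [de [de0 hde]]] := tF.2 _ functional_schwartz e e0.
pose S n := \sum_(k < n) x' (c k) *: P k.
pose p k m n := forall x, nrm ((monom k x)%:C * (x' (series_partial m x) -
      x' (wsum c (fun n => partial m (P n) x) n))) <= de.
have [M hM] : exists M, forall k, (size k <= N)%N -> forall n, (M <= n)%N ->
    forall m, (size m <= N)%N -> p k m n.
  apply: (@finite_words d N (fun k n => forall m, (size m <= N)%N -> p k m n)) => k.
  have [M hM] : exists M, forall m, (size m <= N)%N -> forall n, (M <= n)%N -> p k m n.
    apply: finite_words => m.
    have [K hK] := functional_monom_le k m.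
    have [M hM] := geometric_small `|K| de0.
    exists M => n Mn x; apply: (le_trans (hK x n)); apply: le_trans (ltW hM).
    apply: (@le_trans _ _ (`|K| * 2^-1 ^+ n)).
      by rewrite ler_wpM2r ?exprn_ge0 ?invr_ge0// ler_norm.
    by rewrite ler_wpM2l// ler_wiXn2l ?invr_ge0//; lra.
  by exists M => n Mn m mN; exact: hM.
have : schwartz_nbhd N de (x' \o series_partial [::]) (S (maxn M N0)).
  split; first exact: (schwartz_sum (fun n => x' (c n)) sP).
  move=> k m kN mN x; rewrite normcNc lecR.
  rewrite [S _ - _]addrC -scaleN1r partial_lin; last 2 first.
  - exact: functional_schwartz.1.
  - exact: (schwartz_sum (fun n => x' (c n)) sP _).1.
  have := hM k kN _ (leq_maxl M N0) m mN x.
  rewrite functional_wsum linfunE partial_functional mulN1r -nrmN -mulrN opprB.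
  by rewrite [- _ + _]addrC.
move=> /hde; rewrite (tempered_sum (fun n => x' (c n)) sP _ tF) hN ?leq_maxr//.
by rewrite normcNc ltcR => /ltW.
Qed.

End Functional.

End SmoothSeries.

(** * Solution of the moment problem *)

Lemma strong_recursion (T : Type) (t0 : T) (step : nat -> (nat -> T) -> T) :
  (forall n u v, (forall k, (k < n)%N -> u k = v k) -> step n u = step n v) ->
  exists c : nat -> T, forall n, c n = step n c.
Proof.
move=> local.
(* [u n] is a table whose entries below n are final; the sequence is read off along the diagonal. *)
pose u := fix u n : nat -> T := if n is m.+1 then
  (fun k => if (k < m)%N then u m k else step m (u m)) else (fun=> t0).
have stable n k : (k < n)%N -> u n k = u k.+1 k.
  elim: n => // n IH; rewrite ltnS leq_eqVlt => /predU1P[->//|kn].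
  by rewrite -(IH kn) /= kn.
exists (fun n => u n.+1 n) => n; rewrite /= ltnn; apply: local => k; exact: stable.
Qed.

Section Solution.
Context {R : realType} {d : nat} {X : tvsType R[i]}.
Local Notation C := (R[i]^o).
Local Notation Rd := 'rV[R]_d.
Hypothesis hd : (0 < d)%N.
Variable q : nat -> X -> R.
Hypothesis sq : forall n, seminorm (q n).
Variables (psi : Rd -> C) (c : nat -> X) (rho : nat -> R -> C) (nu : nat -> nat).
Hypothesis spsi : smooth_on_sphere psi.
Hypothesis rho_pos : forall n, schwartz1_pos (rho n).

(* Small enough for [rate n v * q i v <= 2^-n] whenever [i <= n]. *)
Definition rate n (v : X) : R := 2^-1 ^+ n / (1 + \sum_(i < n.+1) q i v).

Let sum_ge0 n v : 0 <= \sum_(i < n.+1) q i v.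
Proof. by apply: sumr_ge0 => i _; case: (sq i). Qed.

Lemma rate_gt0 n v : 0 < rate n v.
Proof. by rewrite divr_gt0 ?exprn_gt0 ?invr_gt0// ltr_pwDl. Qed.

Lemma rate_mul_le n i v : (i <= n)%N -> rate n v * q i v <= 2^-1 ^+ n.
Proof.
move=> iN; have iN' : (i < n.+1)%N by [].
have h0 : 0 < 1 + \sum_(i < n.+1) q i v by rewrite ltr_pwDl.
rewrite /rate mulrAC ler_pdivrMr// ler_wpM2l ?exprn_ge0 ?invr_ge0//.
rewrite (bigD1 (Ordinal iN'))//= addrCA lerDl addr_ge0//.
by apply: sumr_ge0 => j _; case: (sq j).
Qed.

Hypothesis rho_small : forall n j, (j <= n)%N -> (nu j <= n)%N -> sball j (rho n) (rate n (c n)).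

Lemma radial_series_dominated (k m : seq 'I_d) : exists K : nat -> R, forall x : Rd,
  vdom q c K (fun n => (monom k x)%:C * partial m (radial_lift psi (rho n)) x).
Proof.
have q0 i v : 0 <= q i v by case: (sq i).
have [J [K0 [K0_ge0 hK0]]] := radial_lift_bound k m hd spsi.
have /choice[B hB] : forall n, exists M : R, forall x : Rd,
    nrm ((monom k x)%:C * partial m (radial_lift psi (rho n)) x) <= M.
  by move=> n; have /tvs_boundedC := (radial_lift_schwartz hd spsi (rho_pos n)).2 k m.
have B0 n : 0 <= B n by apply: le_trans (nrm_ge0 _) (hB n 0).
(* From this index on, rho_n is small in the seminorm of order J, and its rate takes the i-th
   seminorm of c_n into account. *)
pose n0 i := maxn (maxn J (nu J)) i.
have t0 i n : 0 <= B n * q i (c n) * 2 ^+ n by rewrite !mulr_ge0// exprn_ge0.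
(* The sum takes care of the finitely many terms without smallness, rescaled by 2^n to fit the
   geometric pattern. *)
exists (fun i => K0 + \sum_(n < n0 i) B n * q i (c n) * 2 ^+ n) => x i n.
have p0 : 0 <= 2^-1 ^+ n :> R by rewrite exprn_ge0 ?invr_ge0.
have [nn0|] := ltnP n (n0 i).
  apply: (@le_trans _ _ (B n * q i (c n))); first by rewrite ler_wpM2r.
  apply: (@le_trans _ _ (B n * q i (c n) * 2 ^+ n * 2^-1 ^+ n)).
    by rewrite -mulrA -exprMn mulfV ?expr1n ?mulr1// pnatr_eq0.
  rewrite ler_wpM2r// (bigD1 (Ordinal nn0))//= addrCA lerDl addr_ge0//.
  by apply: sumr_ge0 => j _; exact: t0.
rewrite !geq_max -andbA => /and3P[Jn nuJn i_n].
apply: (@le_trans _ _ (K0 * rate n (c n) * q i (c n))).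
  by rewrite ler_wpM2r//; apply: hK0; [exact: rho_pos|exact: rho_small].
rewrite -mulrA; apply: (@le_trans _ _ (K0 * 2^-1 ^+ n)).
  by rewrite ler_wpM2l// rate_mul_le.
by rewrite ler_wpM2r// lerDl; apply: sumr_ge0 => j _; exact: t0.
Qed.

End Solution.

Theorem proposition8p1 (R : realType) (d : nat) (hd : (0 < d)%N)
    (V : set 'rV[R]_d) (hV : open_cone V)
    (F : nat -> ('rV[R]_d -> R[i]^o) -> R[i]^o)
    (hF : forall n, tempered (F n))
    (hpsi : exists psi : 'rV[R]_d -> R[i]^o,
      sphere_test (V `&` @sphere R d) psi /\
      exists f : nat -> (R -> R[i]^o) -> R[i]^o,
        [/\ forall n, Splus (f n),
            forall n, extends_radial (f n) (radial (F n) psi),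
            P1 f &
            P2 f])
    (X : tvsType R[i]) (hX : frechet X) (a : nat -> X) :
  exists phi : 'rV[R]_d -> X,
    schwartz_in V phi /\ forall n, pairing_eq (F n) phi (a n).
Proof.
have [psi [tpsi [f [sf ef p1 p2]]]] := hpsi; have spsi := tpsi.1.
have [hausX [q [sq nq]] completeX] := hX.
have [nu hnu] := dual_sequence sf p1 p2.
(* The test function is chosen for every possible vector v beforehand, because c_n is known only in
   the course of the recursion and in turn depends on the earlier choices. *)
have /choice[G hG] : forall n, exists G : X -> R -> R[i]^o, forall v,
    dual_at f n (G v) /\ forall j, (j <= n)%N -> (nu j <= n)%N -> sball j (G v) (rate q n v).
  move=> n; have /choice[G hG] : forall v, exists rho : R -> R[i]^o,
      dual_at f n rho /\ forall j, (j <= n)%N -> (nu j <= n)%N -> sball j rho (rate q n v).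
    by move=> v; exact: hnu (rate_gt0 sq n v).
  by exists G.
have [c hc] : exists c : nat -> X, forall n,
    c n = a n - \sum_(k < n) f n (G k (c k)) *: c k.
  apply: (@strong_recursion X 0 (fun n u => a n - \sum_(k < n) f n (G k (u k)) *: u k)).
  by move=> n u v uv; congr (_ - _); apply: eq_bigr => k _; rewrite uv.
pose rho n := G n (c n).
have rpos n : schwartz1_pos (rho n) by have [[? _ _] _] := hG n (c n).
pose P n := radial_lift psi (rho n).
have sP n : schwartz (P n) by exact: radial_lift_schwartz hd spsi (rpos n).
have domP := radial_series_dominated hd sq spsi rpos (fun n => (hG n (c n)).2).
have FP n k : F n (P k) = f n (rho k) by rewrite (ef n (rho k) (rpos k)).
exists (series_partial c P [::]); split; first split.
- exact: (series_schwartz sq nq hausX completeX sP domP).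
- apply: (series_supp sq nq hausX completeX domP) => n x.
  exact: (radial_lift_supp hV tpsi (rpos n)).
move=> n x' cx'; apply/esym.
apply: (series_pairing sq nq completeX sP domP cx' (N0 := n.+1)) => [|N nN].
  exact: hF.
(* The terms with k > n vanish, since f_n(rho_k) = 0. *)
have -> : \sum_(k < N) x' (c k) * F n (P k) = \sum_(k < n.+1) x' (c k) * F n (P k).
  rewrite [RHS](big_ord_widen _ (fun k => x' (c k) * F n (P k)) nN) big_mkcond [RHS]big_mkcond.
  apply: eq_bigr => k _; case: ltnP => // nk.
  by have [[_ _ h0] _] := hG k (c k); rewrite FP h0// mulr0.
rewrite big_ord_recr /= FP.
(* As f_n(rho_n) = 1, the last term is x'(c_n), and the definition of c_n cancels the preceding
   ones. *)
have [[_ -> _] _] := hG n (c n); rewrite mulr1 [in X in _ + X]hc linearB linear_sum /=.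
rewrite [X in _ + (_ - X)](_ : _ = \sum_(k < n) x' (c k) * F n (P k)); first by rewrite addrC subrK.
by apply: eq_bigr => k _; rewrite linearZ FP mulrC.
Qed.
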